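(* \textsc{Constraint Graph Satisfiability} is weakly $\mathsf{NP}$-complete when restricted to constraint graphs of treewidth $2$; that is, it is $\mathsf{NP}$-hard on constraint graphs of treewidth $2$ when weights are encoded in binary, and it is solvable in pseudo-polynomial time on such graphs.
   Context: A constraint graph is an undirected graph with a positive integer weight on every edge and a nonnegative integer weight (its minimum inflow) on every vertex. A legal configuration is an assignment of an orientation to every edge such that for every vertex, the total weight of the edges oriented into that vertex is at least that vertex's minimum inflow. \textsc{Constraint Graph Satisfiability}: given a constraint graph $G$, does $G$ have a legal configuration? *)

(* Defs.v *)
From mathcomp Require Import all_boot.

Set Implicit Arguments.
Unset Strict Implicit.
Unset Printing Implicit Defensive.

Definition word := seq bool.

Inductive move := Left | Stay | Right.

(* Tapes are infinite in both directions; [None] is the blank symbol. The     *)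
(* tape alphabet is the input alphabet {0,1} extended by the finite type of   *)
(* auxiliary symbols [aux] and the blank.                                     *)
Definition symbol (aux : finType) := option (bool + aux).

(* [lefts] lists the cells to the left of the head, nearest first; all cells  *)
(* beyond the two lists are blank.                                            *)
Record tape (aux : finType) := Tape {
  lefts : seq (symbol aux);
  head_symbol : symbol aux;
  rights : seq (symbol aux) }.

Definition move_head (aux : finType) (m : move) (t : tape aux) : tape aux :=
  let: Tape l a r := t in
  match m with
  | Left => Tape (behead l) (head None l) (a :: r)
  | Stay => t
  | Right => Tape (a :: l) (head None r) (behead r)
  end.

Definition write_move (aux : finType) (am : symbol aux * move) (t : tape aux) :
    tape aux :=
  move_head am.2 (Tape (lefts t) am.1 (rights t)).

(* The head starts on the first letter. *)
Definition tape_of (aux : finType) (w : word) : tape aux :=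
  let s := [seq Some (inl b) | b <- w] in Tape [::] (head None s) (behead s).

Fixpoint bit_prefix (aux : finType) (s : seq (symbol aux)) : word :=
  if s is Some (inl b) :: s' then b :: bit_prefix s' else [::].

Definition word_of (aux : finType) (t : tape aux) : word :=
  bit_prefix (head_symbol t :: rights t).

(* The number of tapes is [extra_tapes.+1], so that tape 0 always exists. *)
Record TM := MkTM {
  extra_tapes : nat;
  aux : finType;
  state : finType;
  start : state;
  halting : pred state;
  accepting : pred state;
  delta : state -> {ffun 'I_extra_tapes.+1 -> symbol aux} ->
          state * {ffun 'I_extra_tapes.+1 -> symbol aux * move} }.

Definition config (M : TM) : Type :=
  state M * {ffun 'I_(extra_tapes M).+1 -> tape (aux M)}.

(* The i-th input word is written on tape i. *)
Definition init (M : TM) (ws : seq word) : config M :=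
  (start M, [ffun i : 'I_(extra_tapes M).+1 => tape_of (aux M) (nth [::] ws i)]).

Definition step (M : TM) (c : config M) : config M :=
  if halting c.1 then c else
  let: (q, acts) := delta c.1 [ffun i => head_symbol (c.2 i)] in
  (q, [ffun i => write_move (acts i) (c.2 i)]).

(* Halting configurations are fixed by [step], so [run M ws t] is halting iff *)
(* M halts on ws within t steps.                                              *)
Definition run (M : TM) (ws : seq word) (t : nat) : config M :=
  iter t (@step M) (init M ws).

Definition halts_within (M : TM) (ws : seq word) (t : nat) : bool :=
  halting (run M ws t).1.

Definition accepts_within (M : TM) (ws : seq word) (t : nat) : bool :=
  halts_within M ws t && accepting (run M ws t).1.

Definition outputs_within (M : TM) (ws : seq word) (t : nat) (w : word) : bool :=
  halts_within M ws t && (word_of ((run M ws t).2 ord0) == w).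

(* [code] is the binary encoding of instances and [max_number x] the largest  *)
(* number occurring in x; they are Garey and Johnson's functions Length (as   *)
(* the size of the code) and Max.                                             *)
Record problem := Problem {
  instance : Type;
  code : instance -> word;
  max_number : instance -> nat;
  yes : instance -> Prop }.

Definition instance_length (P : problem) (x : instance P) : nat :=
  size (code x).

Definition restrict (P : problem) (C : instance P -> Prop) : problem :=
  @Problem {x : instance P | C x} (fun x => code (sval x))
    (fun x => max_number (sval x)) (fun x => yes (sval x)).

Definition language (L : word -> Prop) : problem :=
  @Problem word id (fun=> 0) L.

Definition pbound (c k n : nat) : nat := c * n.+1 ^ k.

(* The verifier reads the instance on tape 0 and the certificate on tape 1.   *)
Definition in_NP (P : problem) : Prop :=
  exists (V : TM) (c k d l : nat), forall x : instance P,
    let p := pbound c k (instance_length x) in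
    let t := pbound d l (instance_length x) in
    (forall w : word, size w <= p -> halts_within V [:: code x; w] t) /\
    (yes x <->
       exists w : word, size w <= p /\ accepts_within V [:: code x; w] t).

Definition poly_reducible (P Q : problem) : Prop :=
  exists (f : instance P -> instance Q) (M : TM) (c k : nat),
  forall x : instance P,
    outputs_within M [:: code x] (pbound c k (instance_length x)) (code (f x)) /\
    (yes x <-> yes (f x)).

Definition NP_hard (P : problem) : Prop :=
  forall L : word -> Prop, in_NP (language L) -> poly_reducible (language L) P.

Definition pseudo_polynomial (P : problem) : Prop :=
  exists (M : TM) (c k : nat), forall x : instance P,
    let t := pbound c k (instance_length x + max_number x) in
    halts_within M [:: code x] t /\ (yes x <-> accepts_within M [:: code x] t).

Definition weakly_NP_complete (P : problem) : Prop :=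
  [/\ in_NP P, NP_hard P & pseudo_polynomial P].

Definition is_tree (T : finType) (e : rel T) : Prop :=
  [/\ 0 < #|T|, symmetric e, irreflexive e,
      (forall x y : T, connect e x y)
    & (forall c : seq T, 2 < size c -> ~~ ucycleb e c)].

Record tree_decomposition (V : finType) (e : rel V) := TreeDecomposition {
  node : finType;
  link : rel node;
  bag : node -> {set V};
  link_tree : is_tree link;
  bag_vertex : forall v : V, exists x : node, v \in bag x;
  bag_edge : forall u v : V, e u v ->
    exists x : node, (u \in bag x) && (v \in bag x);
  bag_connected : forall (v : V) (x y : node), v \in bag x -> v \in bag y ->
    connect [rel a b | [&& link a b, v \in bag a & v \in bag b]] x y }.

Definition width (V : finType) (e : rel V) (D : tree_decomposition e) : nat :=
  (\max_(x : node D) #|bag x|).-1.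

Definition has_treewidth (V : finType) (e : rel V) (k : nat) : Prop :=
  (exists D : tree_decomposition e, width D = k) /\
  (forall D : tree_decomposition e, k <= width D).

(* Only the values of [weight] on edges are meaningful. *)
Record constraint_graph := ConstraintGraph {
  order : nat;
  edge : rel 'I_order;
  edge_sym : symmetric edge;
  edge_irr : irreflexive edge;
  weight : 'I_order -> 'I_order -> nat;
  weight_sym : forall u v, weight u v = weight v u;
  weight_gt0 : forall u v, edge u v -> 0 < weight u v;
  min_inflow : 'I_order -> nat }.

(* [o u v] means that the edge uv is oriented from u into v. *)
Definition is_orientation (G : constraint_graph) (o : rel 'I_(order G)) : Prop :=
  forall u v, edge u v -> o u v = ~~ o v u.

Definition inflow (G : constraint_graph) (o : rel 'I_(order G))
    (v : 'I_(order G)) : nat :=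
  \sum_(u | edge u v && o u v) weight u v.

Definition legal (G : constraint_graph) (o : rel 'I_(order G)) : Prop :=
  is_orientation o /\ forall v, min_inflow v <= inflow o v.

Definition satisfiable (G : constraint_graph) : Prop :=
  exists o : rel 'I_(order G), legal o.

(* Binary digits, least significant first; [up_log 2 n.+1] is their number. *)
Definition bits (n : nat) : word :=
  [seq odd (n %/ 2 ^ i) | i <- iota 0 (up_log 2 n.+1)].

(* Self-delimiting: every digit is preceded by 1, and 0 marks the end. *)
Definition code_nat (n : nat) : word :=
  flatten [seq [:: true; b] | b <- bits n] ++ [:: false].

(* The entry 0 stands for a non-edge; this is unambiguous because edge        *)
(* weights are positive.                                                      *)
Definition adjacency (G : constraint_graph) (u v : 'I_(order G)) : nat :=
  if edge u v then weight u v else 0.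

(* The number of vertices, the minimum inflows, and the weighted adjacency    *)
(* matrix in row-major order, all in binary.                                  *)
Definition code_graph (G : constraint_graph) : word :=
  flatten [seq code_nat n | n <-
    order G :: [seq min_inflow v | v <- enum 'I_(order G)]
      ++ [seq adjacency u v | u <- enum 'I_(order G), v <- enum 'I_(order G)]].

Definition max_weight (G : constraint_graph) : nat :=
  maxn (\max_(v < order G) min_inflow v)
       (\max_(u < order G) \max_(v < order G) adjacency u v).

Definition constraint_graph_satisfiability : problem :=
  Problem code_graph max_weight satisfiable.

(* Main.v *)
(* Turing machines are programmed at two levels. Programs over four stacks    *)
(* are compiled to machines with one tape per stack; on top of them, a        *)
(* function between types encoded by binary trees is polynomial-time if some  *)
(* stack program replaces the code of the argument on top of a stack by the   *)
(* code of the result. This class is closed under composition, pairing, case  *)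
(* distinction and iteration with polynomially bounded results, so that the   *)
(* three algorithms can be written as functions on lists and numbers.         *)
(*   NP: the certificate is the orientation, as a bit matrix.                 *)
(*   Hardness: an accepting run of a verifier is a tiling of a grid by local  *)
(* tiles, a tiling is an exact cover, and an exact cover is a subset sum in a *)
(* base so large that no carry occurs. A subset sum instance becomes a graph  *)
(* with two hubs and one vertex per item, joined to both hubs: the demand of  *)
(* an item vertex lets it give its weight to at most one hub, and the demands *)
(* of the hubs leave no slack.                                                *)
(*   Pseudo-polynomial time: repeatedly eliminate a vertex with at most two   *)
(* live neighbours, replacing its edges by a single generalized edge that     *)
(* lists the achievable pairs of inflows, capped at the largest demand. Such  *)
(* a vertex exists because in a rooted tree decomposition of width 2 the      *)
(* vertex whose topmost bag is deepest has all its neighbours in that bag,    *)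
(* and eliminating any such vertex is an edge contraction, which preserves    *)
(* the width bound. Numbers are unary, and the cap is found by search.        *)

Require Import Defs.
From mathcomp Require Import all_boot.
From mathcomp Require Import zify.

Set Implicit Arguments.
Unset Strict Implicit.
Unset Printing Implicit Defensive.

(** * Stack programs and their compilation to Turing machines *)

(** All three claims come down to exhibiting polynomial-time functions on lists and numbers. The
    class [FP] is closed under composition, pairing, case distinction, folds and bounded iteration;
    [decision_machine], [output_machine] and [search_machine] turn its members into Turing machines.

    Membership ([cgs_in_NP]): an orientation is a bit matrix no longer than the code of the graph,
    and checking it takes only binary additions and comparisons ([verifyP]).

    Hardness ([cgs_NP_hard]): the tableau of a computation obeys local rules, so acceptance with
    some certificate is the existence of a tiling with constrained first and last rows
    ([tableau_complete], [tableau_sound]). Using every cell once with matching colours is an exact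
    cover ([cover_tiling]), and reading 0/1 rows as numbers in a base too large for carries gives a
    subset sum ([digits_sum]). In the gadget an item a_i has one edge of weight a_i to each of two
    hubs and must keep one of them. One hub demands the target t, the other all the a_i, of which a
    side edge supplies t. Supply equals demand up to a few units, and all remaining quantities are
    multiples of 4, so the items serving the first hub sum to exactly t ([gadget_satisfiable]).
    Without the hubs no edge is left, whence width 2, and a triangle forbids less
    ([gadget_treewidth], [triangle_width]).

    Pseudo-polynomial time ([cgs_pseudo_polynomial]): inflow beyond a bound M on all demands is
    worthless, so whatever a set of edges does to two vertices is described by at most (M+1)^2
    pairs. A vertex with at most two neighbours can therefore be removed, its edges being replaced
    by one generalized edge that lists the pairs achievable while the vertex is satisfied
    ([eliminate_feasible]). In width 2 such a vertex exists ([simplicial_vertex], [pivotP]), and its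
    removal is a contraction, which keeps the width ([eliminate_decomposed]). After one round per
    vertex only the non-emptiness of the lists remains to be tested ([eliminate_iter]). The bound M
    is found by counting upwards until it covers every demand, which happens no later than at the
    largest number of the instance. *)

Inductive reg := R0 | R1 | R2 | R3.

Record store := St { st0 : word; st1 : word; st2 : word; st3 : word }.

Definition get (s : store) (r : reg) : word :=
  match r with R0 => st0 s | R1 => st1 s | R2 => st2 s | R3 => st3 s end.

Definition put (s : store) (r : reg) (w : word) : store :=
  let: St a b c d := s in
  match r with
  | R0 => St w b c d | R1 => St a w c d | R2 => St a b w d | R3 => St a b c w
  end.

Inductive prog :=
| Nop
| Push of reg & bool
| Pop of reg
| Seq of prog & prog
| If of reg & pred (option bool) & prog & prog
| While of reg & pred (option bool) & prog.

(** The last index is the exact number of steps of the compiled machine. A push costs 2 because the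
    head first moves left and then writes; every test costs 1. *)
Inductive exec : prog -> store -> store -> nat -> Prop :=
| ENop s : exec Nop s s 1
| EPush r b s : exec (Push r b) s (put s r (b :: get s r)) 2
| EPop r s : exec (Pop r) s (put s r (behead (get s r))) 1
| ESeq p q s s' s'' t t' :
    exec p s s' t -> exec q s' s'' t' -> exec (Seq p q) s s'' (t + t')
| EIfT r (c : pred (option bool)) p q s s' t :
    c (ohead (get s r)) -> exec p s s' t -> exec (If r c p q) s s' t.+1
| EIfF r (c : pred (option bool)) p q s s' t :
    ~~ c (ohead (get s r)) -> exec q s s' t -> exec (If r c p q) s s' t.+1
| EWhileF r (c : pred (option bool)) p s : ~~ c (ohead (get s r)) -> exec (While r c p) s s 1
| EWhileT r (c : pred (option bool)) p s s' s'' t t' :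
    c (ohead (get s r)) -> exec p s s' t -> exec (While r c p) s' s'' t' ->
    exec (While r c p) s s'' (t + t').+1.

Definition store_size (s : store) :=
  size (st0 s) + size (st1 s) + size (st2 s) + size (st3 s).

(** Each step adds at most one symbol, so time bounds space. Through [computes_size] this bounds the
    outputs of all polynomial-time functions. *)
Lemma exec_size p s s' t : exec p s s' t -> store_size s' <= store_size s + t.
Proof.
elim=> {p s s' t}.
- by move=> s; lia.
- by move=> [] b [a0 a1 a2 a3]; rewrite /store_size /=; lia.
- by move=> [] [a0 a1 a2 a3]; rewrite /store_size /= size_behead; lia.
- by move=> *; lia.
- by move=> *; lia.
- by move=> *; lia.
- by move=> *; lia.
- by move=> *; lia.
Qed.

Definition tape_reg (r : reg) : 'I_4 :=
  match r with
  | R0 => @Ordinal 4 0 isT | R1 => @Ordinal 4 1 isT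
  | R2 => @Ordinal 4 2 isT | R3 => @Ordinal 4 3 isT
  end.

Notation symbols := {ffun 'I_4 -> symbol void}.
Notation actions := {ffun 'I_4 -> symbol void * move}.
Notation tapes := {ffun 'I_4 -> tape void}.

Definition letter (a : symbol void) : option bool :=
  if a is Some (inl b) then Some b else None.

Definition idle (h : symbols) : actions := [ffun i => (h i, Stay)].

Definition act_on (r : reg) (a : symbol void) (m : move) (h : symbols) : actions :=
  [ffun i => if i == tape_reg r then (a, m) else (h i, Stay)].

(** Control points become machine states. For [Push] the boolean records that the head has already
    moved left; for [If] and [While] the point [None] is the test. *)
Fixpoint control (p : prog) : finType :=
  match p with
  | Nop => unit
  | Push _ _ => bool
  | Pop _ => unit
  | Seq p q => (control p + control q)%type
  | If _ _ p q => option (control p + control q)%type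
  | While _ _ p => option (control p)
  end.

Fixpoint entry (p : prog) : control p :=
  match p return control p with
  | Nop => tt
  | Push _ _ => false
  | Pop _ => tt
  | Seq p _ => inl (entry p)
  | If _ _ _ _ => None
  | While _ _ _ => None
  end.

(* The next control point is [None] when the program ends. *)
Fixpoint next (p : prog) : control p -> symbols -> option (control p) * actions :=
  match p return control p -> symbols -> option (control p) * actions with
  | Nop => fun _ h => (None, idle h)
  | Push r b => fun c h =>
      if c then (None, act_on r (Some (inl b)) Stay h)
      else (Some true, act_on r (h (tape_reg r)) Left h)
  | Pop r => fun _ h => (None, act_on r None Right h)
  | Seq p q => fun c h =>
      match c with
      | inl c => let: (o, a) := next c h in
                 (Some (if o is Some c' then inl c' else inr (entry q)), a)
      | inr c => let: (o, a) := next c h in (omap inr o, a)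
      end
  | If r f p q => fun c h =>
      match c with
      | None => (Some (Some (if f (letter (h (tape_reg r)))
                             then inl (entry p) else inr (entry q))), idle h)
      | Some (inl c) => let: (o, a) := next c h in (omap (Some \o inl) o, a)
      | Some (inr c) => let: (o, a) := next c h in (omap (Some \o inr) o, a)
      end
  | While r f p => fun c h =>
      match c with
      | None => (if f (letter (h (tape_reg r))) then Some (Some (entry p)) else None,
                 idle h)
      | Some c => let: (o, a) := next c h in (Some o, a)
      end
  end.

Definition heads (T : tapes) : symbols := [ffun i => head_symbol (T i)].
Definition perform (a : actions) (T : tapes) : tapes :=
  [ffun i => write_move (a i) (T i)].

Inductive leads (p : prog) : control p -> tapes -> nat -> tapes -> Prop :=
| LeadsEnd c T a : next c (heads T) = (None, a) -> leads c T 1 (perform a T)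
| LeadsStep c T c' a t T' : next c (heads T) = (Some c', a) ->
    leads c' (perform a T) t T' -> leads c T t.+1 T'.

Lemma perform_idle T : perform (idle (heads T)) T = T.
Proof. by apply/ffunP=> i; rewrite !ffunE /write_move /=; case: (T i). Qed.

Lemma leads_seq_r p q (c : control q) T t T' :
  leads c T t T' -> leads (inr c : control (Seq p q)) T t T'.
Proof.
elim=> {c T t T'} [c T a|c T c' a t T'] E; first by constructor; rewrite /= E.
by move=> _ IH; apply: (@LeadsStep (Seq p q) _ _ (inr c') a) => //=; rewrite E.
Qed.

Lemma leads_seq_l p q (c : control p) T t T' t' T'' :
  leads c T t T' -> leads (entry q) T' t' T'' ->
  leads (inl c : control (Seq p q)) T (t + t') T''.
Proof.
move=> H H'; elim: H H' => {c T t T'} [c T a E|c T c' a t T' E _ IH] H'.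
  rewrite add1n; apply: (@LeadsStep (Seq p q) _ _ (inr (entry q)) a) => /=.
    by rewrite E.
  exact: leads_seq_r.
rewrite addSn; apply: (@LeadsStep (Seq p q) _ _ (inl c') a) => /=; first by rewrite E.
exact: IH.
Qed.

Lemma leads_if_l r f p q (c : control p) T t T' :
  leads c T t T' -> leads (Some (inl c) : control (If r f p q)) T t T'.
Proof.
elim=> {c T t T'} [c T a|c T c' a t T'] E; first by constructor; rewrite /= E.
by move=> _ IH; apply: (@LeadsStep (If r f p q) _ _ (Some (inl c')) a) => //=; rewrite E.
Qed.

Lemma leads_if_r r f p q (c : control q) T t T' :
  leads c T t T' -> leads (Some (inr c) : control (If r f p q)) T t T'.
Proof.
elim=> {c T t T'} [c T a|c T c' a t T'] E; first by constructor; rewrite /= E.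
by move=> _ IH; apply: (@LeadsStep (If r f p q) _ _ (Some (inr c')) a) => //=; rewrite E.
Qed.

Lemma leads_while r f p (c : control p) T t T' t' T'' :
  leads c T t T' -> leads (None : control (While r f p)) T' t' T'' ->
  leads (Some c : control (While r f p)) T (t + t') T''.
Proof.
move=> H H'; elim: H H' => {c T t T'} [c T a E|c T c' a t T' E _ IH] H'.
  rewrite add1n; apply: (@LeadsStep (While r f p) _ _ None a) => //=.
  by rewrite E.
rewrite addSn; apply: (@LeadsStep (While r f p) _ _ (Some c') a) => /=.
  by rewrite E.
exact: IH.
Qed.

(* A stack is read from the head of its tape rightwards; what lies to the     *)
(* left of the head is irrelevant.                                            *)
Definition holds (T : tape void) (w : word) :=
  forall i, nth None (head_symbol T :: rights T) i =
            nth None [seq Some (inl b) | b <- w] i.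

Definition represents (T : tapes) (s : store) :=
  forall r, holds (T (tape_reg r)) (get s r).

Lemma holds_letter T w : holds T w -> letter (head_symbol T) = ohead w.
Proof. by move/(_ 0) => /= ->; case: w. Qed.

Lemma letter_heads T s r :
  represents T s -> letter (heads T (tape_reg r)) = ohead (get s r).
Proof. by move/(_ r)/holds_letter; rewrite ffunE. Qed.


Lemma get_put s r w r' : get (put s r w) r' = if tape_reg r' == tape_reg r then w else get s r'.
Proof. by case: s; case: r; case: r'. Qed.

Lemma represents_act T s r a m w :
  represents T s -> holds (write_move (a, m) (T (tape_reg r))) w ->
  represents (perform (act_on r a m (heads T)) T) (put s r w).
Proof.
move=> rT h r'; rewrite get_put !ffunE; case: eqP => [->//|_].
have := rT r'; rewrite /write_move /=.
by case: (T _).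
Qed.

Lemma holds_pop a T w : holds T w -> holds (write_move (a, Right) T) (behead w).
Proof.
move=> h i; rewrite /write_move /=.
have := h i.+1; rewrite /=.
have -> : nth None [seq Some (inl b) | b <- behead w] i =
          nth None [seq Some (inl b : bool + void) | b <- w] i.+1.
  by case: (w) => //; rewrite nth_nil.
by move=> <-; case: (rights T) => //=; case: i => //= i; rewrite nth_nil.
Qed.

Lemma holds_push b T w : holds T w ->
  holds (write_move (Some (inl b), Stay) (write_move (head_symbol T, Left) T)) (b :: w).
Proof. by move=> h [|i] //; apply: (h i). Qed.

Lemma exec_leads p s s' t : exec p s s' t -> forall T, represents T s ->
  exists2 T', represents T' s' & leads (entry p) T t T'.
Proof.
elim=> {p s s' t}.
- move=> s T rT; exists T => //.
  by have := @LeadsEnd Nop tt T _ erefl; rewrite perform_idle.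
- move=> r b s T rT.
  pose T1 := perform (act_on r (heads T (tape_reg r)) Left (heads T)) T.
  exists (perform (act_on r (Some (inl b)) Stay (heads T1)) T1).
    move=> r'; rewrite get_put /T1 !ffunE; case: eqP => [->|_]; rewrite ?eqxx.
      by apply: holds_push; apply: rT.
    by have := rT r'; rewrite /write_move /=; case: (T _).
  apply: (@LeadsStep (Push r b) _ _ true) => //.
  exact: (@LeadsEnd (Push r b)).
- move=> r s T rT.
  exists (perform (act_on r None Right (heads T)) T).
    apply: represents_act => //; exact: holds_pop.
  exact: (@LeadsEnd (Pop r)).
- move=> p q s s' s'' t t' _ IH1 _ IH2 T /IH1[T1 /IH2[T2 rT2 l2] l1].
  by exists T2 => //; apply: leads_seq_l l1 l2.
- move=> r c p q s s' t cs _ IH T rT; have [T1 rT1 l1] := IH _ rT; exists T1 => //.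
  apply: (@LeadsStep (If r c p q) _ _ (Some (inl (entry p))) (idle (heads T))).
    by rewrite /= (letter_heads _ rT) cs.
  by rewrite perform_idle; apply: leads_if_l.
- move=> r c p q s s' t cs _ IH T rT; have [T1 rT1 l1] := IH _ rT; exists T1 => //.
  apply: (@LeadsStep (If r c p q) _ _ (Some (inr (entry q))) (idle (heads T))).
    by rewrite /= (letter_heads _ rT) (negbTE cs).
  by rewrite perform_idle; apply: leads_if_r.
- move=> r c p s cs T rT; exists T => //.
  have E : @next (While r c p) None (heads T) = (None, idle (heads T)).
    by rewrite /= (letter_heads _ rT) (negbTE cs).
  by have := LeadsEnd E; rewrite perform_idle; apply.
- move=> r c p s s' s'' t t' cs _ IH1 _ IH2 T rT.
  have [T1 /IH2[T2 rT2 l2] l1] := IH1 _ rT; exists T2 => //.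
  apply: (@LeadsStep (While r c p) _ _ (Some (entry p)) (idle (heads T))).
    by rewrite /= (letter_heads _ rT) cs.
  by rewrite perform_idle; apply: leads_while l1 l2.
Qed.

(* After [p] has ended, one more step reads the top of R0 to decide on        *)
(* acceptance.                                                                *)
Definition machine (p : prog) : TM :=
  @MkTM 3 void (control p + option bool)%type (inl (entry p))
    (fun q => if q is inr (Some _) then true else false)
    (fun q => if q is inr (Some b) then b else false)
    (fun q h =>
       match q with
       | inl c => let: (o, a) := next c h in
                  (if o is Some c' then inl c' else inr None, a)
       | inr None => (inr (Some (letter (h (tape_reg R0)) == Some true)), idle h)
       | inr (Some b) => (q, idle h)
       end).

Lemma leads_machine p (c : control p) T t T' : leads c T t T' ->
  iter t (@step (machine p)) (inl c, T) = (inr None, T').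
Proof.
elim=> {c T t T'} [c T a E|c T c' a t T' E _ IH].
  by rewrite /= /step /= -/(heads T) E.
by rewrite iterSr /= {2}/step /= -/(heads T) E.
Qed.

Lemma tape_of_holds w : holds (tape_of void w) w.
Proof. by case: w => [|b w] [|i] //=; rewrite !nth_nil. Qed.

Lemma holds_word_of T w : holds T w -> word_of T = w.
Proof.
case: T => l h r; rewrite /holds /word_of /=.
elim: w h r => [|b w IH] h r H.
  by have /= -> := H 0.
have /= -> := H 0; congr (_ :: _).
case: r H => [|h' r] H.
  case: w H {IH} => // b' w /(_ 1) //=.
by apply: IH => i; apply: (H i.+1).
Qed.

Definition load (ws : seq word) : store :=
  St (nth [::] ws 0) (nth [::] ws 1) (nth [::] ws 2) (nth [::] ws 3).

Lemma iter_halted (M : TM) (c : config M) n : halting c.1 -> iter n (@step M) c = c.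
Proof. by move=> hc; elim: n => //= n ->; rewrite /step hc. Qed.

Lemma machine_run p ws s t n : exec p (load ws) s t -> t < n ->
  exists2 T, represents T s &
    run (machine p) ws n = (inr (Some (ohead (st0 s) == Some true)), T).
Proof.
move=> /exec_leads H lt_tn.
have [|T rT l] := H (init (machine p) ws).2.
  by case=> /=; rewrite ffunE; apply: tape_of_holds.
exists T => //.
rewrite /run -(subnK lt_tn) iterD iterS [init _ _]surjective_pairing.
rewrite (leads_machine l) {2}/step /= -/(heads T) (letter_heads R0 rT).
rewrite -/(perform (idle (heads T)) T) perform_idle.
exact: iter_halted.
Qed.

Lemma machine_halts p ws s t n : exec p (load ws) s t -> t < n ->
  halts_within (machine p) ws n.
Proof. by move=> H lt_tn; have [T _ E] := machine_run H lt_tn; rewrite /halts_within E. Qed.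

Lemma machine_accepts p ws s t n : exec p (load ws) s t -> t < n ->
  accepts_within (machine p) ws n = (ohead (st0 s) == Some true).
Proof.
by move=> H lt_tn; have [T _ E] := machine_run H lt_tn; rewrite /accepts_within /halts_within E.
Qed.

Lemma machine_outputs p ws s t n : exec p (load ws) s t -> t < n ->
  outputs_within (machine p) ws n (st0 s).
Proof.
move=> H lt_tn; have [T rT E] := machine_run H lt_tn.
rewrite /outputs_within /halts_within E /=; apply/eqP/holds_word_of.
have := rT R0; rewrite /tape_reg; congr (holds (T _) _); exact: val_inj.
Qed.

(** * Binary trees as a data type of stack programs *)

(** The base is at least 2, so constants, sums and products are all absorbed by raising the
    exponent. *)
Definition poly (f : nat -> nat) := exists k, forall n, f n <= n.+2 ^ k.

Lemma leq_exp2 n a b : a <= b -> n.+2 ^ a <= n.+2 ^ b.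
Proof. exact: leq_pexp2l. Qed.

Lemma poly_const c : poly (fun=> c).
Proof.
exists c => n; apply: leq_trans (ltnW (ltn_expl c (isT : 1 < 2))) _.
by case: c => // c; rewrite leq_exp2r.
Qed.

Lemma poly_id : poly id.
Proof. by exists 1 => n; rewrite expn1 ltnW. Qed.

Lemma poly_exp k : poly (fun n => n.+2 ^ k).
Proof. by exists k. Qed.

Lemma poly_add f g : poly f -> poly g -> poly (fun n => f n + g n).
Proof.
case=> a Ha [b Hb]; exists (maxn a b).+1 => n; rewrite expnS.
have h : f n <= n.+2 ^ maxn a b := leq_trans (Ha n) (leq_exp2 _ (leq_maxl _ _)).
have h' : g n <= n.+2 ^ maxn a b := leq_trans (Hb n) (leq_exp2 _ (leq_maxr _ _)).
by rewrite (leq_trans (leq_add h h')) // addnn -mul2n leq_mul2r orbT.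
Qed.

Lemma poly_mul f g : poly f -> poly g -> poly (fun n => f n * g n).
Proof. by case=> a Ha [b Hb]; exists (a + b) => n; rewrite expnD leq_mul. Qed.

Lemma poly_comp_exp f k : poly f -> poly (fun n => (f n).+2 ^ k).
Proof.
case=> a Ha; exists (a.+2 * k) => n; rewrite expnM.
case: k => // k; rewrite leq_exp2r // !expnS.
have := Ha n; have : 0 < n.+2 ^ a by rewrite expn_gt0.
by set y := _ ^ _; nia.
Qed.

Lemma poly_le f g : (forall n, f n <= g n) -> poly g -> poly f.
Proof. by move=> le_fg [k Hk]; exists k => n; apply: leq_trans (le_fg n) (Hk n). Qed.

Lemma poly_S f : poly f -> poly (fun n => (f n).+1).
Proof.
move=> pf; apply: poly_le (poly_add pf (poly_const 1)) => n; by rewrite addn1.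
Qed.

Ltac polyt := repeat first
  [ exact: poly_const | exact: poly_id | exact: poly_exp | apply: poly_S
  | apply: poly_add | apply: poly_mul | apply: poly_comp_exp ].

Lemma poly_pbound f : poly f -> exists c k, forall n, f n <= pbound c k n.
Proof.
case=> k Hk; exists (2 ^ k), k => n; apply: leq_trans (Hk n) _.
by rewrite /pbound -expnMn; case: (k) => // j; rewrite leq_exp2r //; lia.
Qed.

Inductive tree := Leaf | Node of tree & tree.

(** A prefix code: a tree lying on top of other data ends where the count of subtrees still to be
    read drops to zero, so no separators are needed. *)
Fixpoint tree_code (x : tree) : word :=
  match x with
  | Leaf => [:: false]
  | Node a b => true :: tree_code a ++ tree_code b
  end.

Definition tree_size (x : tree) := size (tree_code x).

Lemma tree_size_gt0 x : 0 < tree_size x. Proof. by case: x. Qed.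
Lemma tree_size_Node a b : tree_size (Node a b) = (tree_size a + tree_size b).+1.
Proof. by rewrite /tree_size /= size_cat. Qed.
Lemma tree_size_Leaf : tree_size Leaf = 1. Proof. by []. Qed.

Definition left_tree x := if x is Node a _ then a else Leaf.
Definition right_tree x := if x is Node _ b then b else Leaf.
Definition is_node x := if x is Node _ _ then true else false.

Definition runs p s s' t := exists2 t', t' <= t & exec p s s' t'.

Lemma runs_exec p s s' t : exec p s s' t -> runs p s s' t.
Proof. by exists t. Qed.

Lemma runs_le p s s' t t' : t <= t' -> runs p s s' t -> runs p s s' t'.
Proof. by move=> le_tt' [u le_ut e]; exists u => //; apply: leq_trans le_tt'. Qed.

Lemma runs_seq p q s s' s'' t t' :
  runs p s s' t -> runs q s' s'' t' -> runs (Seq p q) s s'' (t + t').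
Proof. by case=> u le_u e [v le_v e']; exists (u + v); [apply: leq_add | apply: ESeq e e']. Qed.

Lemma runs_while r (c : pred (option bool)) p s s' s'' t t' : c (ohead (get s r)) ->
  runs p s s' t -> runs (While r c p) s' s'' t' -> runs (While r c p) s s'' (t + t').+1.
Proof.
by move=> cs [u le_u e] [v le_v e']; exists (u + v).+1; [rewrite ltnS leq_add | apply: EWhileT cs e e'].
Qed.

Lemma runs_ifT r (c : pred (option bool)) p q s s' t : c (ohead (get s r)) ->
  runs p s s' t -> runs (If r c p q) s s' t.+1.
Proof. by move=> cs [u le_u e]; exists u.+1 => //; apply: EIfT. Qed.

Lemma runs_ifF r (c : pred (option bool)) p q s s' t : ~~ c (ohead (get s r)) ->
  runs q s s' t -> runs (If r c p q) s s' t.+1.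
Proof. by move=> cs [u le_u e]; exists u.+1 => //; apply: EIfF. Qed.

Definition nonempty (o : option bool) := o != None.
Definition is1 (o : option bool) := o == Some true.

Definition pour r d :=
  While r nonempty (If r is1 (Seq (Pop r) (Push d true)) (Seq (Pop r) (Push d false))).

Lemma runs_pour r d s : tape_reg r != tape_reg d ->
  runs (pour r d) s (put (put s r [::]) d (catrev (get s r) (get s d)))
    (5 * size (get s r)).+1.
Proof.
move=> ne_rd; move Da: (get s r) => a; elim: a s Da => [|b a IH] s Da.
  exists 1 => //; have -> : put (put s r [::]) d (catrev [::] (get s d)) = s.
    by move: Da; case: s r d ne_rd => ? ? ? ? [] [] //= _ ->.
  by apply: EWhileF; rewrite Da.
have := IH (put (put s r a) d (b :: get s d)).
have -> : get (put (put s r a) d (b :: get s d)) r = a.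
  by case: s r d ne_rd {IH Da} => ? ? ? ? [] [].
move=> /(_ erefl) {}IH.
have -> : (5 * size (b :: a)).+1 = (4 + (5 * size a).+1).+1 by rewrite /=; lia.
apply: (@runs_while _ _ _ _ (put (put s r a) d (b :: get s d))); rewrite ?Da //.
  exists 4 => //; case: b Da {IH} => Da; [apply: EIfT | apply: EIfF]; rewrite ?Da //;
  have -> : put s r a = put s r (behead (get s r)) by rewrite Da.
  - have -> : get s d = get (put s r (behead (get s r))) d.
      by case: s r d ne_rd Da => ? ? ? ? [] [].
    by apply: (@ESeq _ _ _ _ _ 1 2); [apply: EPop | apply: EPush].
  - have -> : get s d = get (put s r (behead (get s r))) d.
      by case: s r d ne_rd Da => ? ? ? ? [] [].
    by apply: (@ESeq _ _ _ _ _ 1 2); [apply: EPop | apply: EPush].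
move: IH; congr (runs _ _ _ _).
by case: s r d ne_rd {Da} => ? ? ? ? [] [].
Qed.

(* Removes the tree on top of R0, pushing its code in reverse on R1 (if [t1]) *)
(* and on R2 (if [t2]); R3 counts the subtrees that are still to be read.     *)
Definition take_bit (t1 t2 b : bool) :=
  Seq (Pop R0) (Seq (if t1 then Push R1 b else Nop) (if t2 then Push R2 b else Nop)).
Definition scan_loop t1 t2 :=
  While R3 nonempty
    (If R0 is1 (Seq (take_bit t1 t2 true) (Push R3 true))
               (Seq (take_bit t1 t2 false) (Pop R3))).
Definition scan t1 t2 := Seq (Push R3 true) (scan_loop t1 t2).

Lemma runs_take_bit (t1 t2 b : bool) w a c d :
  runs (take_bit t1 t2 b) (St (b :: w) a c d)
    (St w (if t1 then b :: a else a) (if t2 then b :: c else c) d) 5.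
Proof.
have give (t : bool) r s :
    runs (if t then Push r b else Nop) s (if t then put s r (b :: get s r) else s) 2.
  by case: t; [apply/runs_exec/EPush | exists 1 => //; apply: ENop].
apply: (@runs_le _ _ _ (1 + (2 + 2))) => //; apply: runs_seq; first exact/runs_exec/EPop.
apply: runs_seq; first exact: give.
by have := give t2 R2 (if t1 then St w (b :: a) c d else St w a c d); case: (t1); case: (t2).
Qed.

(** A node adds one subtree to be read and a leaf removes one, so reading a whole tree uses up one
    mark on R3. The rest of the run is a hypothesis, which lets the induction pass through both
    subtrees in turn. *)
Lemma runs_scan_loop (t1 t2 : bool) x w a b n s t :
  runs (scan_loop t1 t2)
    (St w (if t1 then catrev (tree_code x) a else a) (if t2 then catrev (tree_code x) b else b)
       (nseq n true)) s t ->
  runs (scan_loop t1 t2) (St (tree_code x ++ w) a b (nseq n.+1 true)) s (9 * tree_size x + t).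
Proof.
elim: x w a b n t => [|x IHx y IHy] w a b n t H.
  apply: (@runs_le _ _ _ ((7 + t).+1)); first by rewrite /tree_size /=; lia.
  apply: runs_while H => //=; apply: runs_ifF => //.
  apply: (runs_seq (t := 5) (t' := 1)); first exact: (@runs_take_bit t1 t2 false).
  exact/runs_exec/EPop.
rewrite tree_size_Node; apply: (@runs_le _ _ _ ((8 + (9 * tree_size x + (9 * tree_size y + t))).+1)).
  by lia.
rewrite [tree_code _]/= cat_cons -catA.
apply: (@runs_while _ _ _ _ (St (tree_code x ++ tree_code y ++ w) (if t1 then true :: a else a)
    (if t2 then true :: b else b) (nseq n.+2 true))) => //.
  apply: runs_ifT => //; apply: (runs_seq (t := 5) (t' := 2)).
    exact: (@runs_take_bit t1 t2 true).
  exact/runs_exec/EPush.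
apply/IHx/IHy; move: H; rewrite /= !catrev_catl.
by case: (t1); case: (t2).
Qed.

Lemma runs_scan (t1 t2 : bool) x w a b :
  runs (scan t1 t2) (St (tree_code x ++ w) a b [::])
   (St w (if t1 then catrev (tree_code x) a else a) (if t2 then catrev (tree_code x) b else b) [::])
   (9 * tree_size x + 3).
Proof.
apply: (@runs_le _ _ _ (2 + (9 * tree_size x + 1))); first by lia.
apply: runs_seq; first exact/runs_exec/EPush.
by apply: (@runs_scan_loop _ _ x _ _ _ 0); exists 1 => //; apply: EWhileF.
Qed.

Definition dup := Seq (scan true true) (Seq (pour R1 R0) (pour R2 R0)).
Definition drop_top := scan false false.
Definition swap :=
  Seq (scan true false) (Seq (scan false true) (Seq (pour R1 R0) (pour R2 R0))).

Notation main w := (St w [::] [::] [::]).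

Lemma catrevK (T : Type) (u v : seq T) : catrev (catrev u [::]) v = u ++ v.
Proof. by rewrite !catrevE cats0 revK. Qed.

Lemma runs_pour1 x w c : runs (pour R1 R0) (St w (catrev (tree_code x) [::]) c [::])
  (St (tree_code x ++ w) [::] c [::]) (5 * tree_size x).+1.
Proof.
have := @runs_pour R1 R0 (St w (catrev (tree_code x) [::]) c [::]) isT.
by rewrite /= catrevK catrevE cats0 size_rev.
Qed.

Lemma runs_pour2 x w : runs (pour R2 R0) (St w [::] (catrev (tree_code x) [::]) [::])
  (main (tree_code x ++ w)) (5 * tree_size x).+1.
Proof.
have := @runs_pour R2 R0 (St w [::] (catrev (tree_code x) [::]) [::]) isT.
by rewrite /= catrevK catrevE cats0 size_rev.
Qed.

Lemma runs_dup x w : runs dup (main (tree_code x ++ w)) (main (tree_code x ++ tree_code x ++ w)) (30 * tree_size x).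
Proof.
have gt0 := tree_size_gt0 x.
apply: (@runs_le _ _ _ ((9 * tree_size x + 3) + ((5 * tree_size x).+1 + (5 * tree_size x).+1))); first by lia.
apply: runs_seq; first exact: runs_scan.
by apply: runs_seq; [apply: runs_pour1 | apply: runs_pour2].
Qed.

Lemma runs_drop x w : runs drop_top (main (tree_code x ++ w)) (main w) (12 * tree_size x).
Proof.
have gt0 := tree_size_gt0 x; apply: (@runs_le _ _ _ (9 * tree_size x + 3)); first by lia.
exact: runs_scan.
Qed.

Lemma runs_swap x y w : runs swap (main (tree_code x ++ tree_code y ++ w))
  (main (tree_code y ++ tree_code x ++ w)) (20 * (tree_size x + tree_size y)).
Proof.
have gt0 := tree_size_gt0 x; have gt0' := tree_size_gt0 y.
apply: (@runs_le _ _ _ ((9 * tree_size x + 3) +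
  ((9 * tree_size y + 3) + ((5 * tree_size x).+1 + (5 * tree_size y).+1)))); first by lia.
apply: runs_seq; first exact: runs_scan.
apply: runs_seq; first exact: runs_scan.
by apply: runs_seq; [apply: runs_pour1 | apply: runs_pour2].
Qed.

(** The word [w] below the argument is arbitrary: a program leaves deeper data alone, which is what
    pairing and iteration rely on. Input and output are both given as codings of an abstract [X], so
    functions defined on a subtype fit as well. *)
Definition computes X (p : prog) (i o : X -> tree) (b : nat -> nat) :=
  forall x w, runs p (main (tree_code (i x) ++ w)) (main (tree_code (o x) ++ w)) (b (tree_size (i x))).

Definition ptime X (i o : X -> tree) := exists p k, computes p i o (fun n => n.+2 ^ k).

Lemma ptime_poly X p (i o : X -> tree) b : computes p i o b -> poly b -> ptime i o.
Proof. by move=> H [k Hk]; exists p, k => x w; apply: runs_le (H x w). Qed.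

Lemma computes_size X p (i o : X -> tree) b x :
  computes p i o b -> tree_size (o x) <= tree_size (i x) + b (tree_size (i x)).
Proof.
move=> /(_ x [::])[t le_t /exec_size]; rewrite /store_size /= !cats0 !addn0 -/(tree_size _) -/(tree_size _).
by move/leq_trans; apply; rewrite leq_add2l.
Qed.

Lemma ptime_size X (i o : X -> tree) : ptime i o ->
  exists k, forall x, tree_size (o x) <= (tree_size (i x)).+2 ^ k.
Proof.
case=> p [k Hp]; have [j Hj] : poly (fun n => n + n.+2 ^ k) by polyt.
by exists j => x; apply: leq_trans (computes_size x Hp) (Hj _).
Qed.

Lemma ptime_ext X (i i' o o' : X -> tree) : i =1 i' -> o =1 o' -> ptime i o -> ptime i' o'.
Proof. by move=> Ei Eo [p [k H]]; exists p, k => x w; rewrite -Ei -Eo; apply: H. Qed.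

Lemma ptime_reindex X Y (f : Y -> X) i o : ptime i o -> ptime (i \o f) (o \o f).
Proof. by move=> [p [k H]]; exists p, k => x w; apply: H. Qed.

Lemma ptime_id X (i : X -> tree) : ptime i i.
Proof. by exists Nop, 0 => x w; exists 1 => //; apply: ENop. Qed.

Lemma ptime_comp X (i m o : X -> tree) : ptime i m -> ptime m o -> ptime i o.
Proof.
case=> p [j Hp] [q [k Hq]].
apply: (@ptime_poly _ (Seq p q) _ _ (fun n => n.+2 ^ j + (n + n.+2 ^ j).+2 ^ k)); last by polyt.
move=> x w; apply: runs_seq (Hp x w) _; apply: runs_le (Hq _ _).
case: (k) => // l; rewrite leq_exp2r // !ltnS; exact: (computes_size x Hp).
Qed.

Lemma ptime_left X (i : X -> tree) : ptime i (left_tree \o i).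
Proof.
apply: (@ptime_poly _ (If R0 is1 (Seq (Pop R0) (Seq (scan true false) (Seq drop_top (pour R1 R0)))) Nop)
         _ _ (fun n => 30 * n + 10)); last by polyt.
move=> u w; rewrite [(_ \o _) u]/=; case: (i u) => [|x y] {u}.
  by exists 2 => //; apply: EIfF => //; apply: ENop.
apply: (@runs_le _ _ _ ((1 + ((9 * tree_size x + 3) + ((9 * tree_size y + 3) + (5 * tree_size x).+1))).+1)).
  by rewrite tree_size_Node; lia.
apply: runs_ifT => //; apply: runs_seq; first exact/runs_exec/EPop.
rewrite /= -catA; apply: runs_seq; first exact: runs_scan.
apply: runs_seq; first exact: runs_scan.
exact: runs_pour1.
Qed.

Lemma ptime_right X (i : X -> tree) : ptime i (right_tree \o i).
Proof.
apply: (@ptime_poly _ (If R0 is1 (Seq (Pop R0) drop_top) Nop) _ _ (fun n => 12 * n + 10)); last by polyt.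
move=> u w; rewrite [(_ \o _) u]/=; case: (i u) => [|x y] {u}.
  by exists 2 => //; apply: EIfF => //; apply: ENop.
apply: (@runs_le _ _ _ ((1 + 12 * tree_size x).+1)); first by rewrite tree_size_Node; lia.
apply: runs_ifT => //; apply: runs_seq; first exact/runs_exec/EPop.
rewrite /= -catA; exact: runs_drop.
Qed.

Lemma ptime_Node X (i f g : X -> tree) : ptime i f -> ptime i g ->
  ptime i (fun x => Node (f x) (g x)).
Proof.
case=> p [j Hp] [q [k Hq]].
apply: (@ptime_poly _ (Seq dup (Seq q (Seq swap (Seq p (Push R0 true))))) _ _
  (fun n => 30 * n + (n.+2 ^ k + (20 * ((n + n.+2 ^ k) + n) + (n.+2 ^ j + 2))))); last by polyt.
move=> x w; apply: runs_seq; first exact: runs_dup.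
apply: runs_seq; first exact: Hq.
apply: runs_seq.
  apply: runs_le (runs_swap _ _ _); rewrite leq_mul2l leq_add2r; exact: (computes_size x Hq).
apply: runs_seq; first exact: Hp.
by rewrite /= -catA; apply/runs_exec/EPush.
Qed.

Fixpoint push_word (u : word) := if u is b :: v then Seq (push_word v) (Push R0 b) else Nop.

Lemma runs_push_word u w : runs (push_word u) (main w) (main (u ++ w)) (2 * size u + 1).
Proof.
elim: u => [|b u IH] /=; first by exists 1 => //; apply: ENop.
apply: (@runs_le _ _ _ ((2 * size u + 1) + 2)); first by lia.
apply: runs_seq IH _; exact/runs_exec/EPush.
Qed.

Lemma ptime_const X (i : X -> tree) c : ptime i (fun=> c).
Proof.
apply: (@ptime_poly _ (Seq drop_top (push_word (tree_code c))) _ _ (fun n => 12 * n + (2 * tree_size c + 1))); last by polyt.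
move=> x w; apply: runs_seq; first exact: runs_drop.
exact: runs_push_word.
Qed.

(** Each branch has to be computed only on the arguments that reach it, hence the subtypes. *)
Lemma ptime_if X (i c f g : X -> tree) : ptime i c ->
  ptime (fun x : {x | is_node (c x)} => i (sval x)) (fun x => f (sval x)) ->
  ptime (fun x : {x | ~~ is_node (c x)} => i (sval x)) (fun x => g (sval x)) ->
  ptime i (fun x => if is_node (c x) then f x else g x).
Proof.
case=> p [l Hp] [q [j Hq]] [r [k Hr]].
apply: (@ptime_poly _ (Seq dup (Seq p (If R0 is1 (Seq drop_top q) (Seq drop_top r)))) _ _
  (fun n => 30 * n + (n.+2 ^ l + (12 * (n + n.+2 ^ l) + (n.+2 ^ j + n.+2 ^ k)).+1))); last by polyt.
move=> x w; apply: runs_seq; first exact: runs_dup.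
apply: runs_seq; first exact: Hp.
have le_c := computes_size x Hp.
case E : (is_node (c x)); [apply: runs_ifT | apply: runs_ifF]; first by move: E; case: (c x).
- apply: (@runs_le _ _ _ (12 * tree_size (c x) + (tree_size (i x)).+2 ^ j)); first by lia.
  by apply: runs_seq; [apply: runs_drop | apply: (Hq (exist _ x E))].
- by move: E; case: (c x).
apply: (@runs_le _ _ _ (12 * tree_size (c x) + (tree_size (i x)).+2 ^ k)); first by lia.
by apply: runs_seq; [apply: runs_drop | apply: (Hr (exist _ x (negbT E)))].
Qed.

(** The loop counter of an iteration: it is the length of a coded list and also the value of a unary
    number. *)
Fixpoint spine (x : tree) := if x is Node _ y then (spine y).+1 else 0.

Lemma spine_size x : spine x < tree_size x.
Proof. by elim: x => //= x _ y IH; rewrite tree_size_Node; lia. Qed.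

Definition iter_loop p :=
  While R0 is1 (Seq (Pop R0) (Seq drop_top (Seq swap (Seq p swap)))).

Lemma runs_iter_loop S (e : S -> tree) h p k N B n y w :
  computes p e (e \o h) (fun n => n.+2 ^ k) ->
  tree_size n <= N -> (forall i, i <= spine n -> tree_size (e (iter i h y)) <= B) ->
  runs (iter_loop p) (main (tree_code n ++ tree_code (e y) ++ w))
    (main (false :: tree_code (e (iter (spine n) h y)) ++ w))
    (spine n * (52 * N + 40 * B + B.+2 ^ k + 2) + 1).
Proof.
move=> Hp; set C := _ + _ + _ + _.
elim: n y => [|c _ n IH] y le_N le_B; first by exists 1 => //; apply: EWhileF.
rewrite iterSr; move: le_N le_B; rewrite tree_size_Node => le_N le_B.
have le_y : tree_size (e y) <= B by apply: (le_B 0).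
have le_hy : tree_size (e (h y)) <= B by apply: (le_B 1).
have le_hk : (tree_size (e y)).+2 ^ k <= B.+2 ^ k by case: (k) => // j; rewrite leq_exp2r.
apply: (@runs_le _ _ _ ((1 + (12 * tree_size c + (20 * (tree_size n + tree_size (e y)) + (B.+2 ^ k +
  20 * (tree_size (e (h y)) + tree_size n))))) + (spine n * C + 1)).+1).
  rewrite /= mulSn {2}/C; lia.
rewrite [tree_code _]/= cat_cons -catA; apply: runs_while (IH _ _ _) => //.
- apply: runs_seq; first exact/runs_exec/EPop.
  apply: runs_seq; first exact: runs_drop.
  apply: runs_seq; first exact: runs_swap.
  by apply: runs_seq; [apply: runs_le (Hp _ _) | apply: runs_swap].
- by lia.
- by move=> i le_i; rewrite -iterSr; apply: le_B.
Qed.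

(** Iterating a polynomial-time step is polynomial as long as the intermediate values do not grow
    with the iteration; [b] provides that bound. *)
Lemma ptime_iter X S (i n : X -> tree) (e : S -> tree) (h : S -> S) (f : X -> S) b :
  ptime i n -> ptime e (e \o h) -> ptime i (e \o f) -> poly b ->
  (forall x j, j <= spine (n x) -> tree_size (e (iter j h (f x))) <= b (tree_size (i x))) ->
  ptime i (fun x => e (iter (spine (n x)) h (f x))).
Proof.
move=> FPn [q [k Hq]] FPf [j Hj] Hb.
have [p [l Hp]] := ptime_Node FPn FPf; have [m Hm] := ptime_size FPn.
pose B y := y.+2 ^ j; pose N y := y.+2 ^ m.
apply: (@ptime_poly _ (Seq p (Seq (Pop R0) (Seq (iter_loop q) (Pop R0)))) _ _
  (fun y => y.+2 ^ l + (1 + ((N y * (52 * N y + 40 * B y + (B y).+2 ^ k + 2) + 1) + 1)))).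
  move=> x w; apply: runs_seq; first exact: Hp.
  rewrite [tree_code _]/= cat_cons -catA; apply: runs_seq; first exact/runs_exec/EPop.
  apply: (runs_seq (s' := main (false :: tree_code (e (iter (spine (n x)) h (f x))) ++ w)));
    last exact/runs_exec/EPop.
  apply: runs_le (@runs_iter_loop _ e h q k (N (tree_size (i x))) (B (tree_size (i x))) (n x) (f x) w Hq _ _).
  - rewrite leq_add2r leq_mul2r; apply/orP; right.
    exact: leq_trans (ltnW (spine_size _)) (Hm x).
  - exact: Hm.
  - by move=> c le_c; apply: leq_trans (Hb _ _ le_c) (Hj _).
by rewrite /N /B; polyt.
Qed.

(** * Words as trees: loading the inputs and writing the output *)

Definition word_tree (u : word) : tree :=
  foldr (fun b => Node (if b then Node Leaf Leaf else Leaf)) Leaf u.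

Lemma tree_size_word u : tree_size (word_tree u) <= 4 * size u + 1.
Proof. by elim: u => // b u IH; rewrite [word_tree _]/= tree_size_Node; case: b => /=; rewrite /tree_size /= in IH *; lia. Qed.

Lemma size_lt_word_tree u : size u < tree_size (word_tree u).
Proof. by elim: u => // b u IH; rewrite [word_tree _]/= tree_size_Node /=; lia. Qed.

(** The word has been poured onto [r] and so is reversed; treating its last letter first builds the
    list code from the end. *)
Definition pack r :=
  While r nonempty
    (If r is1
      (Seq (Pop r) (Seq (Push R0 false) (Seq (Push R0 false) (Seq (Push R0 true) (Push R0 true)))))
      (Seq (Pop r) (Seq (Push R0 false) (Push R0 true)))).

Lemma runs_pack r s x w : r = R2 \/ r = R3 -> st0 s = tree_code x ++ w ->
  runs (pack r) s (put (put s r [::]) R0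
     (tree_code (foldl (fun x b => Node (if b then Node Leaf Leaf else Leaf) x) x (get s r)) ++ w))
     (12 * size (get s r) + 1).
Proof.
move=> Dr; move Du: (get s r) => u; elim: u x s Du => [|b u IH] x s Du Ds.
  exists 1 => //; have -> : put (put s r [::]) R0 (tree_code x ++ w) = s.
    by case: s Ds Du; case: Dr => -> ? ? ? ? /= -> ->.
  by apply: EWhileF; rewrite Du.
apply: (@runs_le _ _ _ (10 + (12 * size u + 1)).+1); first by rewrite /=; lia.
pose y := Node (if b then Node Leaf Leaf else Leaf) x.
have H := IH y (put (put s r u) R0 (tree_code y ++ w)).
apply: (@runs_while _ _ _ _ (put (put s r u) R0 (tree_code y ++ w))); first by rewrite Du.
  have e : exec (Pop r) s (put s r u) 1 by rewrite -[u]/(behead (b :: u)) -Du; apply: EPop.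
  exists (if b then 10 else 6); first by case: (b).
  move: Du Ds @y e {H}; case: b => Du Ds y e; [apply: EIfT | apply: EIfF]; rewrite ?Du //.
  - apply: (@ESeq _ _ _ _ _ 1 8 e).
    case: s Ds {e Du} => a0 a1 a2 a3 /= ->.
    case: Dr => -> /=; apply: (@ESeq _ _ _ _ _ 2 6); try exact: EPush;
      apply: (@ESeq _ _ _ _ _ 2 4); try exact: EPush;
      apply: (@ESeq _ _ _ _ _ 2 2); exact: EPush.
  - apply: (@ESeq _ _ _ _ _ 1 4 e).
    case: s Ds {e Du} => a0 a1 a2 a3 /= ->.
    by case: Dr => -> /=; apply: (@ESeq _ _ _ _ _ 2 2); apply: EPush.
have {H} := H _ _; rewrite /=; case: s {Du Ds} => a0 a1 a2 a3.
by case: Dr => -> /= H; apply: H.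
Qed.

Definition load_inputs :=
  Seq (pour R0 R2) (Seq (pour R1 R3) (Seq (Push R0 false) (Seq (pack R3)
    (Seq (Push R0 false) (Seq (pack R2) (Push R0 true)))))).

Lemma runs_load_inputs u v : runs load_inputs (St u v [::] [::])
  (main (tree_code (Node (word_tree u) (word_tree v)))) (20 * (size u + size v) + 10).
Proof.
apply: (@runs_le _ _ _ ((5 * size u).+1 + ((5 * size v).+1 + (2 + ((12 * size v + 1) +
  (2 + ((12 * size u + 1) + 2))))))); first by lia.
apply: runs_seq; first exact: (@runs_pour R0 R2 (St u v [::] [::])).
apply: runs_seq; first exact: (@runs_pour R1 R3 (St [::] v (catrev u [::]) [::])).
apply: runs_seq; first exact/runs_exec/EPush.
have fold w x : foldl (fun x b => Node (if b then Node Leaf Leaf else Leaf) x) x (catrev w [::])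
    = foldr (fun b => Node (if b then Node Leaf Leaf else Leaf)) x w.
  by rewrite catrevE cats0 foldl_rev.
have szc (w : word) : size (catrev w [::]) = size w by rewrite catrevE cats0 size_rev.
apply: runs_seq.
  rewrite -(szc v).
  by apply: (@runs_pack R3 (St [:: false] [::] (catrev u [::]) (catrev v [::])) Leaf [::]); [right|].
rewrite /= fold -/(word_tree v) cats0.
apply: runs_seq; first exact/runs_exec/EPush.
apply: runs_seq.
  rewrite -(szc u).
  by apply: (@runs_pack R2 (St (false :: tree_code (word_tree v)) [::] (catrev u [::]) [::]) Leaf); [left|].
rewrite /= fold -/(word_tree u).
exact/runs_exec/EPush.
Qed.

Definition output_loop :=
  While R0 is1 (Seq (Pop R0) (If R0 is1
    (Seq (Pop R0) (Seq (Pop R0) (Seq (Pop R0) (Push R1 true))))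
    (Seq (Pop R0) (Push R1 false)))).
Definition output_word := Seq output_loop (Seq (Pop R0) (pour R1 R0)).

Lemma runs_output_loop u a : runs output_loop (St (tree_code (word_tree u)) a [::] [::])
  (St [:: false] (catrev u a) [::] [::]) (8 * size u + 1).
Proof.
elim: u a => [|b u IH] a; first by exists 1 => //; apply: EWhileF.
apply: (@runs_le _ _ _ (7 + (8 * size u + 1)).+1); first by rewrite /=; lia.
apply: runs_while (IH (b :: a)) => //.
apply: (runs_seq (t := 1) (t' := 6)); first exact/runs_exec/EPop.
case: b => /=; [apply: runs_ifT | apply: runs_ifF] => //.
  apply: (runs_seq (t := 1) (t' := 4)); first exact/runs_exec/EPop.
  apply: (runs_seq (t := 1) (t' := 3)); first exact/runs_exec/EPop.
  apply: (runs_seq (t := 1) (t' := 2)); first exact/runs_exec/EPop.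
  exact/runs_exec/EPush.
apply: (@runs_le _ _ _ (1 + 2)) => //; apply: runs_seq; first exact/runs_exec/EPop.
exact/runs_exec/EPush.
Qed.

Lemma runs_output_word u : runs output_word (main (tree_code (word_tree u))) (main u) (20 * size u + 20).
Proof.
apply: (@runs_le _ _ _ ((8 * size u + 1) + (1 + (5 * size u).+1))); first by lia.
apply: runs_seq; first exact: runs_output_loop.
apply: runs_seq; first exact/runs_exec/EPop.
have := @runs_pour R1 R0 (St [::] (catrev u [::]) [::] [::]) isT.
by rewrite /= catrevK cats0 catrevE cats0 size_rev.
Qed.

Fixpoint unary (n : nat) : tree := if n is m.+1 then Node Leaf (unary m) else Leaf.

Lemma tree_size_unary n : tree_size (unary n) = 2 * n + 1.
Proof. by elim: n => // n IH; rewrite [unary _]/= tree_size_Node IH tree_size_Leaf; lia. Qed.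

Definition bool_tree (b : bool) := if b then Node Leaf Leaf else Leaf.

Lemma decision_machine (F : word * word -> bool) :
  ptime (fun x => Node (word_tree x.1) (word_tree x.2)) (bool_tree \o F) ->
  exists (M : TM) k, forall u v t, (size u + size v).+2 ^ k <= t ->
    halts_within M [:: u; v] t /\ accepts_within M [:: u; v] t = F (u, v).
Proof.
case=> p [k Hp]; exists (machine (Seq load_inputs p)).
have [j Hj] : poly (fun n => (20 * n + 10 + (4 * n + 4).+2 ^ k).+1) by polyt.
exists j => u v t /(leq_trans (Hj _)) le_t.
have [t' le_t' e] : runs (Seq load_inputs p) (load [:: u; v])
    (main (tree_code (bool_tree (F (u, v))))) (20 * (size u + size v) + 10 + (4 * (size u + size v) + 4).+2 ^ k).
  apply: runs_seq; first exact: runs_load_inputs.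
  have := Hp (u, v) [::]; rewrite !cats0; apply: runs_le.
  case: (k) => // i; rewrite leq_exp2r // !ltnS tree_size_Node.
  by have := tree_size_word u; have := tree_size_word v; rewrite /=; lia.
have lt_t : t' < t by apply: leq_trans le_t.
split; first exact: machine_halts e lt_t.
by rewrite (machine_accepts e lt_t); case: (F _).
Qed.

Lemma output_machine (F : word -> word) :
  ptime (fun u => Node (word_tree u) Leaf) (word_tree \o F) ->
  exists (M : TM) k, forall u t, (size u).+2 ^ k <= t -> outputs_within M [:: u] t (F u).
Proof.
move=> PF; have [p [k Hp]] := PF; exists (machine (Seq load_inputs (Seq p output_word))).
have [m Hm] := ptime_size PF.
have [j Hj] : poly (fun n => (20 * n + 10 + ((4 * n + 4).+2 ^ k + (20 * (4 * n + 4).+2 ^ m + 20))).+1) by polyt.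
exists j => u t /(leq_trans (Hj _)) le_t.
have le_u : tree_size (Node (word_tree u) Leaf) <= 4 * size u + 4.
  by rewrite tree_size_Node tree_size_Leaf; have := tree_size_word u; lia.
have le_exp i : (tree_size (Node (word_tree u) Leaf)).+2 ^ i <= (4 * size u + 4).+2 ^ i.
  by case: i => // i; rewrite leq_exp2r.
have [t' le_t' e] : runs (Seq load_inputs (Seq p output_word)) (load [:: u]) (main (F u))
    (20 * size u + 10 + ((4 * size u + 4).+2 ^ k + (20 * (4 * size u + 4).+2 ^ m + 20))).
  apply: runs_seq; first by have := runs_load_inputs u [::]; rewrite addn0; apply.
  apply: runs_seq.
    by have := Hp u [::]; rewrite !cats0; apply: runs_le.
  apply: runs_le (runs_output_word (F u)); rewrite leq_add2r leq_mul2l /=.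
  apply: leq_trans (le_exp m); apply: leq_trans (Hm u).
  exact/ltnW/size_lt_word_tree.
exact: (@machine_outputs _ _ (main (F u)) t' t e (leq_trans _ le_t)).
Qed.

(* The search runs through the fuels 0, 1, 2, ... until [E] says that the     *)
(* fuel is enough.                                                            *)
Lemma search_machine (E A : nat * word -> bool) :
  let i (x : nat * word) := Node (unary x.1) (word_tree x.2) in
  ptime i (bool_tree \o E) -> ptime i (bool_tree \o A) ->
  exists (M : TM) k, forall u m, E (m, u) ->
  exists2 n, E (n, u) &
    forall t, (size u + m).+2 ^ k <= t ->
      halts_within M [:: u] t /\ accepts_within M [:: u] t = A (n, u).
Proof.
move=> i PE PA.
pose test x := Node (bool_tree (E x)) (i x).
pose inc (x : nat * word) := (x.1.+1, x.2).
have Ptest : ptime i test by apply: ptime_Node PE (ptime_id _).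
have [ptest [k1 Htest]] := Ptest.
have [pinit [k0 Hinit]] : ptime (fun u => Node (word_tree u) Leaf) (fun u => i (0, u)).
  by apply: ptime_Node; [apply: ptime_const | apply: ptime_left].
have [pinc [k2 Hinc]] : ptime i (test \o inc).
  apply: ptime_comp (ptime_reindex inc Ptest).
  apply: ptime_Node (ptime_right _); apply: ptime_Node (ptime_left _); exact: ptime_const.
have [pA [k3 HA]] := PA.
pose loop := While R0 (fun o => ~~ is1 o) (Seq (Pop R0) (Seq pinc (Pop R0))).
pose p := Seq load_inputs (Seq pinit (Seq ptest (Seq (Pop R0) (Seq loop (Seq drop_top pA))))).
pose S n := 4 * n + 8.
have [j Hj] : poly (fun n => ((20 * n + 10) + ((S n).+2 ^ k0 + ((S n).+2 ^ k1 + (1 +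
    ((n * (3 + (S n).+2 ^ k2) + 1) + (36 + (S n).+2 ^ k3)))))).+1).
  by rewrite /S; polyt.
exists (machine p), j => u m Em.
(* The search stops at the least fuel [n] that passes the test; [n <= m] turns a time bound in [m]
   into a bound on the number of rounds. *)
have [n [En le_nm Dn]] : exists n, [/\ E (n, u), n <= m & forall i, i < n -> ~~ E (i, u)].
  have ex : exists n, E (n, u) by exists m.
  case: (ex_minnP ex) => n En min_n; exists n; split=> //; first exact: min_n.
  by move=> l; rewrite ltnNge; apply: contra => /min_n.
exists n => // t /(leq_trans (Hj _)) le_t.
pose s := S (size u + m).
have le_X l : l <= n -> tree_size (i (l, u)) <= s.
  by rewrite /s /S tree_size_Node tree_size_unary => le_in; have := tree_size_word u; rewrite /=; lia.
have le_exp y l : y <= s -> y.+2 ^ l <= s.+2 ^ l by case: l => // l le_y; rewrite leq_exp2r.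
have H0 : tree_size (Node (word_tree u) Leaf) <= s.
  by rewrite /s /S tree_size_Node tree_size_Leaf; have := tree_size_word u; lia.
(* Induction on the number [l] of rounds that remain, the current fuel being [n - l]. *)
have Hloop l : l <= n -> runs loop (main (tree_code (bool_tree (E (n - l, u))) ++ tree_code (i (n - l, u))))
    (main (tree_code (bool_tree (E (n, u))) ++ tree_code (i (n, u)))) (l * (3 + s.+2 ^ k2) + 1).
  elim: l => [_|l IH lt_ln].
    by rewrite subn0; exists 1 => //; apply: EWhileF; rewrite En.
  have Di : (n - l.+1).+1 = n - l by lia.
  have Ei : E (n - l.+1, u) = false by apply/negbTE/Dn; lia.
  apply: (@runs_le _ _ _ ((1 + (s.+2 ^ k2 + 1)) + (l * (3 + s.+2 ^ k2) + 1)).+1).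
    by rewrite mulSn; lia.
  apply: runs_while (IH (ltnW lt_ln)); first by rewrite Ei.
  apply: runs_seq; first exact/runs_exec/EPop.
  rewrite Ei [behead _]/=; apply: runs_seq.
    have := Hinc (n - l.+1, u) [::]; rewrite !cats0; apply: runs_le.
    by apply/le_exp/le_X; lia.
  rewrite [(test \o inc) _]/= /inc [(_, u).1]/= Di; exact/runs_exec/EPop.
have [t' le_t' e] : runs p (load [:: u]) (main (tree_code (bool_tree (A (n, u)))))
   ((20 * (size u + m) + 10) + (s.+2 ^ k0 + (s.+2 ^ k1 + (1 +
    (((size u + m) * (3 + s.+2 ^ k2) + 1) + (36 + s.+2 ^ k3)))))).
  apply: runs_seq.
    by apply: runs_le (runs_load_inputs u [::]); rewrite addn0; lia.
  apply: runs_seq.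
    have := Hinit u [::]; rewrite !cats0; apply: runs_le.
    exact: le_exp.
  apply: runs_seq.
    have := Htest (0, u) [::]; rewrite !cats0; apply: runs_le.
    exact/le_exp/le_X.
  apply: runs_seq; first exact/runs_exec/EPop.
  apply: runs_seq.
    have := Hloop n (leqnn _); rewrite subnn /=; apply: runs_le.
    by rewrite leq_add2r leq_mul2r (leq_trans le_nm (leq_addl _ _)) orbT.
  apply: runs_seq.
    by apply: runs_le (runs_drop _ _); rewrite En.
  by have := HA (n, u) [::]; rewrite !cats0; apply: runs_le; apply/le_exp/le_X.
have lt_t : t' < t by apply: leq_trans le_t.
split; first exact: machine_halts e lt_t.
by rewrite (machine_accepts e lt_t); case: (A _).
Qed.

(** * Polynomial-time functions between encoded types *)

(** [witness] serves as the default value when a list of [A] is taken apart. *)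
Class Enc (A : Type) := { enc : A -> tree; witness : A }.

#[global] Instance enc_bool : Enc bool := {| enc := bool_tree; witness := false |}.
(** Numbers of type [nat] are unary, so polynomial time means polynomial in their value; binary
    numbers are handled as words. *)
#[global] Instance enc_nat : Enc nat := {| enc := unary; witness := 0 |}.
#[global] Instance enc_seq A {EA : Enc A} : Enc (seq A) :=
  {| enc := foldr (fun a => Node (enc a)) Leaf; witness := [::] |}.
#[global] Instance enc_prod A B {EA : Enc A} {EB : Enc B} : Enc (A * B) :=
  {| enc := fun x => Node (enc x.1) (enc x.2); witness := (witness, witness) |}.

Definition esize A {EA : Enc A} (a : A) := tree_size (enc a).

Definition FP A B {EA : Enc A} {EB : Enc B} (f : A -> B) := ptime enc (fun a => enc (f a)).

Lemma esize_pair A B {EA : Enc A} {EB : Enc B} (x : A * B) :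
  esize x = (esize x.1 + esize x.2).+1.
Proof. exact: tree_size_Node. Qed.
Lemma esize_cons A {EA : Enc A} (a : A) s : esize (a :: s) = (esize a + esize s).+1.
Proof. exact: tree_size_Node. Qed.
Lemma esize_nil A {EA : Enc A} : esize ([::] : seq A) = 1. Proof. by []. Qed.
Lemma esize_nat (n : nat) : esize n = 2 * n + 1. Proof. exact: tree_size_unary. Qed.
Lemma esize_bool (b : bool) : esize b <= 3. Proof. by case: b. Qed.
Lemma size_esize A {EA : Enc A} (s : seq A) : size s < esize s.
Proof. by elim: s => // a s IH; rewrite esize_cons /=; lia. Qed.
Lemma esize_mem (A : eqType) {EA : Enc A} (s : seq A) a : a \in s -> esize a < esize s.
Proof.
by elim: s => // b s IH; rewrite inE esize_cons => /orP[/eqP->|/IH]; lia.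
Qed.
Lemma esize_gt0 A {EA : Enc A} (a : A) : 0 < esize a. Proof. exact: tree_size_gt0. Qed.
Lemma esize_cat A {EA : Enc A} (s t : seq A) : esize (s ++ t) = (esize s + esize t).-1.
Proof.
elim: s => [|a s IH]; first by rewrite esize_nil.
have gt0 : 0 < esize s by apply: esize_gt0.
by rewrite cat_cons !esize_cons IH; lia.
Qed.
Lemma esize_rev A {EA : Enc A} (s : seq A) : esize (rev s) = esize s.
Proof.
elim: s => // a s IH; rewrite rev_cons -cats1 esize_cat !esize_cons IH esize_nil; lia.
Qed.
Lemma spine_seq A {EA : Enc A} (s : seq A) : spine (enc s) = size s.
Proof. by elim: s => //= a s ->. Qed.
Lemma spine_unary n : spine (unary n) = n.
Proof. by elim: n => //= n ->. Qed.

Lemma FP_size A B {EA : Enc A} {EB : Enc B} (f : A -> B) :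
  FP f -> exists k, forall a, esize (f a) <= (esize a).+2 ^ k.
Proof. exact: ptime_size. Qed.

Lemma fp_ext A B {EA : Enc A} {EB : Enc B} (f g : A -> B) : f =1 g -> FP f -> FP g.
Proof. by move=> fg; apply: ptime_ext => // a; rewrite fg. Qed.

Lemma fp_compose A B C {EA : Enc A} {EB : Enc B} {EC : Enc C} (g : B -> C) (f : A -> B) :
  FP g -> FP f -> FP (fun a => g (f a)).
Proof. by move=> Pg Pf; apply: ptime_comp Pf _; apply: (ptime_reindex f Pg). Qed.

Section Combinators.
Context {E A B : Type} {EE : Enc E} {EA : Enc A} {EB : Enc B}.

Lemma fp_id : FP (fun e : E => e). Proof. exact: ptime_id. Qed.
Lemma fp_const (c : A) : FP (fun _ : E => c). Proof. exact: ptime_const. Qed.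

Lemma fp_pair (f : E -> A) (g : E -> B) : FP f -> FP g -> FP (fun e => (f e, g e)).
Proof. exact: ptime_Node. Qed.
Lemma fp_fst (f : E -> A * B) : FP f -> FP (fun e => (f e).1).
Proof. by move=> Pf; apply: ptime_comp Pf _; apply: ptime_left. Qed.
Lemma fp_snd (f : E -> A * B) : FP f -> FP (fun e => (f e).2).
Proof. by move=> Pf; apply: ptime_comp Pf _; apply: ptime_right. Qed.

Lemma fp_if (c : E -> bool) (f g : E -> A) :
  FP c -> FP f -> FP g -> FP (fun e => if c e then f e else g e).
Proof.
move=> Pc Pf Pg; have := ptime_if Pc (ptime_reindex sval Pf) (ptime_reindex sval Pg).
by apply: ptime_ext => // e /=; case: (c e).
Qed.

Lemma fp_S (f : E -> nat) : FP f -> FP (fun e => (f e).+1).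
Proof. by move=> Pf; apply: ptime_Node Pf; apply: ptime_const. Qed.
Lemma fp_pred (f : E -> nat) : FP f -> FP (fun e => (f e).-1).
Proof.
move=> Pf; apply: ptime_comp Pf _; apply: ptime_ext (ptime_right _) => // e /=.
by case: (f e).
Qed.
Lemma fp_eq0 (f : E -> nat) : FP f -> FP (fun e => f e == 0).
Proof.
move=> Pf; have := ptime_if (f := fun=> bool_tree false) (g := fun=> bool_tree true) Pf (ptime_const _ (bool_tree false)) (ptime_const _ (bool_tree true)).
by apply: ptime_ext => // e; case: (f e).
Qed.

Lemma fp_cons (f : E -> A) (g : E -> seq A) : FP f -> FP g -> FP (fun e => f e :: g e).
Proof. exact: ptime_Node. Qed.
Lemma fp_behead (f : E -> seq A) : FP f -> FP (fun e => behead (f e)).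
Proof.
move=> Pf; apply: ptime_comp Pf _; apply: ptime_ext (ptime_right _) => // e /=.
by case: (f e).
Qed.
Lemma fp_nilp (f : E -> seq A) : FP f -> FP (fun e => nilp (f e)).
Proof.
move=> Pf; have := ptime_if (f := fun=> bool_tree false) (g := fun=> bool_tree true) Pf (ptime_const _ (bool_tree false)) (ptime_const _ (bool_tree true)).
by apply: ptime_ext => // e; case: (f e).
Qed.
Lemma fp_head (d : E -> A) (f : E -> seq A) : FP d -> FP f -> FP (fun e => head (d e) (f e)).
Proof.
move=> Pd Pf.
have H : ptime (fun x : {x | is_node (enc (f x))} => enc (sval x))
               (fun x => left_tree (enc (f (sval x)))).
  by apply: ptime_comp (ptime_left _); apply: (ptime_reindex sval Pf).
have := ptime_if (f := fun x => left_tree (enc (f x))) Pf H (ptime_reindex sval Pd).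
by apply: ptime_ext => // e; case: (f e).
Qed.
End Combinators.

Lemma fp_iter E S {EE : Enc E} {ES : Enc S} (n : E -> nat) (h : E -> S -> S) (s : E -> S) b :
  FP n -> FP s -> FP (fun x => h x.1 x.2) -> poly b ->
  (forall e j, j <= n e -> esize (iter j (h e) (s e)) <= b (esize e)) ->
  FP (fun e => iter (n e) (h e) (s e)).
Proof.
move=> Pn Ps Ph Pb Hb.
pose h' (x : E * S) := (x.1, h x.1 x.2).
have h'E e j : iter j h' (e, s e) = (e, iter j (h e) (s e)) by elim: j => //= j ->.
have Ph' : FP h' by apply: fp_pair => //; apply: fp_fst; apply: fp_id.
apply: (fp_ext (f := fun e => (iter (n e) h' (e, s e)).2)); first by move=> e; rewrite h'E.
have Ps' : FP (fun e => (e, s e)) by apply: fp_pair Ps; apply: fp_id.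
have Pb' : poly (fun m => (m + b m).+1) by polyt.
apply: fp_snd; apply: ptime_ext (ptime_iter (n := fun e => enc (n e)) (f := fun e => (e, s e))
  Pn Ph' Ps' Pb' _) => // [e|e j]; rewrite /= spine_unary // => /Hb le_b.
by rewrite h'E tree_size_Node ltnS leq_add2l.
Qed.

Lemma fp_foldl_bounded E A S {EE : Enc E} {EA : Enc A} {ES : Enc S}
    (l : E -> seq A) (h : E -> S -> A -> S) (s : E -> S) b :
  FP l -> FP s -> FP (fun x : E * (S * A) => h x.1 x.2.1 x.2.2) -> poly b ->
  (forall e j, esize (foldl (h e) (s e) (take j (l e))) <= b (esize e)) ->
  FP (fun e => foldl (h e) (s e) (l e)).
Proof.
move=> Pl Ps Ph Pb Hb.
(* The state of the iteration consists of the context, the part of the list still to be read, and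
   the accumulator. *)
pose h' (x : E * (seq A * S)) := (x.1, (behead x.2.1,
  if nilp x.2.1 then x.2.2 else h x.1 x.2.2 (head (@witness A EA) x.2.1))).
have h'E e j : iter j h' (e, (l e, s e)) = (e, (drop j (l e), foldl (h e) (s e) (take j (l e)))).
  elim: j => [|j IH]; first by rewrite drop0 take0.
  rewrite iterS IH /h' /=; congr (_, _); congr (_, _).
    by rewrite -drop1 drop_drop add1n.
  case: (ltnP j (size (l e))) => lt_j.
    rewrite (take_nth witness lt_j) -cats1 foldl_cat (drop_nth witness lt_j) //.
  by rewrite drop_oversize // !take_oversize // ltnW.
have P1 : FP (fun x : E * (seq A * S) => x.1) by apply: fp_fst; apply: fp_id.
have P2 : FP (fun x : E * (seq A * S) => x.2.1) by apply: fp_fst; apply: fp_snd; apply: fp_id.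
have P3 : FP (fun x : E * (seq A * S) => x.2.2) by apply: fp_snd; apply: fp_snd; apply: fp_id.
have Ph' : FP h'.
  apply: (fp_pair P1); apply: fp_pair; first exact: fp_behead.
  apply: (fp_if _ P3); first exact: fp_nilp.
  apply: (fp_compose (g := fun x : E * (S * A) => h x.1 x.2.1 x.2.2)
    (f := fun x : E * (seq A * S) => (x.1, (x.2.2, head (@witness A EA) x.2.1)))) => //.
  apply: (fp_pair P1); apply: (fp_pair P3); apply: (fp_head _ P2); exact: fp_const.
have [k Hk] := FP_size Pl.
apply: (fp_ext (f := fun e => (iter (size (l e)) h' (e, (l e, s e))).2.2)).
  by move=> e; rewrite h'E take_size.
have Ps' : FP (fun e => (e, (l e, s e))).
  by apply: fp_pair; [apply: fp_id | apply: fp_pair].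
have Pb' : poly (fun m => (m + (m.+2 ^ k + b m).+1).+1) by polyt.
apply: fp_snd; apply: fp_snd.
apply: ptime_ext (ptime_iter (n := fun e => enc (l e)) (f := fun e => (e, (l e, s e)))
  Pl Ph' Ps' Pb' _) => // [e|e j]; rewrite spine_seq // => le_j.
rewrite h'E -/(esize _) esize_pair ltnS leq_add2l esize_pair ltnS.
apply: leq_add; last exact: Hb.
apply: leq_trans (Hk e); have -> : esize (l e) = esize (take j (l e) ++ drop j (l e)).
  by rewrite cat_take_drop.
have gt0 : 0 < esize (take j (l e)) by apply: esize_gt0.
by rewrite esize_cat /=; lia.
Qed.

Lemma esize_foldl E A S {EE : Enc E} {EA : Enc A} {ES : Enc S} (h : S -> A -> S) s (l : seq A) B :
  (forall s a, esize a <= esize l -> esize (h s a) <= esize s + B) ->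
  esize (foldl h s l) <= esize s + size l * B.
Proof.
elim: l s => [|a l IH] s H /=; first by rewrite mul0n addn0.
apply: leq_trans (IH _ _) _.
  by move=> s' a' le_a; apply: H; rewrite esize_cons; lia.
by have := H s a; rewrite esize_cons mulSn => /(_ ltac:(lia)); lia.
Qed.

(** A step may enlarge the accumulator by an amount depending on the context and the list element
    only; growth is then additive along the list, hence polynomial. *)
Lemma fp_foldl E A S {EE : Enc E} {EA : Enc A} {ES : Enc S}
    (l : E -> seq A) (h : E -> S -> A -> S) (s : E -> S) k :
  FP l -> FP s -> FP (fun x : E * (S * A) => h x.1 x.2.1 x.2.2) ->
  (forall e s a, esize (h e s a) <= esize s + (esize e + esize a).+2 ^ k) ->
  FP (fun e => foldl (h e) (s e) (l e)).
Proof.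
move=> Pl Ps Ph Hk; have [i Hi] := FP_size Pl; have [j Hj] := FP_size Ps.
apply: (fp_foldl_bounded (b := fun m => m.+2 ^ j + m.+2 ^ i * (m + m.+2 ^ i).+2 ^ k) Pl Ps Ph).
  by polyt.
move=> e t; set u := take t (l e).
have le_u : esize u <= esize (l e).
  have -> : esize (l e) = esize (take t (l e) ++ drop t (l e)) by rewrite cat_take_drop.
  have gt0 : 0 < esize (drop t (l e)) by apply: esize_gt0.
  by rewrite esize_cat /u; lia.
have le_exp c d : c <= d -> c.+2 ^ k <= d.+2 ^ k by case: (k) => // q; rewrite leq_exp2r.
apply: leq_trans (esize_foldl (B := (esize e + esize (l e)).+2 ^ k) _ _) _.
  move=> s' a le_a; apply: leq_trans (Hk _ _ _) _; rewrite leq_add2l le_exp //.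
  by rewrite leq_add2l (leq_trans le_a).
rewrite leq_add ?Hj // leq_mul //.
  by apply: leq_trans (Hi e); apply: leq_trans le_u; apply/ltnW/size_esize.
by rewrite le_exp // leq_add2l Hi.
Qed.

(* One table of closure lemmas per group of functions; a table is filled in   *)
(* when its functions have been defined.                                      *)
Ltac fp_data := fail.
Ltac fp_binary := fail.
Ltac fp_graph := fail.
Ltac fp_hyperedge := fail.
Ltac fp_elimination := fail.

Ltac fp_step := cbn beta zeta; lazymatch goal with
  | |- FP (@fst _ _) => exact (fp_fst fp_id)
  | |- FP (@snd _ _) => exact (fp_snd fp_id)
  | |- FP (fun e => e) => exact fp_id
  | |- FP (fun _ => ?c) => exact (fp_const c)
  | |- FP (fun e => (@?f e, @?g e)) => apply (@fp_pair _ _ _ _ _ _ f g)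
  | |- FP (fun e => fst (@?f e)) => apply (@fp_fst _ _ _ _ _ _ f)
  | |- FP (fun e => snd (@?f e)) => apply (@fp_snd _ _ _ _ _ _ f)
  | |- FP (fun e => if _ then _ else _) => apply fp_if
  | |- FP (fun e => S (@?f e)) => apply (@fp_S _ _ f)
  | |- FP (fun e => predn (@?f e)) => apply (@fp_pred _ _ f)
  | |- FP (fun e => cons (@?f e) (@?g e)) => apply (@fp_cons _ _ _ _ f g)
  | |- FP (fun e => behead (@?f e)) => apply (@fp_behead _ _ _ _ f)
  | |- FP (fun e => nilp (@?f e)) => apply (@fp_nilp _ _ _ _ f)
  | |- FP (fun e => head (@?d e) (@?f e)) => apply (@fp_head _ _ _ _ d f)
  | H : FP ?h |- FP (fun e => ?h (@?f e)) => apply (@fp_compose _ _ _ _ _ _ h f H)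
  | _ => first [fp_data | fp_binary | fp_graph | fp_hyperedge | fp_elimination]
  end.
Ltac fp := cbn beta zeta; first [ assumption | fp_step; fp | idtac ].

Lemma fp_app2 E A B C {EE : Enc E} {EA : Enc A} {EB : Enc B} {EC : Enc C}
    (h : A -> B -> C) (f : E -> A) (g : E -> B) :
  FP (fun x => h x.1 x.2) -> FP f -> FP g -> FP (fun e => h (f e) (g e)).
Proof. by move=> Ph Pf Pg; apply: (fp_compose Ph (fp_pair Pf Pg)). Qed.

Lemma fp_app3 E A B C D {EE : Enc E} {EA : Enc A} {EB : Enc B} {EC : Enc C} {ED : Enc D}
    (h : A -> B -> C -> D) (f : E -> A) (g : E -> B) (k : E -> C) :
  FP (fun x => h x.1 x.2.1 x.2.2) -> FP f -> FP g -> FP k ->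
  FP (fun e => h (f e) (g e) (k e)).
Proof. by move=> Ph Pf Pg Pk; apply: (fp_compose Ph (fp_pair Pf (fp_pair Pg Pk))). Qed.

Lemma fp_rev E A {EE : Enc E} {EA : Enc A} (l : E -> seq A) : FP l -> FP (fun e => rev (l e)).
Proof.
move=> Pl; apply: (fp_ext (f := fun e => foldl (fun s a => a :: s) [::] (l e))).
  move=> e; rewrite -[RHS]cats0 -catrevE.
  by elim: (l e) [::] => //= a s IH t; rewrite IH.
apply: (fp_foldl (h := fun _ s a => a :: s) (k := 1)) => //; first by fp.
  by fp.
by move=> e s a; rewrite esize_cons expn1; lia.
Qed.

Lemma fp_foldr E A S {EE : Enc E} {EA : Enc A} {ES : Enc S} (l : E -> seq A) (h : E -> A -> S -> S) (s : E -> S) k :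
  FP l -> FP s -> FP (fun x : E * (A * S) => h x.1 x.2.1 x.2.2) ->
  (forall e a s, esize (h e a s) <= esize s + (esize e + esize a).+2 ^ k) ->
  FP (fun e => foldr (h e) (s e) (l e)).
Proof.
move=> Pl Ps Ph Hk.
apply: (fp_ext (f := fun e => foldl (fun s a => h e a s) (s e) (rev (l e)))).
  by move=> e; rewrite foldl_rev.
apply: (fp_foldl (h := fun e s a => h e a s) (k := k)) => //; first exact: fp_rev.
by apply (fp_app3 Ph); fp.
Qed.

(** * Closure under list operations *)

Section Lists.
Context {E A B : Type} {EE : Enc E} {EA : Enc A} {EB : Enc B}.

Lemma fp_map (f : E -> A -> B) (l : E -> seq A) :
  FP (fun x => f x.1 x.2) -> FP l -> FP (fun e => [seq f e a | a <- l e]).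
Proof.
move=> Pf Pl; have [k Hk] := FP_size Pf.
have [j Hj] : poly (fun m => (m.+3 ^ k).+1) by apply: poly_S; apply: (@poly_comp_exp succn); polyt.
apply: (fp_ext (f := fun e => foldr (fun a s => f e a :: s) [::] (l e))).
  by move=> e; elim: (l e) => //= a s ->.
apply: (fp_foldr (h := fun e a s => f e a :: s) (k := j)) => //; first by fp.
  by fp; apply (fp_app2 Pf); fp.
move=> e a s; rewrite esize_cons; have := Hk (e, a); rewrite esize_pair /= => le_f.
by rewrite addnC -addnS leq_add2l; apply: leq_ltn_trans le_f (Hj _).
Qed.

Lemma fp_filter (p : E -> A -> bool) (l : E -> seq A) :
  FP (fun x => p x.1 x.2) -> FP l -> FP (fun e => [seq a <- l e | p e a]).
Proof.
move=> Pp Pl.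
apply: (fp_ext (f := fun e => foldr (fun a s => if p e a then a :: s else s) [::] (l e))).
  by move=> e; elim: (l e) => //= a s ->.
apply: (fp_foldr (h := fun e a s => if p e a then a :: s else s) (k := 1)) => //; first by fp.
  by fp; apply (fp_app2 Pp); fp.
by move=> e a s; case: (p e a); rewrite ?esize_cons expn1; lia.
Qed.

Lemma fp_has (p : E -> A -> bool) (l : E -> seq A) :
  FP (fun x => p x.1 x.2) -> FP l -> FP (fun e => has (p e) (l e)).
Proof.
move=> Pp Pl.
apply: (fp_ext (f := fun e => foldr (fun a b => if p e a then true else b) false (l e))).
  by move=> e; elim: (l e) => //= a s ->; case: (p e a).
apply: (fp_foldr (h := fun e a b => if p e a then true else b) (k := 1)) => //; first by fp.
  by fp; apply (fp_app2 Pp); fp.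
move=> e a s; have gt0 : 0 < esize e by apply: esize_gt0.
by case: (p e a) => //; rewrite ?leq_addr // expn1 (leq_trans (esize_bool _)); lia.
Qed.

Lemma fp_all (p : E -> A -> bool) (l : E -> seq A) :
  FP (fun x => p x.1 x.2) -> FP l -> FP (fun e => all (p e) (l e)).
Proof.
move=> Pp Pl.
apply: (fp_ext (f := fun e => if has (fun a => if p e a then false else true) (l e) then false else true)).
  by move=> e; elim: (l e) => //= a s; case: (p e a).
apply: fp_if; [apply: fp_has => //|apply: fp_const|apply: fp_const].
by fp.
Qed.

Lemma fp_size (l : E -> seq A) : FP l -> FP (fun e => size (l e)).
Proof.
move=> Pl; apply: (fp_ext (f := fun e => foldr (fun _ n => n.+1) 0 (l e))).
  by move=> e; elim: (l e) => //= a s ->.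
apply: (fp_foldr (h := fun _ _ n => n.+1) (k := 1) (s := fun=> 0)) => //; first by fp.
  by fp.
by move=> e a s; rewrite !esize_nat expn1; lia.
Qed.

Lemma fp_cat (s t : E -> seq A) : FP s -> FP t -> FP (fun e => s e ++ t e).
Proof.
move=> Ps Pt; apply: (fp_ext (f := fun e => foldr cons (t e) (s e))).
  by move=> e; elim: (s e) => //= a u ->.
apply: (fp_foldr (h := fun e a s => a :: s) (k := 1)) => //; first by fp.
by move=> e a u; rewrite ?esize_cons expn1; lia.
Qed.
End Lists.

Lemma fp_flatten E A {EE : Enc E} {EA : Enc A} (l : E -> seq (seq A)) :
  FP l -> FP (fun e => flatten (l e)).
Proof.
move=> Pl; apply: (fp_foldr (h := fun e a s => a ++ s) (k := 1)) => //; first by fp.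
  by apply: fp_cat; fp.
by move=> e a u; rewrite ?esize_cat expn1; lia.
Qed.

(** * Closure under unary arithmetic *)

Section Numbers.
Context {E : Type} {EE : Enc E}.

Lemma fp_negb (b : E -> bool) : FP b -> FP (fun e => ~~ b e).
Proof. by move=> Pb; apply: (fp_if Pb); fp. Qed.
Lemma fp_and (b c : E -> bool) : FP b -> FP c -> FP (fun e => b e && c e).
Proof. by move=> Pb Pc; apply: (fp_if Pb); fp. Qed.
Lemma fp_or (b c : E -> bool) : FP b -> FP c -> FP (fun e => b e || c e).
Proof. by move=> Pb Pc; apply: (fp_if Pb); fp. Qed.
Lemma fp_eqb (b c : E -> bool) : FP b -> FP c -> FP (fun e => b e == c e).
Proof.
move=> Pb Pc; apply: (fp_ext (f := fun e => if b e then c e else ~~ c e)).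
  by move=> e; case: (b e); case: (c e).
by apply: (fp_if Pb) => //; apply: fp_negb.
Qed.

Lemma fp_add (m n : E -> nat) : FP m -> FP n -> FP (fun e => m e + n e).
Proof.
move=> Pm Pn; have [j Hj] := FP_size Pm; have [k Hk] := FP_size Pn.
have iterE a b : iter a succn b = a + b by elim: a => //= a ->.
apply: (fp_ext (f := fun e => iter (m e) succn (n e))); first by move=> e; rewrite iterE.
apply: (@fp_iter _ _ _ _ m (fun _ => succn) n (fun x => x.+2 ^ j + x.+2 ^ k)) => //.
- by fp.
- by polyt.
by move=> e i le_i; rewrite iterE; have := Hj e; have := Hk e; rewrite !esize_nat; lia.
Qed.

Lemma fp_sub (m n : E -> nat) : FP m -> FP n -> FP (fun e => m e - n e).
Proof.
move=> Pm Pn; have [j Hj] := FP_size Pm.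
have iterE a b : iter a predn b = b - a by elim: a => [|a /= ->]; rewrite ?subn0 ?subnS.
apply: (fp_ext (f := fun e => iter (n e) predn (m e))); first by move=> e; rewrite iterE.
apply: (@fp_iter _ _ _ _ n (fun _ => predn) m (fun x => x.+2 ^ j)) => //.
- by fp.
- by polyt.
by move=> e i le_i; rewrite iterE; have := Hj e; rewrite !esize_nat; lia.
Qed.
End Numbers.

Section Comparisons.
Context {E : Type} {EE : Enc E}.

Lemma fp_leq (m n : E -> nat) : FP m -> FP n -> FP (fun e => m e <= n e).
Proof. by move=> Pm Pn; apply: fp_eq0; apply: fp_sub. Qed.

Lemma fp_eqn (m n : E -> nat) : FP m -> FP n -> FP (fun e => m e == n e).
Proof.
move=> Pm Pn; apply: (fp_ext (f := fun e => (m e <= n e) && (n e <= m e))).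
  by move=> e; rewrite eqn_leq.
by apply: fp_and; apply: fp_leq.
Qed.

Lemma fp_min (m n : E -> nat) : FP m -> FP n -> FP (fun e => minn (m e) (n e)).
Proof. by move=> Pm Pn; apply: fp_if => //; apply: fp_leq => //; apply: fp_S. Qed.

Lemma fp_mul (m n : E -> nat) : FP m -> FP n -> FP (fun e => m e * n e).
Proof.
move=> Pm Pn; have [j Hj] := FP_size Pm; have [k Hk] := FP_size Pn.
have iterE a b : iter a (addn b) 0 = a * b by elim: a => //= a ->.
apply: (fp_ext (f := fun e => iter (m e) (addn (n e)) 0)); first by move=> e; rewrite iterE.
apply: (@fp_iter _ _ _ _ m (fun e => addn (n e)) (fun=> 0)
         (fun x => 2 * (x.+2 ^ j * x.+2 ^ k) + 1)) => //.
- exact: fp_const.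
- by apply: fp_add; fp.
- by polyt.
move=> e i le_i; rewrite iterE esize_nat leq_add2r leq_mul2l /=; apply: leq_mul.
  by apply: leq_trans (Hj e); rewrite esize_nat; lia.
by apply: leq_trans (Hk e); rewrite esize_nat; lia.
Qed.

Lemma fp_exp (m : E -> nat) k : FP m -> FP (fun e => m e ^ k).
Proof.
move=> Pm; elim: k => [|k IH]; first exact: fp_const.
by apply: (fp_ext (f := fun e => m e * m e ^ k)); [move=> e; rewrite expnS | apply: fp_mul].
Qed.

Lemma fp_drop A {EA : Enc A} (n : E -> nat) (s : E -> seq A) :
  FP n -> FP s -> FP (fun e => drop (n e) (s e)).
Proof.
move=> Pn Ps; have [j Hj] := FP_size Ps.
have iterE a (b : seq A) : iter a behead b = drop a b.
  by elim: a b => [|a IH] b; rewrite ?drop0 // iterSr IH; case: b.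
apply: (fp_ext (f := fun e => iter (n e) behead (s e))); first by move=> e; rewrite iterE.
apply: (@fp_iter _ _ _ _ n (fun _ => behead) s (fun x => x.+2 ^ j)) => //.
- by fp.
- by polyt.
move=> e i le_i; rewrite iterE; apply: leq_trans (Hj e).
have -> : esize (s e) = esize (take i (s e) ++ drop i (s e)) by rewrite cat_take_drop.
have gt0 : 0 < esize (take i (s e)) by apply: esize_gt0.
by rewrite esize_cat; lia.
Qed.

Lemma fp_nth A {EA : Enc A} (d : E -> A) (s : E -> seq A) (n : E -> nat) :
  FP d -> FP s -> FP n -> FP (fun e => nth (d e) (s e) (n e)).
Proof.
move=> Pd Ps Pn; apply: (fp_ext (f := fun e => head (d e) (drop (n e) (s e)))).
  by move=> e; rewrite -nth0 nth_drop addn0.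
by apply: fp_head => //; apply: fp_drop.
Qed.

End Comparisons.

Lemma fp_iota E {EE : Enc E} (m n : E -> nat) : FP m -> FP n -> FP (fun e => iota (m e) (n e)).
Proof.
move=> Pm Pn; have [j Hj] := FP_size Pm; have [k Hk] := FP_size Pn.
have iterE a b : iter b (fun s => a :: [seq i.+1 | i <- s]) [::] = iota a b.
  by elim: b => //= b ->; rewrite -[a.+1]add1n iotaDl.
apply: (fp_ext (f := fun e => iter (n e) (fun s => m e :: [seq i.+1 | i <- s]) [::])).
  by move=> e; rewrite iterE.
apply: (@fp_iter _ _ _ _ n (fun e s => m e :: [seq i.+1 | i <- s]) (fun=> [::])
         (fun x => x.+2 ^ k * (2 * (x.+2 ^ j + x.+2 ^ k) + 2) + 1)) => //.
- exact: fp_const.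
- fp; apply: (fp_map (f := fun _ i => i.+1)); fp.
- by polyt.
move=> e i le_i; rewrite iterE.
have : esize (iota (m e) i) <= i * (2 * (m e + i) + 2) + 1.
  elim: i (m e) {le_i} => // i IH a; rewrite [iota _ _]/= esize_cons esize_nat.
  by have := IH a.+1; nia.
have := Hj e; have := Hk e; rewrite !esize_nat => H1 H2 /leq_trans; apply.
by rewrite leq_add2r; apply: leq_mul; lia.
Qed.

Ltac fp_data ::= lazymatch goal with
  | |- FP (fun e => ~~ (@?f e)) => apply (@fp_negb _ _ f)
  | |- FP (fun e => andb (@?f e) (@?g e)) => apply (@fp_and _ _ f g)
  | |- FP (fun e => orb (@?f e) (@?g e)) => apply (@fp_or _ _ f g)
  | |- FP (fun e => @eq_op _ (@?f e) (@?g e)) =>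
      first [apply (@fp_eqn _ _ f g) | apply (@fp_eqb _ _ f g)]
  | |- FP (fun e => (@?f e) <= (@?g e)) => apply (@fp_leq _ _ f g)
  | |- FP (fun e => (@?f e) + (@?g e)) => apply (@fp_add _ _ f g)
  | |- FP (fun e => (@?f e) - (@?g e)) => apply (@fp_sub _ _ f g)
  | |- FP (fun e => (@?f e) * (@?g e)) => apply (@fp_mul _ _ f g)
  | |- FP (fun e => (@?f e) ^ ?k) => apply (@fp_exp _ _ f k)
  | |- FP (fun e => minn (@?f e) (@?g e)) => apply (@fp_min _ _ f g)
  | |- FP (fun e => iota (@?f e) (@?g e)) => apply (@fp_iota _ _ f g)
  | |- FP (fun e => drop (@?f e) (@?g e)) => apply (@fp_drop _ _ _ _ f g)
  | |- FP (fun e => nth (@?d e) (@?f e) (@?g e)) => apply (@fp_nth _ _ _ _ d f g)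
  | |- FP (fun e => rev (@?f e)) => apply (@fp_rev _ _ _ _ f)
  | |- FP (fun e => size (@?f e)) => apply (@fp_size _ _ _ _ f)
  | |- FP (fun e => flatten (@?f e)) => apply (@fp_flatten _ _ _ _ f)
  | |- FP (fun e => cat (@?f e) (@?g e)) => apply (@fp_cat _ _ _ _ f g)
  | |- FP (fun e => map (fun a => @?f e a) (@?l e)) => apply (@fp_map _ _ _ _ _ _ f l)
  | |- FP (fun e => filter (fun a => @?f e a) (@?l e)) => apply (@fp_filter _ _ _ _ f l)
  | |- FP (fun e => has (fun a => @?f e a) (@?l e)) => apply (@fp_has _ _ _ _ f l)
  | |- FP (fun e => all (fun a => @?f e a) (@?l e)) => apply (@fp_all _ _ _ _ f l)
  end.

(** * Tree decompositions *)

Section Trees.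
Variables (T : finType) (e : rel T).
Hypothesis tree_e : is_tree e.

Definition avoiding (z : T) : rel T := [rel a b | [&& e a b, a != z & b != z]].

Lemma avoiding_sym z : connect_sym (avoiding z).
Proof.
have [_ e_sym _ _ _] := tree_e.
by apply: sym_connect_sym => a b; rewrite /avoiding /= e_sym [(a != z) && _]andbC.
Qed.

(** A path between two different neighbours of [z] that avoids [z] would close up to a cycle through
    [z]. *)
Lemma tree_branch z y y' : e z y -> e z y' -> connect (avoiding z) y y' -> y = y'.
Proof.
have [_ e_sym e_irr _ acyclic] := tree_e.
move=> ezy ezy' /connectP[p0 p0P Dy']; case: (shortenP p0P) Dy' => p pP Up _ Dy'.
case: p pP Up Dy' => [|x p] pP Up Dy'; first by rewrite Dy'.
have /negP[] : ~~ ucycleb e [:: z, y, x & p] by apply: acyclic.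
have pe : path e y (x :: p) by apply: sub_path pP => a b /and3P[].
have nz : z \notin x :: p.
  elim: (x :: p) y pP {pe Up Dy' ezy p0P} => //= b s IH a /andP[/and3P[_ _ bz] /IH].
  by rewrite inE negb_or eq_sym bz.
apply/andP; split.
  change (e z y && path e y (rcons (x :: p) z)).
  by rewrite ezy rcons_path pe -Dy' e_sym.
rewrite cons_uniq Up andbT inE negb_or nz andbT.
by apply: contraTneq ezy => ->; rewrite e_irr.
Qed.

(** Take the distance to an arbitrary root: the first step of a shortest path decreases it. *)
Lemma tree_depth : exists r (d : T -> nat), d r = 0 /\
  forall x, x != r -> exists2 y, e x y & d y < d x.
Proof.
have [T_gt0 _ _ conn _] := tree_e.
have [r _] := card_gt0P T_gt0.
pose P x n := [exists p : n.-tuple T, path e x p && (last x p == r)].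
have exP x : exists n, P x n.
  have /connectP[p pP Dr] := conn x r; exists (size p).
  by apply/existsP; exists (in_tuple p); rewrite /= pP -Dr eqxx.
exists r, (fun x => ex_minn (exP x)); split.
  case: ex_minnP => m _ /(_ 0); rewrite leqn0 => min_m; apply/eqP/min_m.
  by apply/existsP; exists [tuple] => /=.
move=> x ne_xr; case: (ex_minnP (exP x)) => m /existsP[[p /= /eqP sz_p] /andP[pP Dr]] min_m.
case: p sz_p pP Dr => [|y p] /= sz_p; first by rewrite (negPf ne_xr).
move=> /andP[exy pP] Dr; exists y => //; case: ex_minnP => k _ /(_ (size p)) min_k.
rewrite -sz_p ltnS min_k //; apply/existsP; exists (in_tuple p); by rewrite /= pP.
Qed.

Variables (V : finType) (bag : T -> {set V}) (adj : rel V) (L : {set V}).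
Hypothesis bag_node : forall v, v \in L -> exists x, v \in bag x.
Hypothesis bag_adj : forall u v, u \in L -> v \in L -> adj u v ->
  exists x, (u \in bag x) && (v \in bag x).
Hypothesis bag_conn : forall v x y, v \in L -> v \in bag x -> v \in bag y ->
  connect [rel a b | [&& e a b, v \in bag a & v \in bag b]] x y.

(* Root the tree and choose v so that the topmost node of the subtree of v is *)
(* as deep as possible: the subtree of a neighbour u meets that of v and has  *)
(* a node at least as high, hence it contains the topmost node of v.          *)
Lemma simplicial_vertex : L != set0 ->
  exists v x, [/\ v \in L, v \in bag x & forall u, u \in L -> adj v u -> u \in bag x].
Proof.
have [_ e_sym e_irr _ _] := tree_e.
have [r [d [d_r d_lt]]] := tree_depth.
(* Descending in depth from a node no deeper than [z] never meets [z], because the depth drops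
   strictly from the first step on. *)
have to_root z u : u != z -> d u <= d z -> z != r /\ connect (avoiding z) u r.
  elim: {u}(d u) {-2}u (leqnn (d u)) => [|m IH] u le_u ne_uz le_d.
    have Du : u = r by apply: contraTeq le_u => /d_lt[y _]; lia.
    by rewrite -Du eq_sym.
  have [Du|/d_lt[y euy lt_y]] := eqVneq u r; first by rewrite -Du eq_sym.
  have ne_yz : y != z by apply: contraTneq lt_y => ->; lia.
  have [||-> cyr] // := IH y _ ne_yz; try lia.
  by split=> //; apply: connect_trans cyr; apply: connect1; rewrite /avoiding /= euy ne_uz.
pose top x := [exists v in L, (v \in bag x) && [forall y, (v \in bag y) ==> (d x <= d y)]].
have topP v : v \in L -> exists2 x, v \in bag x & top x.
  move=> Lv; have [x0 bx0] := bag_node Lv.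
  case: (@arg_minnP _ x0 [pred x | v \in bag x] d bx0) => x bx min_x; exists x => //.
  apply/existsP; exists v; rewrite Lv /=; apply/andP; split=> //; apply/forallP=> y; apply/implyP; exact: min_x.
case/set0Pn => v0 /topP[x0 _ tx0].
case: (@arg_maxnP _ x0 top d tx0) => z /existsP[v /and3P[Lv bvz /forallP min_z]] max_z.
exists v, z; split=> // u Lu adj_vu; apply: contraT => nbuz.
have [x1 /andP[bvx bux]] := bag_adj Lv Lu adj_vu.
have [xu buxu /max_z le_xu] := topP u Lu.
have ne_xu : xu != z by apply: contraNneq nbuz => <-.
have [ne_zr cxu] := to_root z xu ne_xu le_xu.
(* If [u] is missing from the bag of [z], the whole subtree of [u] avoids [z], so [x1] reaches the
   root without passing through [z]. *)
have cx1 : connect (avoiding z) x1 r.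
  apply: connect_trans cxu; have := bag_conn Lu bux buxu.
  apply: connect_sub => a b /and3P[eab ba bb]; apply: connect1; rewrite /avoiding /= eab /=.
  by apply/andP; split; apply: contraNneq nbuz => <-.
have ne_x1 : x1 != z by apply: contraNneq nbuz => <-.
(* Walk inside the subtree of [v] from [x1] to [z]; the last node [y] before [z] still contains
   [v]. *)
have /connectP[p0 p0P Dz] := bag_conn Lv bvx bvz.
case: (shortenP p0P) Dz => p pP Up _ {p0 p0P}.
case/lastP: p pP Up => [|p y] pP Up; first by move=> Dz; rewrite Dz eqxx in ne_x1.
rewrite last_rcons => Dz; rewrite -{y}Dz in pP Up.
move: pP; rewrite rcons_path => /andP[pP /= /and3P[eyz by_ _]].
set y := last x1 p in eyz by_.
have cy : connect (avoiding z) x1 y.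
  apply/connectP; exists p => //.
  move: Up; rewrite -rcons_cons rcons_uniq => /andP[nz _].
  elim: p (x1) nz pP {y eyz by_ bvx bux cx1 ne_x1} => //= b p IH a.
  rewrite inE negb_or => /andP[za nz] /andP[/and3P[eab _ _] pP].
  rewrite /avoiding /= eab eq_sym za IH // andbT; move: nz; rewrite inE negb_or eq_sym.
  by case/andP.
have [z' ezz' lt_z'] := d_lt z ne_zr.
have ne_z' : z' != z by apply: contraTneq lt_z' => ->; rewrite ltnn.
have [_ cz'] := to_root z z' ne_z' (ltnW lt_z').
(* Both [y] and the parent [z'] of [z] reach the root avoiding [z], so they lie in the same branch
   and coincide; then [v] occurs above its topmost node [z]. *)
have eq_yz' : y = z'.
  apply: (@tree_branch z) => //; first by rewrite e_sym.
  apply: connect_trans (_ : connect (avoiding z) r z'); last by rewrite avoiding_sym.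
  by apply: connect_trans cx1; rewrite avoiding_sym.
by have := implyP (min_z y) by_; rewrite eq_yz' leqNgt lt_z'.
Qed.
End Trees.

(** Restricted to the triangle, a simplicial vertex shares one bag with its two neighbours, so some
    bag has at least three elements. *)
Lemma triangle_width (V : finType) (e : rel V) (a b c : V) (D : tree_decomposition e) :
  symmetric e -> e a b -> e b c -> e a c -> uniq [:: a; b; c] -> 2 <= width D.
Proof.
move=> e_sym eab ebc eac Uabc.
have [v [x [Lv bvx Hx]]] : exists v x, [/\ v \in [set a; b; c], v \in bag (t := D) x &
    forall u, u \in [set a; b; c] -> e v u -> u \in bag x].
  apply: simplicial_vertex; first exact: link_tree.
  - by move=> v _; apply: bag_vertex.
  - by move=> u v _ _; apply: bag_edge.
  - by move=> v x y _; apply: bag_connected.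
  by apply/set0Pn; exists a; rewrite !inE eqxx.
suff sub : [set a; b; c] \subset bag x.
  have := subset_leq_card sub; have -> : #|[set a; b; c]| = 3.
    by rewrite -[3]/(size [:: a; b; c]) -(card_uniqP Uabc); apply: eq_card => y; rewrite !inE orbA.
  have := @leq_bigmax _ (fun x : node D => #|bag x|) x; rewrite /width /=.
  by move=> le1 le2; have := leq_trans le2 le1; case: (\max_ _ _).
apply/subsetP => u; have := Hx u; rewrite !inE in Lv * => Hu.
by case/orP: Lv => [/orP[]|] /eqP Dv; case/orP=> [/orP[]|] /eqP Du;
   subst; rewrite ?bvx // Hu ?eqxx ?orbT // e_sym.
Qed.

(** * Binary arithmetic *)

Definition bval (w : word) : nat := foldr (fun (b : bool) n => b + n.*2) 0 w.

(** Drops zeros at the most significant end, which turns a word into the canonical numeral [bits] of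
    its value. *)
Definition trim (w : word) : word :=
  foldr (fun b s => if nilp s && ~~ b then [::] else b :: s) [::] w.

Lemma bits_rec n : 0 < n -> bits n = odd n :: bits n./2.
Proof.
move=> n_gt0; rewrite /bits.
have -> : up_log 2 n.+1 = (up_log 2 (n./2).+1).+1.
  rewrite -[RHS]addn0; apply/eqP; rewrite eqn_leq; apply/andP; split.
    apply: up_log_min => //; rewrite addn0 expnS.
    by have := @up_logP 2 (n./2).+1 isT; lia.
  have : 0 < up_log 2 n.+1 by rewrite up_log_gt0.
  case E : (up_log 2 n.+1) => [//|k] _; rewrite addn0 ltnS; apply: up_log_min => //.
  by have := @up_logP 2 n.+1 isT; rewrite E expnS; lia.
rewrite /= expn0 divn1 -[1]/(1 + 0) iotaDl -map_comp; congr (_ :: _).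
by apply: eq_map => i /=; rewrite add1n expnS divnMA divn2.
Qed.

Lemma bits0 : bits 0 = [::].
Proof. by rewrite /bits up_log1. Qed.

Lemma bits_bval w : bits (bval w) = trim w.
Proof.
elim: w => [|b w IH]; first exact: bits0.
rewrite /= -IH; have [v0|v_gt0] := posnP (bval w).
  by rewrite v0 bits0 /=; case: b; rewrite //= ?bits0 // bits_rec //= bits0.
have D : 0 < b + (bval w).*2 by lia.
rewrite (bits_rec D) half_bit_double oddD odd_double addbF oddb.
by rewrite (bits_rec v_gt0).
Qed.

Lemma bval_bits n : bval (bits n) = n.
Proof.
elim/ltn_ind: n => n IH; have [->|n_gt0] := posnP n; first by rewrite bits0.
by rewrite bits_rec //= IH ?odd_double_half //; lia.
Qed.

Lemma bval_cat_false w n : bval (w ++ nseq n false) = bval w.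
Proof. by elim: w => [|b w IH] /=; [elim: n => //= n -> | rewrite IH]. Qed.

Definition align (u v : word) : seq (bool * bool) :=
  [seq (nth false u i, nth false v i) | i <- iota 0 (size u + (size v - size u))].

Lemma bval_pad (u : word) n : size u <= n -> bval [seq nth false u i | i <- iota 0 n] = bval u.
Proof.
move=> le_u; rewrite -(bval_cat_false u (n - size u)); congr bval.
apply: (@eq_from_nth _ false) => [|i]; rewrite size_map size_iota.
  by rewrite size_cat size_nseq subnKC.
move=> lt_i; rewrite (nth_map 0) ?size_iota // nth_iota // add0n nth_cat nth_nseq.
by case: ltnP => // ?; rewrite nth_default //; case: ifP.
Qed.

Lemma bval_align u v :
  bval (unzip1 (align u v)) = bval u /\ bval (unzip2 (align u v)) = bval v.
Proof. by rewrite /unzip1 /unzip2 /align -!map_comp !bval_pad //; lia. Qed.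

Fixpoint adc (c : bool) (ps : seq (bool * bool)) : word :=
  if ps is p :: ps' then (p.1 (+) p.2 (+) c) :: adc (1 < p.1 + p.2 + c) ps' else [:: c].

Lemma bval_adc c ps : bval (adc c ps) = c + bval (unzip1 ps) + bval (unzip2 ps).
Proof.
elim: ps c => [|[a b] ps IH] c /=; first by rewrite !addn0.
by rewrite IH; case: a; case: b; case: c => /=; lia.
Qed.

Lemma size_adc c ps : size (adc c ps) = (size ps).+1.
Proof. by elim: ps c => //= p ps IH c; rewrite IH. Qed.

Definition badd (u v : word) : word := adc false (align u v).

Lemma bval_badd u v : bval (badd u v) = bval u + bval v.
Proof. by rewrite /badd bval_adc; have [-> ->] := bval_align u v. Qed.

Lemma size_badd u v : size (badd u v) = (maxn (size u) (size v)).+1.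
Proof. by rewrite size_adc size_map size_iota; lia. Qed.

(** Digits come least significant first, so the last position at which they differ decides. *)
Definition bleq (u v : word) : bool :=
  foldl (fun r p => if p.1 == p.2 then r else p.2) true (align u v).

Lemma bleqE u v : bleq u v = (bval u <= bval v).
Proof.
have [<- <-] := bval_align u v; rewrite /bleq.
(* The verdict [r] on the digits already read acts on the remaining ones like a borrow of one when
   it is negative. *)
suff H r ps : foldl (fun r (p : bool * bool) => if p.1 == p.2 then r else p.2) r ps =
    (bval (unzip1 ps) + ~~ r <= bval (unzip2 ps)) by rewrite H addn0.
elim: ps r => [|[a b] ps IH] r /=; first by case: r.
by rewrite IH; case: a; case: b; case: r => /=; lia.
Qed.

Definition bsum (l : seq word) : word := foldl badd [::] l.

Lemma bval_bsum l : bval (bsum l) = sumn [seq bval w | w <- l].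
Proof.
rewrite /bsum -[RHS]add0n -[0]/(bval [::]); elim: l [::] => [|w l IH] s /=; first by rewrite addn0.
by rewrite IH bval_badd addnA.
Qed.

Definition bin (n : nat) : word := iter n (badd [:: true]) [::].

Lemma bval_bin n : bval (bin n) = n.
Proof. by elim: n => // n IH; rewrite -[bin n.+1]/(badd [:: true] (bin n)) bval_badd IH. Qed.

(** Truncating after every digit keeps all intermediate unary numbers small even when the value of
    [w] is exponential in its length. *)
Definition capped (M : nat) (w : word) : nat := foldr (fun (b : bool) n => minn M (b + (n + n))) 0 w.

Lemma cappedE M w : capped M w = minn M (bval w).
Proof. by elim: w => [|b w /= ->]; rewrite /=; lia. Qed.

Definition encode (w : word) : word :=
  flatten [seq [:: true; b] | b <- trim w] ++ [:: false].

Lemma encodeE w : encode w = code_nat (bval w).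
Proof. by rewrite /encode -bits_bval. Qed.

(** The state holds whether the next letter is a digit, the current number reversed, and the
    finished numbers reversed. *)
Definition decode_step (s : (bool * word) * seq word) (b : bool) :=
  if s.1.1 then ((false, b :: s.1.2), s.2)
  else if b then ((true, s.1.2), s.2)
  else ((false, [::]), rev s.1.2 :: s.2).

Definition decode (w : word) : seq word :=
  rev (foldl decode_step ((false, [::]), [::]) w).2.

Lemma decodeE ns : decode (flatten [seq code_nat n | n <- ns]) = [seq bits n | n <- ns].
Proof.
have bits_step cur acc (s : word) : foldl decode_step ((false, cur), acc) (flatten [seq [:: true; b] | b <- s])
    = ((false, catrev s cur), acc) by elim: s cur => //= b s IH cur; rewrite IH.
rewrite /decode; suff -> acc : foldl decode_step ((false, [::]), acc) (flatten [seq code_nat n | n <- ns])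
    = ((false, [::]), catrev [seq bits n | n <- ns] acc).
  by rewrite catrevE cats0 revK.
elim: ns acc => //= n ns IH acc.
rewrite foldl_cat /code_nat foldl_cat bits_step /= /decode_step /= catrevE cats0 revK.
exact: IH.
Qed.

Lemma esize_word (w : word) : esize w <= 4 * size w + 1.
Proof. exact: tree_size_word. Qed.

Section BinaryFP.
Context {E : Type} {EE : Enc E}.

Lemma fp_trim (u : E -> word) : FP u -> FP (fun e => trim (u e)).
Proof.
move=> Pu; apply: (fp_foldr (h := fun _ b s => if nilp s && ~~ b then [::] else b :: s) (k := 1)) => //;
  try by fp.
move=> e a s; case: ifP; rewrite ?esize_cons ?esize_nil expn1; lia.
Qed.

Lemma fp_align (u v : E -> word) : FP u -> FP v -> FP (fun e => align (u e) (v e)).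
Proof. by move=> Pu Pv; rewrite /align; fp. Qed.
End BinaryFP.

Lemma leq_cube n : 1 < n -> 16 * n.+2 <= n.+2 ^ 3.
Proof.
move=> n_gt1; rewrite expnSr leq_mul2r; apply/orP; right.
by rewrite -[16]/(4 ^ 2) leq_exp2r.
Qed.

Lemma fp_adc : FP (fun x : bool * seq (bool * bool) => adc x.1 x.2).
Proof.
pose h (s : bool * word) (p : bool * bool) :=
  ((1 < p.1 + p.2 + s.1, (p.1 (+) p.2 (+) s.1) :: s.2) : bool * word).
apply: (fp_ext (f := fun x => rev ((foldl h (x.1, [::]) x.2).1 :: (foldl h (x.1, [::]) x.2).2))).
  case=> c ps /=; rewrite -[RHS]/(catrev [::] _); elim: ps c [::] => [|p ps IH] c acc /=.
    by rewrite rev_cons -cats1 catrevE.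
  by rewrite IH.
have Ph : FP (fun x : (bool * word) * (bool * bool) => h x.1 x.2).
  apply: (fp_ext (f := fun x =>
    (if x.2.1 then x.2.2 || x.1.1 else x.2.2 && x.1.1, (if x.2.1 == x.2.2 then x.1.1 else ~~ x.1.1) :: x.1.2))).
    by case=> [[c s] [a b]]; rewrite /h /=; case: a; case: b; case: c.
  by fp.
have Pf : FP (fun x : bool * seq (bool * bool) => foldl h (x.1, [::]) x.2); last by fp.
apply: (@fp_foldl _ _ _ _ _ _ (fun x : bool * seq (bool * bool) => x.2) (fun _ => h)
  (fun x => (x.1, [::])) 3); try by fp.
  by apply (fp_app2 Ph); fp.
move=> e [c s] p; have gt0 : 0 < esize e by apply: esize_gt0.
have gt0' : 0 < esize p by apply: esize_gt0.
have gt0'' : 0 < esize c by apply: esize_gt0.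
have lt1 : 1 < esize e + esize p by lia.
have := leq_cube lt1; set X := _ ^ 3 => le3; clearbody X.
rewrite /h !esize_pair esize_cons /=.
set b1 := 1 < _; set b2 := _ (+) c; move: (esize_bool b1) (esize_bool b2).
by move: (esize b1) (esize b2) => n1 n2; set z := esize s; lia.
Qed.

Section BinaryArithmeticFP.
Context {E : Type} {EE : Enc E}.

Lemma fp_badd (u v : E -> word) : FP u -> FP v -> FP (fun e => badd (u e) (v e)).
Proof. by move=> Pu Pv; apply: (fp_compose fp_adc (fp_pair (fp_const false) (fp_align Pu Pv))). Qed.

Lemma fp_bleq (u v : E -> word) : FP u -> FP v -> FP (fun e => bleq (u e) (v e)).
Proof.
move=> Pu Pv; have Pa := fp_align Pu Pv.
apply: (fp_foldl (h := fun _ r p => if p.1 == p.2 then r else p.2) (s := fun _ => true) (k := 1)) => //; try by fp.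
by move=> e r p; rewrite expn1; case: p => a b; rewrite esize_pair /=; case: ifP; lia.
Qed.

Lemma fp_capped (M : E -> nat) (w : E -> word) : FP M -> FP w -> FP (fun e => capped (M e) (w e)).
Proof.
move=> PM Pw.
have P : FP (fun x : nat * word => capped x.1 x.2); last by apply: (fp_compose P (fp_pair PM Pw)).
apply: (fp_foldr (h := fun (e : nat * word) (b : bool) n => minn e.1 (b + (n + n))) (k := 1)); try by fp.
  by apply: fp_min; fp; apply: (fp_ext (f := fun x : nat * word * (bool * nat) => if x.2.1 then 1 else 0));
    [case=> [? [[] ?]] | fp].
by move=> [M' w'] b n; rewrite !esize_pair /= !esize_nat expn1; lia.
Qed.
End BinaryArithmeticFP.

Lemma fp_bsum E {EE : Enc E} (l : E -> seq word) : FP l -> FP (fun e => bsum (l e)).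
Proof.
move=> Pl; have [k Hk] := FP_size Pl.
apply: (fp_foldl_bounded (h := fun _ => badd) (s := fun _ => [::]) (b := fun x => 8 * x.+2 ^ k + 1)) => //.
- by fp.
- by apply: fp_badd; fp.
- by polyt.
move=> e j; apply: leq_trans (esize_word _) _.
(* One addition exceeds the longer operand by at most one digit, so lengths grow by at most the
   number of summands. *)
have H (s : word) n : size s <= esize (l e) + n ->
    size (foldl badd s (take j (l e))) <= esize (l e) + (n + size (take j (l e))).
  have: {subset take j (l e) <= l e} by move=> w; apply: mem_take.
  elim: (take j (l e)) s n => [|w t IH] s n sub le_s /=; first by rewrite addn0.
  rewrite addnS -addSn; apply: IH; first by move=> v tv; apply: sub; rewrite inE tv orbT.
  have lt_w : esize w < esize (l e) by apply/esize_mem/sub/mem_head.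
  have lt_w' : size w < esize w by apply: size_esize.
  by rewrite size_badd; lia.
have lt_l : size (l e) < esize (l e) by apply: size_esize.
by have := Hk e; have := H [::] 0 isT; rewrite size_take_min; lia.
Qed.

Lemma fp_bin E {EE : Enc E} (n : E -> nat) : FP n -> FP (fun e => bin (n e)).
Proof.
move=> Pn; have [k Hk] := FP_size Pn.
apply: (@fp_iter _ _ _ _ n (fun _ => badd [:: true]) (fun _ => [::]) (fun x => 4 * x.+2 ^ k + 1)) => //.
- by fp.
- by apply: fp_badd; fp.
- by polyt.
move=> e j le_j; apply: leq_trans (esize_word _) _.
have : size (bin j) <= j.+1.
  elim: (j) => // i IH; rewrite -[bin i.+1]/(badd [:: true] (bin i)) size_badd /=; lia.
by have := Hk e; rewrite esize_nat /bin; lia.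
Qed.

Lemma fp_encode E {EE : Enc E} (w : E -> word) : FP w -> FP (fun e => encode (w e)).
Proof. by move=> Pw; rewrite /encode; have Pt := fp_trim Pw; fp. Qed.

Lemma fp_decode E {EE : Enc E} (w : E -> word) : FP w -> FP (fun e => decode (w e)).
Proof.
move=> Pw; rewrite /decode; apply: fp_rev; apply: fp_snd.
apply: (fp_foldl (h := fun _ => decode_step) (s := fun _ => ((false, [::]), [::])) (k := 3)) => //; try by fp.
  by rewrite /decode_step; fp.
move=> e [[p cur] acc] b; have gt0 : 0 < esize e by apply: esize_gt0.
have gt0' : 0 < esize p by apply: esize_gt0.
have gt0'' : 0 < esize b by apply: esize_gt0.
have le_b := esize_bool b; have le_p := esize_bool p; have le_f := esize_bool false.
have le_t := esize_bool true.
have lt1 : 1 < esize e + esize b by lia.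
have := leq_cube lt1; set X := _ ^ 3 => le3; clearbody X.
rewrite /decode_step [(_, _).1]/= [(p, cur).2]/=; case: p gt0' le_p => gt0' _.
  by rewrite !esize_pair /= esize_cons; set z := esize cur; lia.
case: {2}b; rewrite !esize_pair /= ?esize_cons ?esize_rev ?esize_nil; set z := esize cur; lia.
Qed.

Ltac fp_binary ::= lazymatch goal with
  | |- FP (fun e => badd (@?f e) (@?g e)) => apply (@fp_badd _ _ f g)
  | |- FP (fun e => bleq (@?f e) (@?g e)) => apply (@fp_bleq _ _ f g)
  | |- FP (fun e => capped (@?f e) (@?g e)) => apply (@fp_capped _ _ f g)
  | |- FP (fun e => bsum (@?f e)) => apply (@fp_bsum _ _ f)
  | |- FP (fun e => bin (@?f e)) => apply (@fp_bin _ _ f)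
  | |- FP (fun e => encode (@?f e)) => apply (@fp_encode _ _ f)
  | |- FP (fun e => decode (@?f e)) => apply (@fp_decode _ _ f)
  | |- FP (fun e => trim (@?f e)) => apply (@fp_trim _ _ f)
  end.

(** * Membership in NP *)

Lemma nth_flatten_map (A B : Type) (d : B) (f : A -> seq B) (a : A) s n i j :
  (forall a, size (f a) = n) -> j < n -> i < size s ->
  nth d (flatten [seq f a | a <- s]) (i * n + j) = nth d (f (nth a s i)) j.
Proof.
move=> sz_f lt_j; elim: s i => //= b s IH [|i] /= lt_i.
  by rewrite nth_cat sz_f lt_j.
rewrite nth_cat sz_f mulSn -addnA ltnNge leq_addr /= addKn; exact: IH.
Qed.

Lemma all_iotaP (n : nat) (p : nat -> bool) :
  reflect (forall i : 'I_n, p i) (all p (iota 0 n)).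
Proof.
apply: (iffP allP) => [H i|H i]; first by apply: H; rewrite mem_iota add0n ltn_ord.
by rewrite mem_iota add0n => lt_i; apply: (H (Ordinal lt_i)).
Qed.

Lemma sumn_iota n (f : nat -> nat) : sumn [seq f i | i <- iota 0 n] = \sum_(i < n) f i.
Proof. by rewrite sumnE big_map -[n in iota 0 n]subn0 -/(index_iota 0 n) big_mkord. Qed.

Definition graph_numbers (G : constraint_graph) : seq nat :=
  Defs.order G :: [seq min_inflow v | v <- enum 'I_(Defs.order G)]
    ++ [seq adjacency u v | u <- enum 'I_(Defs.order G), v <- enum 'I_(Defs.order G)].

Lemma size_graph_numbers G :
  size (graph_numbers G) = (Defs.order G + Defs.order G * Defs.order G).+1.
Proof. by rewrite /= size_cat size_map size_allpairs size_enum_ord. Qed.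

Lemma size_code_graph G : size (graph_numbers G) <= size (code_graph G).
Proof.
rewrite /code_graph -/(graph_numbers G); elim: (graph_numbers G) => // n ns IH.
have gt0 : 0 < size (code_nat n) by rewrite /code_nat size_cat addn1.
change (size ns < size (code_nat n ++ flatten [seq code_nat k | k <- ns])).
by rewrite size_cat -add1n leq_add.
Qed.

(** The order is written in binary, but the list contains at least that many numbers; capping by its
    length changes nothing and keeps the conversion to unary polynomial. *)
Definition order_of (L : seq word) : nat := capped (size L) (head [::] L).
Definition inflow_of (L : seq word) (i : nat) : word := nth [::] (behead L) i.
Definition weight_of (L : seq word) (i j : nat) : word :=
  nth [::] (drop (order_of L) (behead L)) (i * order_of L + j).

Section Decode.
Variable G : constraint_graph.
Let n := Defs.order G.
Let L := decode (code_graph G).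

Lemma decode_graph : L = [seq bits k | k <- graph_numbers G].
Proof. exact: decodeE. Qed.

Lemma order_ofE : order_of L = n.
Proof.
rewrite /order_of decode_graph size_map size_graph_numbers cappedE /= bval_bits.
by apply/minn_idPr; rewrite /n; lia.
Qed.

Lemma inflow_ofE (i : 'I_n) : inflow_of L i = bits (min_inflow i).
Proof.
rewrite /inflow_of decode_graph /= map_cat nth_cat 2!size_map size_enum_ord ltn_ord.
by rewrite -map_comp (nth_map i) ?size_enum_ord //= nth_ord_enum.
Qed.

Lemma weight_ofE (i j : 'I_n) : weight_of L i j = bits (adjacency i j).
Proof.
rewrite /weight_of order_ofE decode_graph /= map_cat drop_size_cat; last first.
  by rewrite 2!size_map size_enum_ord.
rewrite (nth_map 0); last first.
  rewrite size_allpairs !size_enum_ord; have := ltn_ord i; have := ltn_ord j; rewrite /n; nia.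
rewrite (@nth_flatten_map _ _ 0 (fun u => [seq adjacency u v | v <- enum 'I_n]) i) //.
- by rewrite (nth_map j) ?size_enum_ord // !nth_ord_enum.
- by move=> a; rewrite size_map size_enum_ord.
by rewrite size_enum_ord.
Qed.

Lemma sum_adjacency (o : rel 'I_n) (v : 'I_n) :
  inflow o v = \sum_(u < n) if o u v then adjacency u v else 0.
Proof.
rewrite /inflow big_mkcond; apply: eq_bigr => u _; rewrite /adjacency.
by case: edge; case: o.
Qed.
End Decode.

Definition verify_list (x : seq word * word) : bool :=
  all (fun i =>
    bleq (inflow_of x.1 i)
      (bsum [seq if nth false x.2 (j * order_of x.1 + i) then weight_of x.1 j i else [::]
            | j <- iota 0 (order_of x.1)]) &&
    all (fun j => nilp (weight_of x.1 i j) ||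
        (nth false x.2 (i * order_of x.1 + j) == ~~ nth false x.2 (j * order_of x.1 + i)))
      (iota 0 (order_of x.1))) (iota 0 (order_of x.1)).

Definition verify (x : word * word) : bool := verify_list (decode x.1, x.2).

Lemma nilp_bits n : nilp (bits n) = (n == 0).
Proof. by case: n => [|n]; rewrite ?bits0 // bits_rec. Qed.

Lemma verifyP G (w : word) :
  reflect (legal (fun i j : 'I_(Defs.order G) => nth false w (i * Defs.order G + j)))
    (verify (code_graph G, w)).
Proof.
set n := Defs.order G; set o := fun i j => _.
rewrite /verify /verify_list /= order_ofE -/n.
have inflowE (i : 'I_n) : bleq (inflow_of (decode (code_graph G)) i)
    (bsum [seq if nth false w (j * n + i) then weight_of (decode (code_graph G)) j i else [::]
            | j <- iota 0 n]) = (min_inflow i <= inflow o i).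
  rewrite bleqE inflow_ofE bval_bits bval_bsum -map_comp sumn_iota (sum_adjacency o); congr (_ <= _).
  by apply: eq_bigr => u _ /=; rewrite /o; case: ifP => // _; rewrite weight_ofE bval_bits.
have edgeE (i j : 'I_n) : nilp (weight_of (decode (code_graph G)) i j) = ~~ edge i j.
  rewrite weight_ofE nilp_bits /adjacency; case E : (edge i j) => //.
  by have := weight_gt0 E; case: weight.
apply: (iffP (@all_iotaP n _)) => [H|[Ho Hin] i].
  split=> [i j eij|i]; last by have /andP[] := H i; rewrite inflowE.
  have /andP[_ /(@all_iotaP n _)/(_ j)] := H i.
  by rewrite edgeE eij /= => /eqP.
rewrite inflowE Hin /=; apply/(@all_iotaP n _) => j; rewrite edgeE.
by case E : (edge i j) => //=; apply/eqP; apply: Ho.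
Qed.

Section AccessorFP.
Context {E : Type} {EE : Enc E}.
Lemma fp_order_of (L : E -> seq word) : FP L -> FP (fun e => order_of (L e)).
Proof. by move=> PL; rewrite /order_of; fp. Qed.
Lemma fp_inflow_of (L : E -> seq word) (i : E -> nat) :
  FP L -> FP i -> FP (fun e => inflow_of (L e) (i e)).
Proof. by move=> PL Pi; rewrite /inflow_of; fp. Qed.
Lemma fp_weight_of (L : E -> seq word) (i j : E -> nat) :
  FP L -> FP i -> FP j -> FP (fun e => weight_of (L e) (i e) (j e)).
Proof. by move=> PL Pi Pj; rewrite /weight_of; have Pn := fp_order_of PL; fp. Qed.
End AccessorFP.
Ltac fp_graph ::= lazymatch goal with
  | |- FP (fun e => order_of (@?f e)) => apply (@fp_order_of _ _ f)
  | |- FP (fun e => inflow_of (@?f e) (@?g e)) => apply (@fp_inflow_of _ _ f g)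
  | |- FP (fun e => weight_of (@?f e) (@?g e) (@?h e)) => apply (@fp_weight_of _ _ f g h)
  end.

Lemma fp_verify : FP verify.
Proof.
have P : FP verify_list by rewrite /verify_list; fp.
by rewrite /verify; fp.
Qed.

Lemma cgs_in_NP (C : constraint_graph -> Prop) : in_NP (@restrict constraint_graph_satisfiability C).
Proof.
have [V [k HV]] := decision_machine fp_verify.
have [c [l Hp]] : exists c l, forall n, (n + n.+1).+2 ^ k <= pbound c l n.
  by apply: poly_pbound; polyt.
exists V, 1, 1, c, l => -[G CG] /=.
have bound n : pbound 1 1 n = n.+1 by rewrite /pbound mul1n expn1.
rewrite /instance_length /= !bound; set n := Defs.order G.
have time (w : word) : size w <= (size (code_graph G)).+1 ->
    (size (code_graph G) + size w).+2 ^ k <= pbound c l (size (code_graph G)).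
  move=> le_w; apply: leq_trans (Hp _); case: (k) => // i.
  by rewrite leq_exp2r // !ltnS leq_add2l.
split=> [w /time /(HV (code_graph G) w)[]//|].
split=> [[o ol]|[w [/time /(HV (code_graph G) w)[_ ->] /verifyP ol]]]; last by exists (fun i j : 'I_n => nth false w (i * n + j)).
pose w := [seq o i j | i <- enum 'I_n, j <- enum 'I_n].
(* The orientation matrix has as many entries as the adjacency matrix, which is part of the code. *)
have le_w : size w <= (size (code_graph G)).+1.
  have := size_code_graph G; rewrite size_graph_numbers size_allpairs size_enum_ord -/n; lia.
exists w; split=> //; have [_ ->] := HV (code_graph G) w _ (time w le_w).
apply/verifyP; rewrite -/n.
have oE (i j : 'I_n) : nth false w (i * n + j) = o i j.
  rewrite (@nth_flatten_map _ _ false (fun u => [seq o u v | v <- enum 'I_n]) i) //.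
  - by rewrite (nth_map j) ?size_enum_ord // !nth_ord_enum.
  - by move=> a; rewrite size_map size_enum_ord.
  by rewrite size_enum_ord.
case: ol => Ho Hin; split=> [i j eij|i]; first by rewrite !oE; apply: Ho.
apply: leq_trans (Hin i) _; rewrite /inflow; apply: eq_leq; apply: eq_bigl => u.
by rewrite oE.
Qed.

(** * The pseudo-polynomial algorithm *)

(* A generalized edge joins two vertices and carries a list of pairs of       *)
(* inflows that it can provide to its two endpoints; an ordinary edge of      *)
(* weight w carries (w, 0) and (0, w).                                        *)
Notation hyperedge := ((nat * nat) * seq (nat * nat))%type.

Definition provides (e r : nat * nat) (v : nat) : nat :=
  (e.1 == v) * r.1 + (e.2 == v) * r.2.

Fixpoint achieves (E : seq hyperedge) (f : nat -> nat) : Prop :=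
  if E is e :: E' then
    exists2 r, r \in e.2 & exists2 g, achieves E' g & forall v, f v = provides e.1 r v + g v
  else forall v, f v = 0.

Definition feasible (m : nat -> nat) (L : seq nat) (E : seq hyperedge) : Prop :=
  exists2 f, achieves E f & forall v, v \in L -> m v <= f v.

Definition incident (v : nat) (e : hyperedge) : bool := (e.1.1 == v) || (e.1.2 == v).

Lemma provides0 v e r : ~~ incident v e -> provides e.1 r v = 0.
Proof. by rewrite /incident /provides negb_or => /andP[/negPf-> /negPf->]. Qed.

Lemma achieves0 E f v : (forall e, e \in E -> ~~ incident v e) -> achieves E f -> f v = 0.
Proof.
elim: E f => [|e E IH] f nE /=; first exact.
move=> [r _ [g Eg ->]]; rewrite provides0 ?nE ?mem_head // (IH g) // => e' Ee'.
by rewrite nE // inE Ee' orbT.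
Qed.

Lemma achieves_split E (p : pred hyperedge) f :
  achieves E f <-> exists g h, [/\ achieves (filter p E) g, achieves (filter (predC p) E) h &
    forall v, f v = g v + h v].
Proof.
elim: E f => [|e E IH] f /=.
  split=> [f0|[g [h [g0 h0 fE]]] v]; last by rewrite fE g0 h0.
  by exists (fun=> 0), (fun=> 0); split=> // v; rewrite f0.
split=> [[r er [k /IH[g [h [Hg Hh kE]]] fE]]|].
  case: (p e) => /=.
    exists (fun v => provides e.1 r v + g v), h; split=> //; last by move=> v; rewrite fE kE addnA.
    by exists r => //; exists g.
  exists g, (fun v => provides e.1 r v + h v); split=> //; last by move=> v; rewrite fE kE; lia.
  by exists r => //; exists h.
case=> g [h []]; case: (p e) => /=.
  move=> [r er [g' Hg' gE]] Hh fE; exists r => //; exists (fun v => g' v + h v).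
    by apply/IH; exists g', h.
  by move=> v; rewrite fE gE addnA.
move=> Hg [r er [h' Hh' hE]] fE; exists r => //; exists (fun v => g v + h' v).
  by apply/IH; exists g, h'.
by move=> v; rewrite fE hE; lia.
Qed.

Lemma feasible_nil m E : feasible m [::] E <-> all (fun e => ~~ nilp e.2) E.
Proof.
split=> [[f Ef _]|].
  elim: E f Ef => //= e E IH f [r er [g Eg _]]; rewrite (IH g) // andbT.
  by case: (e.2) er.
elim: E => [|e E IH] /=; first by exists (fun=> 0).
case/andP=> ne /IH[f Ef _]; case De: e.2 ne => [//|r R] _.
exists (fun v => provides e.1 r v + f v) => //=; exists r; rewrite ?De ?mem_head //.
by exists f.
Qed.

Definition triples (M : nat) : seq (nat * (nat * nat)) :=
  flatten [seq flatten [seq [seq (p, (x, y)) | y <- iota 0 M.+1] | x <- iota 0 M.+1] | p <- iota 0 M.+1].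

Lemma mem_triples M t : (t \in triples M) = [&& t.1 <= M, t.2.1 <= M & t.2.2 <= M].
Proof.
case: t => p [x y]; rewrite -[RHS]/[&& p <= M, x <= M & y <= M].
apply/flatten_mapP/idP => [[p' Mp /flatten_mapP[x' Mx /mapP[y' My [-> -> ->]]]]|].
  by move: Mp Mx My; rewrite !mem_iota /=; lia.
case/and3P=> Mp Mx My; exists p; first by rewrite mem_iota; lia.
apply/flatten_mapP; exists x; first by rewrite mem_iota; lia.
by apply/mapP; exists y => //; rewrite mem_iota; lia.
Qed.

Definition add_load M v a b (e r : nat * nat) (s : nat * (nat * nat)) :=
  (minn M (s.1 + provides e r v), (minn M (s.2.1 + provides e r a), minn M (s.2.2 + provides e r b))).

(* Filtering the grid of all triples keeps the lists short by construction.   *)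
Definition add_edge M v a b (S : seq (nat * (nat * nat))) (e : hyperedge) :=
  [seq t <- triples M | has (fun s => has (fun r =>
    [&& t.1 == minn M (s.1 + provides e.1 r v),
        t.2.1 == minn M (s.2.1 + provides e.1 r a) &
        t.2.2 == minn M (s.2.2 + provides e.1 r b)]) e.2) S].

Lemma add_edgeP M v a b S e t : reflect (exists2 s, s \in S & exists2 r, r \in e.2 &
  t = add_load M v a b e.1 r s) (t \in add_edge M v a b S e).
Proof.
rewrite mem_filter; apply: (iffP andP) => [[/hasP[s Ss /hasP[r er H]] _]|[s Ss [r er ->]]].
  exists s => //; exists r => //; move: H; case: t => t1 [t2 t3] /= /and3P[/eqP-> /eqP-> /eqP->] //.
split; first by apply/hasP; exists s => //; apply/hasP; exists r => //=; rewrite !eqxx.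
by rewrite mem_triples /= !geq_minl.
Qed.

(** A dynamic program over the edges: its states are the inflows at [v], [a], [b] capped at [M], so
    at most (M+1)^3 of them arise, however many edges there are. *)
Definition loads M v a b (E : seq hyperedge) := foldl (add_edge M v a b) [:: (0, (0, 0))] E.

Lemma loadsP M v a b E t : t \in loads M v a b E <-> exists2 g, achieves E g &
  t = (minn M (g v), (minn M (g a), minn M (g b))).
Proof.
suff H S : (forall s, s \in S -> [&& s.1 <= M, s.2.1 <= M & s.2.2 <= M]) ->
    t \in foldl (add_edge M v a b) S E <-> exists2 s, s \in S & exists2 g, achieves E g &
    t = (minn M (s.1 + g v), (minn M (s.2.1 + g a), minn M (s.2.2 + g b))).
  apply: iff_trans (H _ _) _; first by move=> s; rewrite inE => /eqP->.
  split=> [[s]|[g Eg ->]]; first by rewrite inE => /eqP-> [g Eg ->]; exists g.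
  by exists (0, (0, 0)); rewrite ?mem_head //; exists g.
elim: E S => [|e E IH] S le_S /=.
  split=> [St|[s Ss [g g0 ->]]].
    exists t => //; exists (fun=> 0) => //; rewrite !addn0; case: t St => p [x y] /le_S /=.
    by case/and3P => *; congr (_, (_, _)); apply/esym/minn_idPr.
  rewrite !g0 !addn0; case: s Ss => p [x y] Ss; case/and3P: (le_S _ Ss) => /= *.
  by rewrite !(minn_idPr _).
apply: iff_trans (IH _ _) _.
  by move=> s /add_edgeP[s' _ [r _ ->]] /=; rewrite !geq_minl.
have cap x y z : minn M (minn M (x + y) + z) = minn M (x + (y + z)) by lia.
split=> [[s /add_edgeP[s' Ss' [r er ->]] [g Eg ->]]|[s Ss [f [r er [g Eg fE]] ->]]].
  exists s' => //; exists (fun v => provides e.1 r v + g v); last by rewrite /= !cap.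
  by exists r => //; exists g.
exists (add_load M v a b e.1 r s); first by apply/add_edgeP; exists s => //; exists r.
by exists g => //; rewrite /= !fE !cap.
Qed.

Definition merged M m v a b E : hyperedge :=
  ((a, b), [seq t.2 | t <- loads M v a b [seq e <- E | incident v e] & m <= t.1]).

(** Among live vertices the edges at [v] feed only [v], [a] and [b], so all that matters about them
    is which pairs they can give to [a] and [b] while satisfying [v]. Capping is harmless because no
    demand exceeds [M]. *)
Lemma eliminate_feasible M (m : nat -> nat) L E v a b :
  (forall u, m u <= M) -> a != b -> a != v -> b != v -> v \in L ->
  (forall u e, u \in L -> u != v -> e \in E -> incident v e -> incident u e -> (u == a) || (u == b)) ->
  feasible m L E <->
  feasible m [seq u <- L | u != v] (merged M (m v) v a b E :: [seq e <- E | ~~ incident v e]).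
Proof.
move=> le_M ab av bv Lv nbP.
have far u g : u \in L -> u != v -> u != a -> u != b ->
    achieves [seq e <- E | incident v e] g -> g u = 0.
  move=> Lu uv ua ub; apply: achieves0 => e; rewrite mem_filter => /andP[ve Ee].
  by apply: contraT => /negPn /(nbP u e Lu uv Ee ve); rewrite (negPf ua) (negPf ub).
split=> [[f /(@achieves_split _ (incident v))[g [h [Hg Hh fE]]] fm]|].
  have h0 : h v = 0 by apply: achieves0 Hh => e; rewrite mem_filter => /andP[].
  exists (fun u => provides (a, b) (minn M (g a), minn M (g b)) u + h u).
    exists (minn M (g a), minn M (g b)); last by exists h.
    apply/mapP; exists (minn M (g v), (minn M (g a), minn M (g b))) => //.
    rewrite mem_filter; apply/andP; split; last by apply/loadsP; exists g.
    by have := fm v Lv; have := le_M v; rewrite fE h0 /=; lia.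
  move=> u; rewrite mem_filter => /andP[uv Lu]; have := fm u Lu; have := le_M u.
  rewrite fE /provides /=.
  have [<-|au] := eqVneq a u; first by rewrite eq_sym (negPf ab); lia.
  have [<-|bu] := eqVneq b u; first by lia.
  by rewrite (far u g) // 1?eq_sym.
case=> f [r /mapP[t]]; rewrite mem_filter => /andP[tm /loadsP[g Hg Dt]] -> [h Hh fE] fm.
exists (fun u => g u + h u).
  by apply/(@achieves_split _ (incident v)); exists g, h.
rewrite {}Dt /= in tm fE => u Lu; have [->|uv] := eqVneq u v; first by lia.
have := fm u; rewrite mem_filter uv Lu fE /provides /= => /(_ isT).
have [<-|au] := eqVneq a u; first by rewrite eq_sym (negPf ab); lia.
have [<-|bu] := eqVneq b u; first by lia.
by lia.
Qed.

Definition neighbours (L : seq nat) (E : seq hyperedge) (v : nat) : seq nat :=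
  [seq u <- L | (u != v) && has (fun e => incident v e && incident u e) E].

Definition pivot n (s : seq nat * seq hyperedge) : nat :=
  head n [seq v <- s.1 | size (neighbours s.1 s.2 v) <= 2].

(** When [v] has fewer than two live neighbours, the dummies [n] and [n.+1] stand in for them. They
    are no vertices, hence carry no demand, and they keep [a], [b] and [v] distinct. *)
Definition eliminate M (m : nat -> nat) n (s : seq nat * seq hyperedge) :=
  let v := pivot n s in
  let nb := neighbours s.1 s.2 v in
  ([seq u <- s.1 | u != v],
   merged M (m v) v (nth n nb 0) (nth n.+1 nb 1) s.2 :: [seq e <- s.2 | ~~ incident v e]).

(** * Elimination preserves tree decompositions of width at most 2 *)

Section Treewidth.
Variables (n : nat) (T : finType) (link : rel T).
Hypothesis tree_link : is_tree link.

Definition adjacent (E : seq hyperedge) (u v : nat) :=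
  (u != v) && has (fun e => incident u e && incident v e) E.

(** The tree stays the same during the whole elimination; only the bags change, and the axioms are
    kept for live vertices only. *)
Definition decomposed (L : seq nat) (E : seq hyperedge) :=
  exists bag : T -> {set 'I_n},
  [/\ forall x, #|bag x| <= 3,
      forall v : 'I_n, (v : nat) \in L -> exists x, v \in bag x,
      forall u v : 'I_n, (u : nat) \in L -> (v : nat) \in L -> adjacent E u v ->
        exists x, (u \in bag x) && (v \in bag x) &
      forall (v : 'I_n) x y, (v : nat) \in L -> v \in bag x -> v \in bag y ->
        connect [rel a b | [&& link a b, v \in bag a & v \in bag b]] x y].

(** A simplicial vertex and its neighbours lie in one bag of at most three elements, so at most two
    neighbours are left. *)
Lemma pivotP L E : all (gtn n) L -> uniq L -> L != [::] -> decomposed L E ->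
  pivot n (L, E) \in L /\ size (neighbours L E (pivot n (L, E))) <= 2.
Proof.
move=> ltL UL L0 [bag [bag3 bagL bagE bagC]].
pose LS := [set i : 'I_n | (i : nat) \in L].
have [v [x [Lv bvx bnb]]] : exists v x, [/\ v \in LS, v \in bag x &
    forall u, u \in LS -> adjacent E v u -> u \in bag x].
  apply: (@simplicial_vertex _ link _ _ bag (fun u v : 'I_n => adjacent E u v)) => //.
  - by move=> v; rewrite inE; apply: bagL.
  - by move=> u v; rewrite !inE; apply: bagE.
  - by move=> v y z; rewrite inE; apply: bagC.
  have Li : head 0 L \in L by case: (L) L0 => // i s _; apply: mem_head.
  have lti : head 0 L < n by apply: (allP ltL).
  by apply/set0Pn; exists (Ordinal lti); rewrite inE.
rewrite inE in Lv.
have nb2 : size (neighbours L E v) <= 2.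
  have sub : {subset neighbours L E v <= [seq nat_of_ord i | i <- enum (bag x :\ v)]}.
    move=> u; rewrite mem_filter => /andP[/andP[uv Ee] Lu].
    have ltu : u < n by apply: (allP ltL).
    apply/mapP; exists (Ordinal ltu) => //; rewrite mem_enum !inE -val_eqE /= uv.
    by apply: bnb; rewrite ?inE // /adjacent eq_sym uv.
  have := uniq_leq_size (filter_uniq _ UL) sub; rewrite size_map -cardE => /leq_trans; apply.
  by have := bag3 x; rewrite (cardsD1 v) bvx.
have : has (fun v => size (neighbours L E v) <= 2) L by apply/hasP; exists (v : nat).
rewrite /pivot has_filter /=; case Ds : [seq _ <- _ | _] => [//|w s] _ /=.
by have := mem_head w s; rewrite -Ds mem_filter => /andP[].
Qed.

(** The only new adjacency is between the two neighbours [a] and [b] of [v], as if [v] were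
    contracted into [a]; replacing [v] by [a] in every bag accounts for it. *)
Lemma eliminate_decomposed M m L E : all (gtn n) L -> uniq L -> L != [::] -> decomposed L E ->
  decomposed (eliminate M m n (L, E)).1 (eliminate M m n (L, E)).2.
Proof.
move=> ltL UL L0 dec; have [Lv nb2] := pivotP ltL UL L0 dec.
case: dec => bag [bag3 bagL bagE bagC]; rewrite /eliminate [(L, E).1]/= [(L, E).2]/=.
move: Lv nb2; set v := pivot _ _ => Lv; set nb := neighbours L E v => nb2 /=.
set a := nth n nb 0; set b := nth n.+1 nb 1; set R := merged _ _ _ _ _ _.
have Unb : uniq nb by apply: filter_uniq.
have nbP u : u \in nb -> [/\ u \in L, u != v & adjacent E v u].
  rewrite mem_filter => /andP[/andP[uv Ee] Lu].
  by split=> //; rewrite /adjacent eq_sym uv.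
have LP u : u \in [seq u <- L | u != v] -> (u != v) * (u \in L).
  by rewrite mem_filter => /andP[].
have notL k : n <= k -> k \in L = false.
  by move=> le_nk; apply: contraTF (le_nk) => /(allP ltL) /=; rewrite -ltnNge.
have adjP u w : adjacent (R :: [seq e <- E | ~~ incident v e]) u w ->
    u \in L -> w \in L -> adjacent E u w \/ [/\ a \in nb, b \in nb & (u == a) && (w == b) || (u == b) && (w == a)].
  rewrite /adjacent => /andP[uw /= /orP[|/hasP[e]]]; last first.
    rewrite mem_filter => /andP[_ Ee] He _ _; left; rewrite uw; apply/hasP.
    by exists e.
  rewrite {1 2}/incident /= => H Lu Lw; right.
  have [Da Db] : (a \in L) /\ (b \in L).
    by case/andP: H => /orP[] /eqP Du /orP[] /eqP Dw; move: uw Lu Lw; rewrite -?Du -?Dw ?eqxx.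
  have na : a \in nb.
    by rewrite /a in Da *; case: (nb) Da => [|? ?]; rewrite ?mem_head //= notL.
  have nbb : b \in nb.
    by rewrite /b in Db *; case: (nb) Db => [|? [|? ?]]; rewrite ?inE ?eqxx ?orbT //= notL.
  split=> //; case/andP: H => /orP[] /eqP Du /orP[] /eqP Dw; move: uw;
    by rewrite -Du -Dw ?eqxx ?orbT.
(* If one end of the new edge is a dummy, no live vertices become adjacent and the old bags still
   serve. *)
have [nab|Nab] := boolP ((a \in nb) && (b \in nb)); last first.
  exists bag; split=> //.
  - by move=> u /LP[_]; apply: bagL.
  - move=> u w /LP[_ Lu] /LP[_ Lw] H.
    by have [/(bagE u w Lu Lw)|[na nbb _]] := adjP u w H Lu Lw; rewrite ?na ?nbb in Nab *.
  by move=> u x y /LP[_]; apply: bagC.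
case/andP: nab => /nbP[La av adj_a] /nbP[Lb bv adj_b].
have lt_v : v < n by apply: (allP ltL).
have lt_a : a < n by apply: (allP ltL).
pose vo := Ordinal lt_v; pose ao := Ordinal lt_a.
have ne_ao : ao != vo by rewrite -val_eqE.
exists (fun x => if vo \in bag x then ao |: (bag x :\ vo) else bag x).
have bag'P (u : 'I_n) x : (u : nat) != v ->
    (u \in if vo \in bag x then ao |: (bag x :\ vo) else bag x) =
    (u \in bag x) || ((u == ao) && (vo \in bag x)).
  move=> uv; have uvo : u != vo by rewrite -val_eqE.
  by case: ifP => vx; rewrite ?inE ?uvo ?andbF ?orbF // andbT orbC.
split.
- move=> x; case: ifP => // vx; apply: leq_trans (bag3 x).
  by rewrite (cardsD1 vo (bag x)) vx cardsU1; case: (_ \notin _).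
- move=> u /LP[uv Lu]; have [x ux] := bagL u Lu; exists x.
  by rewrite bag'P // ux.
- move=> u w /LP[uv Lu] /LP[wv Lw] Huw.
  have [/(bagE u w Lu Lw)[x /andP[ux wx]]|[_ _ H]] := adjP u w Huw Lu Lw.
    by exists x; rewrite !bag'P // ux wx.
  have lt_b : b < n by apply: (allP ltL).
  have [x /andP[vx bx]] := bagE vo (Ordinal lt_b) Lv Lb adj_b.
  exists x; rewrite !bag'P // vx !andbT.
  have {}H : ((u == ao) && (w == Ordinal lt_b)) || ((u == Ordinal lt_b) && (w == ao)).
    by rewrite -!val_eqE.
  by case/orP: H => /andP[/eqP-> /eqP->]; rewrite bx ?eqxx ?orbT.
move=> u x y /LP[uv Lu]; rewrite !bag'P //.
pose R' := [rel x y | [&& link x y, u \in if vo \in bag x then ao |: (bag x :\ vo) else bag x &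
   u \in if vo \in bag y then ao |: (bag y :\ vo) else bag y]].
have sym : connect_sym R'.
  have [_ l_sym _ _ _] := tree_link.
  by apply: sym_connect_sym => p q; rewrite /= l_sym; congr (_ && _); rewrite andbC.
have subu p q : u \in bag p -> u \in bag q -> connect R' p q.
  move=> up uq; have := bagC u p q Lu up uq; apply: connect_sub => c d /= /and3P[lcd uc ud].
  by apply: connect1; rewrite /= lcd !bag'P // uc ud.
have [Du|ne_u] := eqVneq u ao; last by rewrite !orbF; apply: subu.
have subv p q : vo \in bag p -> vo \in bag q -> connect R' p q.
  move=> up uq; have := bagC vo p q Lv up uq; apply: connect_sub => c d /= /and3P[lcd uc ud].
  by apply: connect1; rewrite /= lcd !bag'P // Du uc ud eqxx !orbT.
(* The new subtree of [a] is the union of the old ones of [a] and [v]; as these vertices are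
   adjacent, the two meet in a node [z]. *)
have [z /andP[vz az]] := bagE vo ao Lv La adj_a.
have toz p : (u \in bag p) || (true && (vo \in bag p)) -> connect R' p z.
  by case/orP=> [up|/= vp]; [apply: subu; rewrite // Du | apply: subv].
move=> /toz xz /toz yz; apply: connect_trans xz _; by rewrite sym.
Qed.

(** Once all vertices are eliminated no demand remains, and feasibility says only that every
    generalized edge has some pair to choose. *)
Lemma eliminate_iter M m L E : (forall u, m u <= M) ->
  all (gtn n) L -> uniq L -> decomposed L E ->
  feasible m L E <-> all (fun e => ~~ nilp e.2) (iter (size L) (eliminate M m n) (L, E)).2.
Proof.
move=> le_M; move Dk: (size L) => k; elim: k L E Dk => [|k IH] L E Dk ltL UL dec.
  by case: L Dk {ltL UL dec} => // _; apply: feasible_nil.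
have L0 : L != [::] by case: (L) Dk.
have [Lv nb2] := pivotP ltL UL L0 dec.
have dec' := eliminate_decomposed M m ltL UL L0 dec.
rewrite iterSr [eliminate _ _ _ _]surjective_pairing.
have sub : subseq (eliminate M m n (L, E)).1 L by apply: filter_subseq.
have size' : size (eliminate M m n (L, E)).1 = k.
  rewrite /= size_filter; have := count_predC (pred1 (pivot n (L, E))) L.
  rewrite count_uniq_mem // Lv Dk => /eqP; rewrite add1n eqSS => /eqP <-.
  by apply: eq_count => u.
apply: iff_trans (IH _ _ size' _ _ dec'); last 2 first.
- by apply/allP => u /(mem_subseq sub) /(allP ltL).
- exact: subseq_uniq sub UL.
move: Lv nb2; rewrite /eliminate /=; set v := pivot _ _ => Lv; set nb := neighbours L E v => nb2.
have Unb : uniq nb by apply: filter_uniq.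
have nbP u : u \in nb -> u < n /\ u != v.
  by rewrite mem_filter => /andP[/andP[uv _] /(allP ltL)].
have lt_v : v < n by apply: (allP ltL).
apply: eliminate_feasible => //.
- case: (nb) Unb nbP => [|a [|b s]] /=; first by rewrite neq_ltn ltnSn.
    by move=> _ /(_ a (mem_head _ _))[lt_a _]; rewrite neq_ltn (ltn_trans lt_a).
  by rewrite inE negb_or => /andP[/andP[]].
- case: (nb) nbP => [|a s] /=; first by rewrite neq_ltn lt_v orbT.
  by move=> /(_ a (mem_head _ _))[].
- case: (nb) nbP => [|a [|b s]] /=; try by rewrite neq_ltn (ltn_trans lt_v) ?orbT.
  by move=> /(_ b)[] //; rewrite !inE eqxx orbT.
move=> u e Lu uv Ee ve ue.
have : u \in nb by rewrite mem_filter uv Lu andbT; apply/hasP; exists e => //; rewrite ve.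
by case: (nb) nb2 => [|a [|b [|]]] //= _; rewrite !inE ?orbF //; move=> ->.
Qed.
End Treewidth.

(** * Constraint graphs as lists of generalized edges *)

Lemma achieves_choices (P : seq (nat * nat)) (w : nat * nat -> nat) f : uniq P ->
  achieves [seq (p, [:: (w p, 0); (0, w p)]) | p <- P] f <->
  exists C : pred (nat * nat), forall v,
    f v = \sum_(p <- P) provides p (if C p then (0, w p) else (w p, 0)) v.
Proof.
elim: P f => [|p P IH] f /=.
  by split=> [f0|[C fE] v]; [exists xpred0 => v|]; rewrite ?fE ?f0 big_nil.
case/andP=> nPp /IH{}IH; split=> [[r pr [g /IH[C gE] fE]]|[C fE]].
  exists (fun q => if q == p then r == (0, w p) else C q) => v.
  rewrite big_cons eqxx fE gE; congr (_ + _).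
    by move: pr; rewrite !inE => /orP[] /eqP-> //; rewrite ?eqxx //; case: eqP => // <-.
  apply: eq_big_seq => q Pq; case: eqP => // Dq; by rewrite -Dq Pq in nPp.
exists (if C p then (0, w p) else (w p, 0)); first by case: (C p); rewrite !inE eqxx ?orbT.
exists (fun v => \sum_(p <- P) provides p (if C p then (0, w p) else (w p, 0)) v).
  by apply/IH; exists C.
by move=> v; rewrite fE big_cons.
Qed.

Definition pairs n : seq (nat * nat) := flatten [seq [seq (i, j) | j <- iota 0 n] | i <- iota 0 n].

Definition graph_pairs (L : seq word) : seq (nat * nat) :=
  [seq p <- pairs (order_of L) | (p.1 < p.2) && ~~ nilp (weight_of L p.1 p.2)].

Definition graph_edges (M : nat) (L : seq word) : seq hyperedge :=
  [seq (p, [:: (capped M (weight_of L p.1 p.2), 0); (0, capped M (weight_of L p.1 p.2))])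
  | p <- graph_pairs L].

(** Capping at M+1 instead of M distinguishes a demand equal to M from a larger one without
    expanding it in unary. *)
Definition enough (x : nat * word) : bool :=
  all (fun i => capped x.1.+1 (inflow_of (decode x.2) i) <= x.1) (iota 0 (order_of (decode x.2))).

Definition demand (M : nat) (L : seq word) (v : nat) : nat := capped M (inflow_of L v).

Definition decide_list (M : nat) (L : seq word) : bool :=
  all (fun e : hyperedge => ~~ nilp e.2)
    (iter (order_of L) (eliminate M (demand M L) (order_of L))
       (iota 0 (order_of L), graph_edges M L)).2.

Definition decide (x : nat * word) : bool := decide_list x.1 (decode x.2).

Lemma uniq_pairs n : uniq (pairs n).
Proof. by apply: allpairs_uniq; rewrite ?iota_uniq // => -[? ?] [? ?]. Qed.

Lemma graph_edges_choices M L f : achieves (graph_edges M L) f <->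
  exists C : pred (nat * nat), forall v, f v = \sum_(p <- graph_pairs L)
    provides p (if C p then (0, capped M (weight_of L p.1 p.2))
                else (capped M (weight_of L p.1 p.2), 0)) v.
Proof. by apply: achieves_choices; apply/filter_uniq/uniq_pairs. Qed.

Lemma sum_pairs n (F : nat * nat -> nat) :
  \sum_(p <- pairs n) F p = \sum_(i < n) \sum_(j < n) F (val i, val j).
Proof.
rewrite /pairs big_flatten big_map -[n in iota 0 n]subn0 -/(index_iota 0 n) big_mkord.
by apply: eq_bigr => i _; rewrite big_map big_mkord.
Qed.

Lemma sum_delta n (v : 'I_n) (F : 'I_n -> nat) : \sum_(i < n) (val i == v) * F i = F v.
Proof.
rewrite (bigD1 v) //= eqxx mul1n big1 ?addn0 // => i; rewrite -val_eqE => /negPf.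
by move=> /= ->.
Qed.

(** Capping each summand loses nothing below the cap, so a demand of at most [M] met by the true
    weights is met by the capped ones. *)
Lemma minn_sum (I : finType) (p : pred I) M (F : I -> nat) :
  minn M (\sum_(i | p i) F i) <= \sum_(i | p i) minn M (F i).
Proof.
elim/big_rec2: _ => [|i y x _ H]; first by rewrite minn0.
by lia.
Qed.

Section Decide.
Variables (G : constraint_graph) (M : nat).
Let n := Defs.order G.
Let L := decode (code_graph G).

Lemma sum_graph_pairs (o : nat -> nat -> bool) (v : 'I_n) :
  \sum_(p <- graph_pairs L) provides p
     (if o p.1 p.2 then (0, capped M (weight_of L p.1 p.2)) else (capped M (weight_of L p.1 p.2), 0)) v
  = \sum_(u < n) if edge u v && (if u < v then o u v else ~~ o v u) then minn M (weight u v) else 0.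
Proof.
rewrite big_filter big_mkcond order_ofE sum_pairs /=.
pose W (i j : 'I_n) := if edge i j && (i < j) then minn M (weight i j) else 0.
transitivity (\sum_(i < n) \sum_(j < n)
    ((val i == v) * (~~ o i j * W i j) + (val j == v) * (o i j * W i j))).
  apply: eq_bigr => i _; apply: eq_bigr => j _; rewrite weight_ofE nilp_bits cappedE bval_bits.
  rewrite /W /adjacency /provides; case E : (edge i j); last by rewrite eqxx andbF /= !muln0.
  have := weight_gt0 E; rewrite lt0n => ->; rewrite andbT.
  by case: ifP => /= _; case: (o i j) => /=; rewrite ?muln0 ?mul0n ?mul1n ?addn0.
under [LHS]eq_bigr => i _ do rewrite big_split /=.
rewrite big_split /= [X in X + _ = _]exchange_big /=.
under [X in X + _ = _]eq_bigr => j _ do rewrite sum_delta.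
under [X in _ + X = _]eq_bigr => i _ do rewrite sum_delta.
rewrite -big_split /=; apply: eq_bigr => u _; rewrite /W (edge_sym v u) (weight_sym v u).
case E : (edge u v) => /=; last by rewrite !muln0.
have : u != v by apply: contraTneq E => ->; rewrite edge_irr.
rewrite -val_eqE /=; case: (ltngtP u v) => //= _ _; rewrite ?muln0 ?addn0 ?add0n.
  by case: (o u v); rewrite ?mul1n ?mul0n.
by case: (o v u); rewrite ?mul1n ?mul0n.
Qed.

Lemma feasible_graph : (forall v : 'I_n, min_inflow v <= M) ->
  feasible (demand M L) (iota 0 n) (graph_edges M L) <-> satisfiable G.
Proof.
move=> le_M; have demandE (v : 'I_n) : demand M L v = min_inflow v.
  by rewrite /demand inflow_ofE cappedE bval_bits; apply/minn_idPr.
have sumE := sum_graph_pairs; rewrite -/L in sumE; move: L demandE sumE => K demandE sumE.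
split=> [[f /graph_edges_choices[C fE] fm]|[o [Ho Hin]]].
  (* Each edge is listed once, smaller endpoint first, and [C] holds when its weight goes to the
     larger endpoint. *)
  pose o := [rel u v : 'I_n | if u < v then C (val u, val v) else ~~ C (val v, val u)].
  exists o; split=> [u v euv|v] /=.
    have : u != v by apply: contraTneq euv => ->; rewrite edge_irr.
    by rewrite -val_eqE /=; case: ltngtP => //= _ _; rewrite negbK.
  have := fm v; rewrite mem_iota add0n ltn_ord demandE fE => /(_ isT) /leq_trans; apply.
  have := sumE (fun i j => C (i, j)) v.
  have -> : \sum_(p <- graph_pairs K) provides p (if C (p.1, p.2)
      then (0, capped M (weight_of K p.1 p.2)) else (capped M (weight_of K p.1 p.2), 0)) v =
    \sum_(p <- graph_pairs K) provides p (if C p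
      then (0, capped M (weight_of K p.1 p.2)) else (capped M (weight_of K p.1 p.2), 0)) v.
    by apply: eq_bigr => -[].
  move=> ->; rewrite /inflow [X in _ <= X]big_mkcond /=; apply: leq_sum => u _.
  by case: ifP => // _; apply: geq_minr.
pose f v := \sum_(p <- graph_pairs K) provides p
   (if [exists i : 'I_n, exists j : 'I_n, [&& val i == p.1, val j == p.2 & o i j]]
    then (0, capped M (weight_of K p.1 p.2)) else (capped M (weight_of K p.1 p.2), 0)) v.
exists f.
  apply/graph_edges_choices.
  by exists (fun p => [exists i : 'I_n, exists j : 'I_n, [&& val i == p.1, val j == p.2 & o i j]]).
move=> k; rewrite mem_iota add0n /= => lt_k; pose v := Ordinal lt_k.
rewrite -[k]/(val v) demandE /f.
have := sumE (fun x y => [exists i : 'I_n, exists j : 'I_n, [&& val i == x, val j == y & o i j]]) v.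
move=> ->; have oE (i j : 'I_n) : [exists i' : 'I_n, exists j' : 'I_n, [&& val i' == i, val j' == j & o i' j']] = o i j.
  apply/existsP/idP => [[i' /existsP[j' /and3P[/eqP/val_inj-> /eqP/val_inj->]]]//|oij].
  by exists i; apply/existsP; exists j; rewrite !eqxx.
apply: leq_trans (_ : minn M (inflow o v) <= _); first by rewrite leq_min le_M Hin.
apply: leq_trans (minn_sum _ _ _) _; rewrite big_mkcond; apply: leq_sum => u _.
rewrite !oE; case E : (edge u v) => //=.
have : u != v by apply: contraTneq E => ->; rewrite edge_irr.
rewrite -val_eqE /=; case: (ltngtP u v) => //= _ _.
by rewrite (Ho u v E).
Qed.

Lemma enoughP : enough (M, code_graph G) = [forall v : 'I_n, min_inflow v <= M].
Proof.
rewrite -[enough _]/(all (fun i => capped M.+1 (inflow_of L i) <= M) (iota 0 (order_of L))).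
rewrite order_ofE; apply/(@all_iotaP n _)/forallP => H v; have := H v;
  by rewrite inflow_ofE cappedE bval_bits; lia.
Qed.

(** The decomposition enters only the correctness proof; the algorithm finds its pivots by counting
    neighbours. *)
Lemma decideP : has_treewidth (@edge G) 2 -> enough (M, code_graph G) ->
  decide (M, code_graph G) <-> satisfiable G.
Proof.
move=> [[D wD] _]; rewrite enoughP => /forallP le_M.
apply: iff_trans (feasible_graph le_M).
rewrite -[decide _]/(decide_list M L) /decide_list order_ofE.
have := @eliminate_iter n _ _ (link_tree D) M (demand M L) (iota 0 n) (graph_edges M L).
rewrite size_iota => H; apply: iff_sym; apply: H.
- by move=> u; rewrite /demand cappedE geq_minl.
- by apply/allP => i; rewrite mem_iota.
- exact: iota_uniq.
exists (bag (t := D)); split.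
- move=> x; apply: leq_trans (@leq_bigmax _ (fun x : node D => #|bag x|) x) _.
  by move: wD; rewrite /width; case: (\max_(x : node D) _) => // k /= ->.
- by move=> v _; apply: bag_vertex.
- move=> u v _ _ /andP[uv /hasP[e /mapP[p]]].
  rewrite mem_filter => /andP[/andP[lt_p wp] Pp] -> /andP[up vp].
  apply: bag_edge; move: Pp => /allpairsP[[i j]] /=; rewrite !mem_iota !add0n /= order_ofE.
  case=> lt_i lt_j Dp; rewrite {p}Dp /= in lt_p wp up vp.
  have := weight_ofE (Ordinal lt_i) (Ordinal lt_j); rewrite /= -/L => Dw.
  move: wp; rewrite Dw nilp_bits /adjacency; case: ifP => // eij _.
  move: up vp uv; rewrite /incident /=.
  case/orP=> /eqP Du /orP[] /eqP Dv uv; try by rewrite -Du -Dv eqxx in uv.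
    have -> : u = Ordinal lt_i by apply: val_inj.
    by have -> : v = Ordinal lt_j by apply: val_inj.
  have -> : u = Ordinal lt_j by apply: val_inj.
  by have -> : v = Ordinal lt_i by [apply: val_inj]; rewrite edge_sym.
by move=> v x y _; apply: bag_connected.
Qed.
End Decide.

(** * Running time of the elimination *)

Lemma esize_filter A {EA : Enc A} (p : pred A) (s : seq A) : esize [seq a <- s | p a] <= esize s.
Proof. by elim: s => //= a s IH; case: (p a); rewrite !esize_cons; lia. Qed.

Lemma esize_map_snd A B {EA : Enc A} {EB : Enc B} (s : seq (A * B)) : esize [seq t.2 | t <- s] <= esize s.
Proof. by elim: s => //= t s IH; rewrite !esize_cons esize_pair; lia. Qed.

Lemma esize_subseq (A : eqType) {EA : Enc A} (s t : seq A) : subseq s t -> esize s <= esize t.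
Proof.
elim: t s => [|b t IH] [|a s] //=.
case: eqP => [->|_] /IH; rewrite ?esize_cons; lia.
Qed.

Section HyperedgeFP.
Context {E : Type} {EE : Enc E}.

Lemma fp_nat_of_bool (b : E -> bool) : FP b -> FP (fun e => nat_of_bool (b e)).
Proof. by move=> Pb; apply: (fp_ext (f := fun e => if b e then 1 else 0)); fp. Qed.

Lemma fp_provides (e r : E -> nat * nat) (v : E -> nat) :
  FP e -> FP r -> FP v -> FP (fun x => provides (e x) (r x) (v x)).
Proof.
by move=> Pe Pr Pv; rewrite /provides; apply: fp_add; apply: fp_mul; fp; apply: fp_nat_of_bool; fp.
Qed.

Lemma fp_incident (v : E -> nat) (e : E -> hyperedge) :
  FP v -> FP e -> FP (fun x => incident (v x) (e x)).
Proof. by move=> Pv Pe; rewrite /incident; fp. Qed.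

Lemma fp_triples (M : E -> nat) : FP M -> FP (fun e => triples (M e)).
Proof. by move=> PM; rewrite /triples; fp. Qed.
End HyperedgeFP.

Ltac fp_hyperedge ::= lazymatch goal with
  | |- FP (fun e => nat_of_bool (@?f e)) => apply (@fp_nat_of_bool _ _ f)
  | |- FP (fun e => provides (@?f e) (@?g e) (@?h e)) => apply (@fp_provides _ _ f g h)
  | |- FP (fun e => incident (@?f e) (@?g e)) => apply (@fp_incident _ _ f g)
  | |- FP (fun e => triples (@?f e)) => apply (@fp_triples _ _ f)
  end.

Lemma fp_add_edge E {EE : Enc E} (M v a b : E -> nat) (S : E -> seq (nat * (nat * nat)))
    (e : E -> hyperedge) : FP M -> FP v -> FP a -> FP b -> FP S -> FP e ->
  FP (fun x => add_edge (M x) (v x) (a x) (b x) (S x) (e x)).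
Proof. by move=> PM Pv Pa Pb PS Pe; rewrite /add_edge; fp. Qed.

Lemma esize_loads M v a b E : esize (loads M v a b E) <= esize (triples M) + esize [:: (0, (0, 0))].
Proof.
rewrite /loads; case/lastP: E => [|E e]; first by rewrite leq_addl.
rewrite -cats1 foldl_cat /= /add_edge.
by apply: leq_trans (esize_filter _ _) _; rewrite leq_addr.
Qed.

Lemma fp_loads E {EE : Enc E} (M v a b : E -> nat) (H : E -> seq hyperedge) :
  FP M -> FP v -> FP a -> FP b -> FP H -> FP (fun x => loads (M x) (v x) (a x) (b x) (H x)).
Proof.
move=> PM Pv Pa Pb PH; have [k Hk] := FP_size (fp_triples PM).
apply: (fp_foldl_bounded (h := fun x => add_edge (M x) (v x) (a x) (b x))
  (s := fun _ => [:: (0, (0, 0))]) (b := fun x => x.+2 ^ k + esize [:: (0, (0, 0))])) => //.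
- by fp.
- by apply: fp_add_edge; fp.
- by polyt.
by move=> e j; apply: leq_trans (esize_loads _ _ _ _ _) _; rewrite leq_add2r.
Qed.

Lemma fp_merged E {EE : Enc E} (M m v a b : E -> nat) (H : E -> seq hyperedge) :
  FP M -> FP m -> FP v -> FP a -> FP b -> FP H ->
  FP (fun x => merged (M x) (m x) (v x) (a x) (b x) (H x)).
Proof.
move=> PM Pm Pv Pa Pb PH; rewrite /merged.
have PL : FP (fun x => loads (M x) (v x) (a x) (b x) [seq e <- H x | incident (v x) e]).
  by apply: fp_loads => //; fp.
by fp.
Qed.

Section EliminateFP.
Context {E : Type} {EE : Enc E}.

Lemma fp_neighbours (L : E -> seq nat) (H : E -> seq hyperedge) (v : E -> nat) :
  FP L -> FP H -> FP v -> FP (fun x => neighbours (L x) (H x) (v x)).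
Proof. by move=> PL PH Pv; rewrite /neighbours; fp. Qed.
End EliminateFP.

Lemma fp_pivot E {EE : Enc E} (n : E -> nat) (s : E -> seq nat * seq hyperedge) :
  FP n -> FP s -> FP (fun x => pivot (n x) (s x)).
Proof. by move=> Pn Ps; rewrite /pivot; fp; apply: fp_neighbours; fp. Qed.

Ltac fp_elimination ::= lazymatch goal with
  | |- FP (fun e => neighbours (@?f e) (@?g e) (@?h e)) => apply (@fp_neighbours _ _ f g h)
  | |- FP (fun e => pivot (@?f e) (@?g e)) => apply (@fp_pivot _ _ f g)
  end.

Lemma fp_eliminate E {EE : Enc E} (M n : E -> nat) (L : E -> seq word)
    (s : E -> seq nat * seq hyperedge) : FP M -> FP n -> FP L -> FP s ->
  FP (fun x => eliminate (M x) (demand (M x) (L x)) (n x) (s x)).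
Proof.
move=> PM Pn PL Ps; rewrite /eliminate; fp.
by apply: fp_merged; rewrite /demand; fp.
Qed.

Lemma esize_merged M m v a b H : esize (merged M m v a b H) <=
  2 * a + 2 * b + esize (triples M) + esize [:: (0, (0, 0))] + 4.
Proof.
rewrite /merged !esize_pair /= !esize_nat.
set S := loads _ _ _ _ _; have le_S : esize S <= esize (triples M) + esize [:: (0, (0, 0))].
  exact: esize_loads.
set T := [seq t <- S | _]; have le_T : esize T <= esize S by apply: esize_filter.
have le_R : esize [seq t.2 | t <- T] <= esize T by apply: esize_map_snd.
by lia.
Qed.

(** Every round adds one generalized edge whose list is bounded by the grid of triples, so the total
    size grows additively in the number of rounds. *)
Lemma esize_eliminate M m n L H i B : esize (triples M) <= B ->
  let s := iter i (eliminate M m n) (L, H) in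
  all (gtn n) L ->
  subseq s.1 L /\ esize s.2 <= esize H + i * (4 * n + B + esize [:: (0, (0, 0))] + 7).
Proof.
move=> le_B s ltL; rewrite {}/s; elim: i => [|i [sub le_E]] /=; first by rewrite addn0.
set s := iter _ _ _ in sub le_E *; set v := pivot n s.
split; first by apply: subseq_trans sub; apply: filter_subseq.
have lt_nb u : u \in neighbours s.1 s.2 v -> u < n.
  by rewrite mem_filter => /andP[_ /(mem_subseq sub) /(allP ltL)].
set a := nth n _ 0; set b := nth n.+1 _ 1.
have le_a : a <= n.
  by rewrite /a; case: (neighbours _ _ _) lt_nb => //= u nb /(_ u (mem_head _ _)) /ltnW.
have le_b : b <= n.+1.
  rewrite /b; case: (neighbours _ _ _) lt_nb => [|u [|w nb]] //= /(_ w).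
  by rewrite !inE eqxx orbT => /(_ isT) /ltnW /leqW.
rewrite esize_cons mulSn.
have := esize_merged M (m v) v a b s.2.
have : esize [seq e <- s.2 | ~~ incident v e] <= esize s.2 by apply: esize_filter.
by lia.
Qed.

Lemma fp_decide : FP decide.
Proof.
have Pe : FP (fun x : nat * seq word => graph_edges x.1 x.2).
  by rewrite /graph_edges /graph_pairs /pairs; fp.
have Pi : FP (fun x : nat * seq word => iter (order_of x.2)
    (eliminate x.1 (demand x.1 x.2) (order_of x.2)) (iota 0 (order_of x.2), graph_edges x.1 x.2)).
  have [j Hj] := FP_size Pe.
  have Pi : FP (fun x : nat * seq word => iota 0 (order_of x.2)) by fp.
  have [k Hk] := FP_size Pi.
  have Pt : FP (fun x : nat * seq word => triples x.1) by fp.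
  have [l Hl] := FP_size Pt.
  have [C DC] : exists C, C = esize [:: (0, (0, 0))] by exists (esize [:: (0, (0, 0))]).
  refine (@fp_iter _ _ _ _ (fun x : nat * seq word => order_of x.2)
    (fun x => eliminate x.1 (demand x.1 x.2) (order_of x.2))
    (fun x => (iota 0 (order_of x.2), graph_edges x.1 x.2))
    (fun y => (y.+2 ^ k + (y.+2 ^ j + y.+2 ^ k * (4 * y.+2 ^ k + y.+2 ^ l + C + 7))).+1) _ _ _ _ _).
  - by fp.
  - by fp.
  - by apply: fp_eliminate; fp.
  - by polyt.
  move=> x i le_i; set n := order_of x.2 in le_i *.
  have lt_n : n < (esize x).+2 ^ k.
    by apply: leq_trans (Hk x); rewrite -{1}(size_iota 0 n); apply: size_esize.
  have ltn_all : all (gtn n) (iota 0 n) by apply/allP => u; rewrite mem_iota.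
  have [sub le_E] := @esize_eliminate x.1 (demand x.1 x.2) n (iota 0 n) (graph_edges x.1 x.2) i
     _ (Hl x) ltn_all.
  rewrite esize_pair ltnS; apply: leq_add.
    by apply: leq_trans (Hk x); apply: esize_subseq.
  apply: leq_trans le_E _; apply: leq_add; first exact: Hj.
  by apply: leq_mul; [apply: leq_trans le_i (ltnW lt_n) | rewrite -DC; lia].
rewrite /decide; have P : FP (fun x : nat * seq word => decide_list x.1 x.2) by rewrite /decide_list; fp.
by apply (fp_app2 P); fp.
Qed.

Lemma fp_enough : FP enough.
Proof. by rewrite /enough; fp. Qed.

Lemma cgs_pseudo_polynomial : pseudo_polynomial (@restrict constraint_graph_satisfiability
  (fun G : constraint_graph => has_treewidth (@edge G) 2)).
Proof.
have [M [k HM]] := search_machine fp_enough fp_decide.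
have [c [l Hp]] : exists c l, forall n, n.+2 ^ k <= pbound c l n.
  by apply: poly_pbound; polyt.
exists M, c, l => -[G tw] /=; rewrite /instance_length /=.
(* The fuel [max_weight G] passes the test, so the search ends by then and its time is polynomial in
   the code length plus the largest number. *)
have [|m Em /(_ _ (Hp _))[halt acc]] := HM (code_graph G) (max_weight G).
  rewrite enoughP; apply/forallP => v; rewrite /max_weight leq_max.
  by apply/orP; left; apply: (leq_bigmax v).
split; [exact: halt | rewrite acc; apply: iff_sym; exact: decideP].
Qed.

(** * From subset sum to graphs of treewidth 2 *)

(* The gadget for the subset sum instance a_0, ..., a_(n-1) with target t:    *)
(* vertex 3+i has demand a_i and edges of weight a_i to vertices 0 and 1, so  *)
(* it gives away at most one of them; vertex 0 demands t and vertex 1 demands *)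
(* the sum of the a_i, of which vertex 2 provides t. Edges of weight one make *)
(* 0, 1, 2 a triangle. All numbers are multiples of 4, which absorbs the unit *)
(* weights. The weights live in a type A so that the same definition serves   *)
(* for natural numbers and for binary words.                                  *)
Section Gadget.
Variables (A : Type) (zero one t' t s : A) (a : seq A).

Definition half_weight (i j : nat) : A :=
  if i == 0 then (if (j == 1) || (j == 2) then one else if 2 < j then nth zero a (j - 3) else zero)
  else if i == 1 then (if j == 2 then t' else if 2 < j then nth zero a (j - 3) else zero)
  else zero.

Definition gadget_weight (i j : nat) : A :=
  if i < j then half_weight i j else half_weight j i.

Definition gadget_demand (i : nat) : A :=
  if i == 0 then t else if i == 1 then s else if i == 2 then zero else nth zero a (i - 3).

Lemma gadget_weight_sym i j : gadget_weight i j = gadget_weight j i.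
Proof. by rewrite /gadget_weight; case: ltngtP => // ->. Qed.

Lemma gadget_weightnn i : gadget_weight i i = zero.
Proof. by rewrite /gadget_weight ltnn /half_weight; case: i => [|[]]. Qed.

End Gadget.

Section GadgetGraph.
Variables (a : seq nat) (t : nat).
Let n := size a.
(** The weight [t.+1] between vertices 1 and 2 is positive even for a zero target, so the triangle
    is always there. *)
Let w := gadget_weight 0 1 t.+1 a.

Lemma gadget_irr : irreflexive (fun u v : 'I_n.+3 => w u v != 0).
Proof. by move=> u; rewrite /w gadget_weightnn. Qed.

Lemma gadget_sym : symmetric (fun u v : 'I_n.+3 => w u v != 0).
Proof. by move=> u v; rewrite /w gadget_weight_sym. Qed.

Definition gadget_graph : constraint_graph :=
  @ConstraintGraph n.+3 (fun u v => w u v != 0) gadget_sym gadget_irr (fun u v => w u v)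
    (fun u v => gadget_weight_sym _ _ _ _ u v) (fun u v uv => etrans (lt0n _) uv)
    (fun v => gadget_demand 0 t (sumn a) a v).

Lemma gadget_adjacency (u v : 'I_n.+3) : @adjacency gadget_graph u v = w u v.
Proof. by rewrite /adjacency /=; case: eqP. Qed.

Lemma inflow_gadget (o : nat -> nat -> bool) v : v < n.+3 ->
  @inflow gadget_graph (fun i j => o i j) (inord v) =
  (if o 0 v then w 0 v else 0) + ((if o 1 v then w 1 v else 0) + ((if o 2 v then w 2 v else 0) +
    \sum_(i < n) if o i.+3 v then w i.+3 v else 0)).
Proof.
move=> lt_v; rewrite (sum_adjacency (G := gadget_graph)) !big_ord_recl /=.
rewrite !gadget_adjacency /= inordK // /bump /= !add1n; do 3!congr (_ + _).
by apply: eq_bigr => i _; rewrite gadget_adjacency inordK.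
Qed.

Lemma gadget_weight0S i : w 0 i.+3 = nth 0 a i.
Proof. by rewrite /w /gadget_weight /half_weight /= ?subSS ?subn0. Qed.
Lemma gadget_weight1S i : w 1 i.+3 = nth 0 a i.
Proof. by rewrite /w /gadget_weight /half_weight /= ?subSS ?subn0. Qed.
Lemma gadget_weightS0 i : w i.+3 0 = nth 0 a i.
Proof. by rewrite /w gadget_weight_sym -/w gadget_weight0S. Qed.
Lemma gadget_weightS1 i : w i.+3 1 = nth 0 a i.
Proof. by rewrite /w gadget_weight_sym -/w gadget_weight1S. Qed.
Lemma gadget_weight_small :
  (w 0 0 = 0) * (w 1 0 = 1) * (w 2 0 = 1) * (w 0 1 = 1) * (w 1 1 = 0) * (w 2 1 = t.+1).
Proof. by []. Qed.
Lemma gadget_weightSS i j : w i.+2 j.+2 = 0.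
Proof. by rewrite /w /gadget_weight /half_weight; case: ifP. Qed.

Lemma sumn_nth : sumn a = \sum_(i < n) nth 0 a i.
Proof. by rewrite sumnE (big_nth 0) big_mkord. Qed.

Lemma gadget_satisfiable : (forall x, x \in a -> 4 %| x) -> 4 %| t ->
  satisfiable gadget_graph <-> exists C : pred nat, \sum_(i < n | C i) nth 0 a i = t.
Proof.
move=> a4 t4; have item4 (C : pred nat) : 4 %| \sum_(i < n | C i) nth 0 a i.
  by apply: dvdn_sum => i _; apply/a4/mem_nth.
split=> [[o0 [Ho Hin]]|[C sumC]].
  pose o i j : bool := o0 (inord i) (inord j).
  have o0E : o0 =2 (fun i j => o i j) by move=> i j; rewrite /o !inord_val.
  have {}Hin v : v < n.+3 -> gadget_demand 0 t (sumn a) a v <=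
     (if o 0 v then w 0 v else 0) + ((if o 1 v then w 1 v else 0) + ((if o 2 v then w 2 v else 0) +
    \sum_(i < n) if o i.+3 v then w i.+3 v else 0)).
    move=> lt_v; rewrite -inflow_gadget //; have := Hin (inord v); rewrite /= inordK // => /leq_trans.
    apply; apply: eq_leq; apply: eq_bigl => u /=; by rewrite o0E.
  have {}Ho i j : i < n.+3 -> j < n.+3 -> w i j != 0 -> o i j = ~~ o j i.
    by move=> lt_i lt_j wij; apply: Ho; rewrite /= !inordK.
  (* What item [i] gives to the hubs 0 and 1. Its incident weight is twice its demand, so it gives
     away at most its demand. *)
  pose x i := if o i.+3 0 then nth 0 a i else 0; pose y i := if o i.+3 1 then nth 0 a i else 0.
  have le_xy (i : 'I_n) : x i + y i <= nth 0 a i.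
    have [a0|a_gt0] := posnP (nth 0 a i); first by rewrite /x /y a0 !if_same.
    have := Hin i.+3 (ltn_ord i); rewrite /gadget_demand /= ?subSS ?subn0.
    rewrite gadget_weight0S gadget_weight1S gadget_weightSS if_same add0n big1 => [|j _]; last first.
      by rewrite gadget_weightSS if_same.
    have lt_i : i.+3 < n.+3 by rewrite !ltnS.
    rewrite (Ho 0 i.+3) //; last by rewrite gadget_weight0S -lt0n.
    rewrite (Ho 1 i.+3) //; last by rewrite gadget_weight1S -lt0n.
    by rewrite /x /y; case: (o _ 0); case: (o _ 1) => /=; lia.
  have le_sum : \sum_(i < n) x i + \sum_(i < n) y i <= sumn a.
    by rewrite -big_split sumn_nth; apply: leq_sum => i _.
  have leA : t <= 2 + \sum_(i < n) x i.
    have := Hin 0 isT; rewrite /gadget_demand /= => /leq_trans; apply.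
    rewrite !gadget_weight_small if_same add0n.
    rewrite addnA; apply: leq_add; first by case: (o 1 0); case: (o 2 0).
    by apply: leq_sum => i _; rewrite gadget_weightS0.
  have leB : sumn a <= t + 2 + \sum_(i < n) y i.
    have := Hin 1 isT; rewrite /gadget_demand /= => /leq_trans; apply.
    rewrite !gadget_weight_small if_same add0n.
    rewrite addnA; apply: leq_add; first by case: (o 0 1); case: (o 2 1); lia.
    by apply: leq_sum => i _; rewrite gadget_weightS1.
  exists (fun i => o i.+3 0); have := item4 (fun i => o i.+3 0).
  have -> : \sum_(i < n | o i.+3 0) nth 0 a i = \sum_(i < n) x i by rewrite big_mkcond.
  move: le_sum leA leB t4; move: (\sum_(i < n) x i) (\sum_(i < n) y i) => X Y.
  (* The three bounds put X between t - 2 and t + 2, and both are multiples of 4. *)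
  by move=> ? ? ? /dvdnP[k Dt] /dvdnP[l DX]; lia.
(* Chosen items give to hub 0 and take from hub 1, the others do the opposite; the triangle is
   oriented from 0 to 1, from 0 to 2 and from 2 to 1. *)
pose h i j := if i == 0 then if j is k.+3 then ~~ C k else true else if j is k.+3 then C k else false.
pose o i j := if i < j then h i j else ~~ h j i.
exists (fun i j => o i j); split=> [u v uv|v].
  have : u != v by apply: contraTneq uv => ->; rewrite /= /w gadget_weightnn.
  by rewrite -val_eqE /o /=; case: ltngtP => //= _ _; rewrite negbK.
rewrite -[v]inord_val inflow_gadget // /= inord_val.
case: v => [[|[|[|v]]] lt_v] /=; rewrite /gadget_demand /= ?subSS ?subn0.
- rewrite -sumC big_mkcond /= !addnA -[X in X <= _]add0n leq_add //.
  apply: leq_sum => i _; rewrite gadget_weightS0 /o /=.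
  by rewrite negbK.
- have : sumn a = t + \sum_(i < n | ~~ C i) nth 0 a i by rewrite -sumC sumn_nth (bigID (fun i : 'I_n => C i)).
  move->; rewrite addnA addnA; apply: leq_add; first by rewrite !gadget_weight_small /o /=; lia.
  rewrite big_mkcond /=; apply: leq_sum => i _.
  by rewrite gadget_weightS1 /o /=.
- by [].
by rewrite gadget_weight0S gadget_weight1S /o /= /h /=; case: (C v) => /=; lia.
Qed.
End GadgetGraph.

(** * Treewidth of the gadget *)

Section Star.
Variable n : nat.

Definition star : rel 'I_n.+1 := fun i j => (i == ord0) (+) (j == ord0).

Lemma star_tree : is_tree star.
Proof.
split.
- by rewrite card_ord.
- by move=> i j; rewrite /star addbC.
- by move=> i; rewrite /star addbb.
- have to0 i : connect star i ord0.
    have [->|ni] := eqVneq i ord0; first exact: connect0.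
    by apply: connect1; rewrite /star (negPf ni) eqxx.
  have sym : connect_sym star by apply: sym_connect_sym => i j; rewrite /star addbC.
  by move=> i j; apply: connect_trans (to0 i) _; rewrite sym.
case=> [|x [|y [|z c]]] // _; apply/negP => /andP[].
rewrite /= !inE !negb_or => /and3P[xy yz]; rewrite {1}/star in xy; rewrite {1}/star in yz.
move=> zc /and4P[/and3P[nxy nxz xc] /andP[nyz yc] _ _].
have [Dy|ny] := eqVneq y ord0; last first.
  move: xy yz; rewrite (negPf ny) addbF addFb => /eqP Dx /eqP Dz.
  by rewrite Dx Dz eqxx in nxz.
have nz : z != ord0 by rewrite -Dy eq_sym.
case: c zc xc yc => [|u c] /=; rewrite /star (negPf nz) addFb ?andbT.
  by move=> /eqP Dx; rewrite Dx Dy eqxx in nxy.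
by move=> /andP[/eqP Du _] _; rewrite inE Dy -Du eqxx.
Qed.
End Star.

Section GadgetTreewidth.
Variables (a : seq nat) (t : nat).
Let n := size a.
Let G := gadget_graph a t.

(** Every edge has a hub as an endpoint, so bags made of both hubs and one further vertex cover all
    edges. The hubs are in every bag and each other vertex in just one, so any tree on the bags
    would do; a star is used. *)
Definition gadget_bag (i : 'I_n.+1) : {set 'I_n.+3} := [set inord 0; inord 1; inord i.+2].

Lemma mem_gadget_bag i (v : 'I_n.+3) :
  (v \in gadget_bag i) = [|| v == 0 :> nat, v == 1 :> nat | v == i.+2 :> nat].
Proof.
have lt_i : i.+2 < n.+3 by apply: (ltn_ord i).
by rewrite !inE -!val_eqE /= !inordK // -orbA.
Qed.

Lemma gadget_bag_vertex (v : 'I_n.+3) : exists i, v \in gadget_bag i.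
Proof.
case: v => [[|[|k]] lt_k].
- by exists ord0; rewrite mem_gadget_bag.
- by exists ord0; rewrite mem_gadget_bag.
by exists (inord k); rewrite mem_gadget_bag /= inordK ?eqxx ?orbT.
Qed.

Lemma gadget_bag_edge (u v : 'I_n.+3) : @edge G u v ->
  exists i, (u \in gadget_bag i) && (v \in gadget_bag i).
Proof.
have [i iv] := gadget_bag_vertex v; have [j ju] := gadget_bag_vertex u.
have [u2|u2] := ltnP u 2.
  by exists i; rewrite iv mem_gadget_bag; case: (nat_of_ord u) u2 => [|[]].
have [v2|v2] := ltnP v 2.
  by exists j; rewrite ju mem_gadget_bag; case: (nat_of_ord v) v2 => [|[]].
move=> /=; case: (nat_of_ord u) u2 => [|[|k]] // _; case: (nat_of_ord v) v2 => [|[|l]] // _.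
by rewrite gadget_weightSS.
Qed.

Lemma gadget_bag_connected (v : 'I_n.+3) i j : v \in gadget_bag i -> v \in gadget_bag j ->
  connect [rel x y | [&& star x y, v \in gadget_bag x & v \in gadget_bag y]] i j.
Proof.
have [v2|v2] := ltnP v 2.
  have all_v k : v \in gadget_bag k by rewrite mem_gadget_bag; case: (nat_of_ord v) v2 => [|[]].
  move=> _ _; have [_ _ _ conn _] := star_tree n; have := conn i j.
  by apply: connect_sub => x y xy; apply: connect1; rewrite /= xy !all_v.
rewrite !mem_gadget_bag; case: (nat_of_ord v) v2 => [|[|k]] //= _.
rewrite !eqSS => /eqP Di /eqP Dj; have -> : i = j by apply: val_inj; rewrite /= -Di.
exact: connect0.
Qed.

Lemma gadget_treewidth : has_treewidth (@edge G) 2.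
Proof.
split.
  exists (TreeDecomposition (star_tree n) gadget_bag_vertex gadget_bag_edge gadget_bag_connected).
  have card i : #|gadget_bag i| = 3.
    have lt_i : i.+2 < n.+3 by apply: (ltn_ord i).
    by rewrite /gadget_bag setUC cardsU1 cards2 !inE -!val_eqE /= !inordK.
  rewrite /width /=; apply/eqP; rewrite eqn_leq -ltnS; apply/andP; split.
    by rewrite -ltnS prednK; [apply/bigmax_leqP => i _; rewrite card |
       apply: leq_trans (leq_bigmax ord0); rewrite card].
  by rewrite -ltnS prednK; [apply: leq_trans (leq_bigmax ord0); rewrite card |
       apply: leq_trans (leq_bigmax ord0); rewrite card].
move=> D; apply: (@triangle_width _ _ (inord 0) (inord 1) (inord 2) D).
- exact: gadget_sym.
- by rewrite /= !inordK.
- by rewrite /= !inordK.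
- by rewrite /= !inordK.
by rewrite /= !inE -!val_eqE /= !inordK.
Qed.
End GadgetTreewidth.

(** The weights are exponentially large, so the code is computed on binary words throughout;
    [gadget_codeE] identifies it with the code of the graph. *)
Definition gadget_code (a : seq word) (t : word) : word :=
  flatten [seq encode w | w <- bin (size a).+3 ::
    [seq gadget_demand [::] t (bsum a) a i | i <- iota 0 (size a).+3] ++
    flatten [seq [seq gadget_weight [::] [:: true] (badd t [:: true]) a i j | j <- iota 0 (size a).+3]
            | i <- iota 0 (size a).+3]].

Lemma bval_nth a i : bval (nth [::] a i) = nth 0 [seq bval w | w <- a] i.
Proof.
have [lt_i|le_i] := ltnP i (size a); first by rewrite (nth_map [::]).
by rewrite !nth_default ?size_map.
Qed.

Lemma bval_gadget_weight a t i j :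
  bval (gadget_weight [::] [:: true] (badd t [:: true]) a i j) =
  gadget_weight 0 1 (bval t).+1 [seq bval w | w <- a] i j.
Proof.
have half k l : bval (half_weight [::] [:: true] (badd t [:: true]) a k l) =
    half_weight 0 1 (bval t).+1 [seq bval w | w <- a] k l.
  rewrite /half_weight; do ![case: ifP => // _]; rewrite ?bval_nth ?bval_badd ?addn1 //.
by rewrite /gadget_weight; case: ifP => _; apply: half.
Qed.

Lemma bval_gadget_demand a t i : bval (gadget_demand [::] t (bsum a) a i) =
  gadget_demand 0 (bval t) (sumn [seq bval w | w <- a]) [seq bval w | w <- a] i.
Proof. by rewrite /gadget_demand; do ![case: ifP => // _]; rewrite ?bval_nth ?bval_bsum. Qed.

Lemma gadget_codeE a t :
  gadget_code a t = code_graph (gadget_graph [seq bval w | w <- a] (bval t)).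
Proof.
rewrite /gadget_code /code_graph; congr flatten.
set a' := [seq bval w | w <- a]; have sz : size a' = size a by rewrite size_map.
rewrite -[Defs.order _]/(size a').+3.
have -> : [seq encode w | w <- bin (size a).+3 ::
    [seq gadget_demand [::] t (bsum a) a i | i <- iota 0 (size a).+3] ++
    flatten [seq [seq gadget_weight [::] [:: true] (badd t [:: true]) a i j | j <- iota 0 (size a).+3]
            | i <- iota 0 (size a).+3]] = [seq code_nat k | k <- (size a).+3 ::
    [seq gadget_demand 0 (bval t) (sumn a') a' i | i <- iota 0 (size a).+3] ++
    flatten [seq [seq gadget_weight 0 1 (bval t).+1 a' i j | j <- iota 0 (size a).+3]
            | i <- iota 0 (size a).+3]].
  rewrite 2!map_cons encodeE bval_bin; congr (_ :: _); move: (iota 0 _) => s; rewrite !map_cat !map_flatten -!map_comp; congr (_ ++ _).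
    by apply: eq_map => i /=; rewrite encodeE bval_gadget_demand.
  congr (flatten _); apply: eq_map => i /=; rewrite -!map_comp; apply: eq_map => j /=.
  by rewrite encodeE bval_gadget_weight.
congr [seq code_nat _ | _ <- _]; rewrite -sz; congr (_ :: _ ++ _).
  by rewrite -val_enum_ord -map_comp.
rewrite -val_enum_ord -map_comp; congr (flatten _); apply: eq_map => i /=.
by rewrite -map_comp; apply: eq_map => j /=; rewrite gadget_adjacency.
Qed.

Lemma fp_gadget_code : FP (fun x : seq word * word => gadget_code x.1 x.2).
Proof.
have Ph (E : Type) (EE : Enc E) (t : E -> word) (a : E -> seq word) (i j : E -> nat) :
    FP t -> FP a -> FP i -> FP j ->
    FP (fun x => half_weight [::] [:: true] (t x) (a x) (i x) (j x)).
  by move=> Pt Pa Pi Pj; rewrite /half_weight; fp.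
rewrite /gadget_code; fp.
  by rewrite /gadget_demand; fp.
by rewrite /gadget_weight; fp; apply: Ph; fp.
Qed.

(** * From tilings to subset sum *)

(* Each entry of a 0/1 row becomes a digit in base 2 ^ beta.+1, which is so   *)
(* large that adding up to beta rows produces no carry; the two leading       *)
(* zeros make the number a multiple of 4.                                     *)
Definition digits (beta : nat) (row : seq bool) : word :=
  flatten [seq b :: nseq beta false | b <- row].
Definition spread (beta : nat) (row : seq bool) : word := [:: false, false & digits beta row].

Lemma bval_nseq_cat k w : bval (nseq k false ++ w) = 2 ^ k * bval w.
Proof. by elim: k => [|k IH] /=; rewrite ?mul1n // IH expnS -mul2n mulnA. Qed.

Lemma bval_digits_cons beta b row :
  bval (digits beta (b :: row)) = b + 2 ^ beta.+1 * bval (digits beta row).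
Proof. by rewrite /digits /= bval_nseq_cat expnS -mul2n mulnA. Qed.

Lemma bval_spread beta row : bval (spread beta row) = 4 * bval (digits beta row).
Proof. by rewrite /= -!mul2n; lia. Qed.

(** At most [beta] rows contribute to a digit, which is less than the base, so the lowest digit of
    the sum is recovered modulo the base and the others by induction. *)
Lemma digits_sum (I : finType) (p : pred I) (r : I -> seq bool) m beta :
  #|I| <= beta -> (forall i, size (r i) = m) ->
  \sum_(i | p i) bval (digits beta (r i)) = bval (digits beta (nseq m true)) <->
  (forall e, e < m -> \sum_(i | p i) nth false (r i) e = 1).
Proof.
move=> le_beta; elim: m r => [|m IH] r sz.
  split=> // _; rewrite big1 // => i _; by rewrite (size0nil (sz i)).
have rE i : r i = head false (r i) :: behead (r i) by have := sz i; case: (r i).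
have szb i : size (behead (r i)) = m by rewrite size_behead sz.
set B := 2 ^ beta.+1.
have B_gt : beta < B by apply: ltn_trans (ltnSn _) (ltn_expl _ _).
pose c := \sum_(i | p i) head false (r i).
have c_lt : c < B.
  apply: leq_ltn_trans B_gt; apply: leq_trans le_beta; rewrite -sum1_card /c big_mkcond.
  by apply: leq_sum => i _; case: (p i) => //; case: head.
have -> : \sum_(i | p i) bval (digits beta (r i)) =
    c + B * \sum_(i | p i) bval (digits beta (behead (r i))).
  rewrite big_distrr -big_split; apply: eq_bigr => i _.
  by rewrite [in LHS]rE bval_digits_cons.
rewrite -[nseq m.+1 true]/(true :: nseq m true) bval_digits_cons -/B.
have B_gt1 : 1 < B by rewrite /B expnS; have := expn_gt0 2 beta; lia.
have [IH1 IH2] := IH _ szb.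
split=> [H|H].
  have c1 : c = 1.
    by have := congr1 (modn^~ B) H; rewrite /= ![_ + B * _]addnC ![B * _]mulnC !modnMDl !modn_small.
  case=> [_|e lt_e]; first by rewrite -[RHS]c1; apply: eq_bigr => i _; rewrite nth0.
  have eqs : \sum_(i | p i) bval (digits beta (behead (r i))) = bval (digits beta (nseq m true)).
    by apply/eqP; rewrite -(eqn_pmul2l (ltnW B_gt1)) -(eqn_add2l c) {1}H c1.
  by rewrite -[RHS](IH1 eqs e lt_e); apply: eq_bigr => i _; rewrite nth_behead.
have -> : c = 1 by rewrite -(H 0 isT); apply: eq_bigr => i _; rewrite nth0.
rewrite IH2 // => e lt_e; rewrite -(H e.+1 lt_e).
by apply: eq_bigr => i _; rewrite nth_behead.
Qed.

Definition cover_items (rows : seq (seq bool)) : seq word := [seq spread (size rows) r | r <- rows].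
Definition cover_target m (rows : seq (seq bool)) : word := spread (size rows) (nseq m true).

Lemma cover_satisfiable m (rows : seq (seq bool)) : (forall r, r \in rows -> size r = m) ->
  satisfiable (gadget_graph [seq bval w | w <- cover_items rows] (bval (cover_target m rows))) <->
  exists C : pred nat, forall e, e < m ->
    \sum_(i < size rows | C i) nth false (nth [::] rows i) e = 1.
Proof.
move=> sz; set n := size rows.
have sz_a : size [seq bval w | w <- cover_items rows] = n by rewrite !size_map.
have nthE i : i < n -> nth 0 [seq bval w | w <- cover_items rows] i =
    4 * bval (digits n (nth [::] rows i)).
  by move=> lt_i; rewrite -map_comp (nth_map [::]) // /= -bval_spread.
apply: iff_trans (gadget_satisfiable _ _) _.
- by move=> x /mapP[w /mapP[r _ ->] ->]; rewrite bval_spread dvdn_mulr.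
- by rewrite bval_spread dvdn_mulr.
have sumE (C : pred nat) : \sum_(i < size [seq bval w | w <- cover_items rows] | C i)
      nth 0 [seq bval w | w <- cover_items rows] i = bval (cover_target m rows) <->
    forall e, e < m -> \sum_(i < n | C i) nth false (nth [::] rows i) e = 1.
  rewrite sz_a -(@digits_sum _ (fun i : 'I_n => C i) (fun i => nth [::] rows i) m n) ?card_ord //; last first.
    by move=> i; apply/sz/mem_nth.
  rewrite bval_spread; under [X in X = _ <-> _]eq_bigr => i _ do rewrite nthE //.
  by rewrite -big_distrr /=; split=> [/eqP|->] //; rewrite eqn_mul2l => /eqP.
by split=> -[C /sumE H]; exists C.
Qed.

Lemma fp_nseq E A {EE : Enc E} {EA : Enc A} (n : E -> nat) (c : A) : FP n -> FP (fun e => nseq (n e) c).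
Proof.
move=> Pn; apply: (fp_ext (f := fun e => [seq c | _ <- iota 0 (n e)])); last by fp.
by move=> e; elim: (n e) 0 => //= k IH j; rewrite IH.
Qed.

Lemma fp_spread E {EE : Enc E} (beta : E -> nat) (row : E -> seq bool) :
  FP beta -> FP row -> FP (fun e => spread (beta e) (row e)).
Proof.
move=> Pb Pr; rewrite /spread /digits; fp.
by apply: fp_nseq; fp.
Qed.

Lemma fp_cover_code E {EE : Enc E} (m : E -> nat) (rows : E -> seq (seq bool)) :
  FP m -> FP rows -> FP (fun e => gadget_code (cover_items (rows e)) (cover_target (m e) (rows e))).
Proof.
move=> Pm Pr; apply (fp_app2 fp_gadget_code); rewrite /cover_items /cover_target.
  by fp; apply: fp_spread; fp.
by apply: fp_spread; fp; apply: fp_nseq.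
Qed.

Lemma sum_iota_delta n q (F : nat -> nat) :
  \sum_(p <- iota 0 n) (p == q) * F p = if q < n then F q else 0.
Proof.
elim: n => [|n IH]; first by rewrite big_nil.
rewrite -addn1 iotaD big_cat IH big_seq1 add0n addn1 ltnS.
by case: (ltngtP q n) => [lt|lt|->] /=; rewrite ?eqxx ?mul0n ?addn0 ?mul1n ?addn0 ?add0n.
Qed.

Section Tilings.
Variables (O H V : finType) (right left : O -> H) (up down : O -> V).
Variables (rows cols : nat) (allowed : nat -> nat -> pred O).

Definition tiling (g : nat -> nat -> O) : Prop :=
  [/\ forall t p, t < rows -> p < cols -> allowed t p (g t p),
      forall t p, t < rows -> p.+1 < cols -> right (g t p) = left (g t p.+1) &
      forall t p, t.+1 < rows -> p < cols -> up (g t p) = down (g t.+1 p)].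

(* A tile placed at a position covers that position, the color of its right   *)
(* side at the border to the next position, and every color but the one of    *)
(* its left side at the border to the previous position; hence the border     *)
(* between two tiles is covered exactly once in every color iff the two       *)
(* colors agree. On the boundary of the grid a tile covers all colors.        *)
Definition covers (x : (nat * nat) * O) (e : (nat * nat) * option (H + V)) : bool :=
  match e.2 with
  | None => (x.1.1 == e.1.1) && (x.1.2 == e.1.2)
  | Some (inl c) => (x.1.1 == e.1.1) &&
      ((x.1.2 == e.1.2) && ((right x.2 == c) || (x.1.2.+1 == cols)) ||
       (x.1.2 == e.1.2.+1) && (left x.2 != c))
  | Some (inr c) => (x.1.2 == e.1.2) &&
      ((x.1.1 == e.1.1) && ((up x.2 == c) || (x.1.1.+1 == rows)) ||
       (x.1.1 == e.1.1.+1) && (down x.2 != c))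
  end.

Definition grid A (s : seq A) : seq ((nat * nat) * A) :=
  flatten [seq flatten [seq [seq ((t, p), c) | c <- s] | p <- iota 0 cols] | t <- iota 0 rows].

Definition placements : seq ((nat * nat) * O) :=
  [seq x <- grid (enum O) | allowed x.1.1 x.1.2 x.2].

Definition borders : seq ((nat * nat) * option (H + V)) := grid (enum {: option (H + V)}).

Definition cover_rows : seq (seq bool) := [seq [seq covers x e | e <- borders] | x <- placements].

Lemma mem_grid (A : eqType) (s : seq A) t p c :
  ((t, p, c) \in grid s) = [&& t < rows, p < cols & c \in s].
Proof.
apply/flatten_mapP/and3P => [[t' Mt /flatten_mapP[p' Mp /mapP[c' Mc [-> -> ->]]]]|[lt_t lt_p sc]].
  by move: Mt Mp; rewrite !mem_iota.
exists t; first by rewrite mem_iota.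
apply/flatten_mapP; exists p; first by rewrite mem_iota.
by apply/mapP; exists c.
Qed.

Lemma uniq_grid (A : eqType) (s : seq A) : uniq s -> uniq (grid s).
Proof.
move=> Us; have sub : grid s = [seq ((x.1, x.2.1), x.2.2) | x <-
    [seq (t, y) | t <- iota 0 rows, y <- [seq (p, c) | p <- iota 0 cols, c <- s]]].
  rewrite map_flatten -map_comp; congr (flatten _); apply: eq_map => t /=.
  rewrite -map_comp map_flatten -map_comp; congr (flatten _); apply: eq_map => p /=.
  by rewrite -map_comp.
rewrite sub map_inj_uniq; last by move=> [t [p c]] [t' [p' c']] /= [-> -> ->].
by do 2![apply: allpairs_uniq; rewrite ?iota_uniq //; try by move=> [? ?] [? ?]].
Qed.

Lemma sum_grid (A : finType) (F : (nat * nat) * A -> nat) :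
  \sum_(x <- grid (enum A)) F x =
  \sum_(t <- iota 0 rows) \sum_(p <- iota 0 cols) \sum_(c : A) F ((t, p), c).
Proof.
rewrite /grid big_flatten big_map; apply: eq_bigr => t _.
rewrite big_flatten big_map; apply: eq_bigr => p _.
by rewrite big_map big_enum.
Qed.

(** With one tile per cell, a border is met only by the tile at its position and by the next one;
    all other terms vanish. *)
Lemma coverage (X : nat -> nat -> pred O) (g : nat -> nat -> O) t p k :
  (forall t p, t < rows -> p < cols -> X t p =1 pred1 (g t p)) -> t < rows -> p < cols ->
  \sum_(t' <- iota 0 rows) \sum_(p' <- iota 0 cols) \sum_(c | X t' p' c) covers ((t', p'), c) ((t, p), k)
  = match k with
    | None => 1
    | Some (inl c) => ((right (g t p) == c) || (p.+1 == cols)) +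
        ((p.+1 < cols) && (left (g t p.+1) != c))
    | Some (inr c) => ((up (g t p) == c) || (t.+1 == rows)) +
        ((t.+1 < rows) && (down (g t.+1 p) != c))
    end.
Proof.
move=> Xg lt_t lt_p.
transitivity (\sum_(t' <- iota 0 rows) \sum_(p' <- iota 0 cols) covers ((t', p'), g t' p') ((t, p), k)).
  apply: eq_big_seq => t'; rewrite mem_iota => /= Mt; apply: eq_big_seq => p'; rewrite mem_iota => /= Mp.
  by rewrite (eq_bigl _ _ (Xg t' p' Mt Mp)) big_pred1_eq.
case: k => [[c|c]|]; rewrite /covers /=.
- transitivity (\sum_(t' <- iota 0 rows) (t' == t) * (\sum_(p' <- iota 0 cols)
     ((p' == p) * ((right (g t' p') == c) || (p'.+1 == cols)) + (p' == p.+1) * (left (g t' p') != c)))).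
    apply: eq_bigr => t' _; rewrite big_distrr; apply: eq_bigr => p' _ /=.
    case: (t' == t) => //; case: (p' =P p) => [->|_].
      by rewrite (ltn_eqF (ltnSn p)) /= orbF mul1n mul1n addn0.
    by case: (p' == p.+1); rewrite /= ?mul1n ?mul0n ?add0n.
  by rewrite sum_iota_delta lt_t big_split /= !sum_iota_delta lt_p; case: ifP.
- transitivity (\sum_(t' <- iota 0 rows) ((t' == t) * (\sum_(p' <- iota 0 cols) (p' == p) *
     ((up (g t' p') == c) || (t'.+1 == rows))) + (t' == t.+1) * \sum_(p' <- iota 0 cols) (p' == p) *
     (down (g t' p') != c))).
    apply: eq_bigr => t' _; rewrite !big_distrr -big_split; apply: eq_bigr => p' _ /=.
    case: (p' == p) => /=; last by rewrite !mul0n !muln0.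
    rewrite !mul1n; case: (t' =P t) => [->|_].
      by rewrite (ltn_eqF (ltnSn t)) /= orbF mul1n addn0.
    by case: (t' == t.+1); rewrite /= ?mul1n ?mul0n ?add0n.
  by rewrite big_split /= !sum_iota_delta lt_t lt_p; case: ifP.
transitivity (\sum_(t' <- iota 0 rows) (t' == t) * (\sum_(p' <- iota 0 cols) (p' == p) * 1)).
  apply: eq_bigr => t' _; rewrite big_distrr; apply: eq_bigr => p' _ /=.
  by case: (t' == t); case: (p' == p).
by rewrite sum_iota_delta lt_t sum_iota_delta lt_p.
Qed.

Lemma sum_placements (D : pred ((nat * nat) * O)) F :
  \sum_(x <- placements | D x) F x = \sum_(t <- iota 0 rows) \sum_(p <- iota 0 cols)
     \sum_(c | allowed t p c && D ((t, p), c)) F ((t, p), c).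
Proof.
rewrite /placements big_filter_cond big_mkcond sum_grid.
by apply: eq_bigr => t _; apply: eq_bigr => p _; rewrite [RHS]big_mkcond.
Qed.

Lemma cover_tiling (o0 : O) : (exists D : pred ((nat * nat) * O), forall e, e \in borders ->
    \sum_(x <- placements | D x) covers x e = 1) <-> exists g, tiling g.
Proof.
have memb t p k : t < rows -> p < cols -> ((t, p), k) \in borders.
  by move=> lt_t lt_p; rewrite mem_grid lt_t lt_p mem_enum.
split=> [[D HD]|[g [g_allowed g_right g_up]]]; last first.
  exists (fun x => g x.1.1 x.1.2 == x.2) => -[[t p] k]; rewrite mem_grid => /and3P[lt_t lt_p _].
  rewrite sum_placements (@coverage _ g) //; last first.
    move=> t' p' lt_t' lt_p' c /=; rewrite eq_sym; case: eqP => [->|]; rewrite ?andbF // andbT.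
    exact: g_allowed.
  case: k => [[c|c]|//].
    case: (ltnP p.+1 cols) => [lt_p1|le_p]; last by rewrite (_ : p.+1 == cols) ?orbT //; lia.
    by rewrite ltn_eqF // orbF g_right //; case: (_ == _).
  case: (ltnP t.+1 rows) => [lt_t1|le_t]; last by rewrite (_ : t.+1 == rows) ?orbT //; lia.
  by rewrite ltn_eqF // orbF g_up //; case: (_ == _).
pose X t p c := allowed t p c && D ((t, p), c).
(* Covering the element [None] at a position exactly once means that exactly one tile is placed
   there. *)
have X1 t p : t < rows -> p < cols -> \sum_(c | X t p c) 1 = 1.
  move=> lt_t lt_p; rewrite -[RHS](HD _ (memb t p None lt_t lt_p)) sum_placements.
  transitivity (\sum_(t' <- iota 0 rows) (t' == t) * (\sum_(p' <- iota 0 cols) (p' == p) *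
      \sum_(c | X t' p' c) 1)); first by rewrite sum_iota_delta lt_t sum_iota_delta lt_p.
  apply: eq_bigr => t' _; rewrite big_distrr; apply: eq_bigr => p' _ /=.
  rewrite big_distrr big_distrr; apply: eq_bigr => c _; rewrite /covers /=.
  by case: (t' == t); case: (p' == p).
pose g t p := odflt o0 [pick c | X t p c].
have Xg t p : t < rows -> p < cols -> X t p =1 pred1 (g t p).
  move=> lt_t lt_p; have := X1 t p lt_t lt_p; rewrite sum1_card /g.
  case: pickP => [c Xc /eqP|X0]; last by rewrite eq_card0.
  move=> /card1P[d Xd] e; have XE c' : X t p c' = (c' == d) by apply: Xd.
  by move: Xc; rewrite !XE => /eqP->.
have HE t p k (lt_t : t < rows) (lt_p : p < cols) :
    _ = 1 := etrans (esym (coverage k Xg lt_t lt_p)) (etrans (esym (sum_placements D _)) (HD _ (memb t p k lt_t lt_p))).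
(* Testing the colour [x] itself: it is already covered from one side, so the other side must not
   cover it. *)
have agree (T : finType) (x y : T) : (forall c, (x == c) + (y != c) = 1) -> x = y.
  by move=> /(_ x); rewrite eqxx; case: eqP.
exists g; split=> t p lt_t lt_p.
- by have := Xg t p lt_t lt_p (g t p); rewrite /= eqxx => /andP[].
- apply: agree => c; have := HE t p (Some (inl c)) lt_t (ltnW lt_p).
  by rewrite /= lt_p ltn_eqF // orbF.
apply: agree => c; have := HE t p (Some (inr c)) (ltnW lt_t) lt_p.
by rewrite /= lt_t ltn_eqF // orbF.
Qed.
End Tilings.

Section TilingGraph.
Variables (O H V : finType) (right left : O -> H) (up down : O -> V).
Variables (rows cols : nat) (allowed : nat -> nat -> pred O).

Let R := cover_rows right left up down rows cols allowed.
Let B := borders H V rows cols.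

Definition tiling_items := cover_items R.
Definition tiling_target := cover_target (size B) R.

Lemma tiling_satisfiable (o0 : O) :
  satisfiable (gadget_graph [seq bval w | w <- tiling_items] (bval tiling_target)) <->
  exists g, tiling right left up down rows cols allowed g.
Proof.
have szR r : r \in R -> size r = size B by case/mapP => x _ ->; rewrite size_map.
apply: iff_trans (cover_satisfiable szR) _.
rewrite -(cover_tiling right left up down rows cols allowed o0).
set s := placements rows cols allowed.
have sz : size R = size s by rewrite size_map.
pose x0 : (nat * nat) * O := ((0, 0), o0).
have Us : uniq s by apply/filter_uniq/uniq_grid/enum_uniq.
have sumE (C : pred nat) (D : pred ((nat * nat) * O)) e0 e : e < size B ->
    (forall i, i < size s -> C i = D (nth x0 s i)) ->
    \sum_(i < size R | C i) nth false (nth [::] R i) e =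
    \sum_(x <- s | D x) covers right left up down rows cols x (nth e0 B e).
  move=> lt_e CD; rewrite sz (big_nth x0) big_mkord.
  apply: eq_big => i; first exact/CD.
  by move=> _; rewrite (nth_map x0) // (nth_map e0).
split=> [[C HC]|[D HD]].
  exists (fun x => C (index x s)) => e Be.
  rewrite -[e](nth_index e Be) -(sumE C) ?HC ?index_mem // => i lt_i.
  by rewrite index_uniq.
exists (fun i => D (nth x0 s i)) => e lt_e.
by rewrite (sumE (fun i => D (nth x0 s i)) D ((0, 0), None)) // HD // mem_nth.
Qed.
End TilingGraph.

(** * Computing tiling instances in polynomial time *)

Definition fin_enc (T : finType) (t0 : T) : Enc T :=
  {| enc := fun t => unary (index t (enum T)); witness := t0 |}.

(** A fixed finite type allows a case distinction over all its elements, so [f] only needs to be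
    polynomial-time for each fixed value. Tiles and colours, being fixed with the machine, are
    treated this way. *)
Lemma fp_fin E A (T : finType) (t0 : T) {EE : Enc E} {EA : Enc A} (t : E -> T) (f : T -> E -> A) :
  @FP E T EE (fin_enc t0) t -> (forall x, FP (f x)) -> FP (fun e => f (t e) e).
Proof.
move=> Pt Pf.
have P (s : seq T) : FP (fun p : nat * E => f (nth t0 s p.1) p.2).
  elim: s => [|x s IH].
    by apply: (fp_ext (f := fun p : nat * E => f t0 p.2)); [move=> p; rewrite nth_nil | have Pf0 := Pf t0; fp].
  apply: (fp_ext (f := fun p : nat * E => if p.1 == 0 then f x p.2 else f (nth t0 s p.1.-1) p.2)).
    by case=> -[].
  have Pfx := Pf x; fp.
  by apply (@fp_compose _ _ _ _ _ _ (fun p : nat * E => f (nth t0 s p.1) p.2)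
    (fun p : nat * E => (p.1.-1, p.2))) => //; fp.
have Pi : FP (fun e => index (t e) (enum T)) by apply: Pt.
apply: (fp_ext (f := fun e => f (nth t0 (enum T) (index (t e) (enum T))) e)).
  by move=> e; rewrite nth_index // mem_enum.
by apply: (fp_compose (P (enum T)) (fp_pair Pi fp_id)).
Qed.

Section TilingFP.
Variables (O H V : finType) (right left : O -> H) (up down : O -> V) (o0 : O).
#[local] Instance enc_tile : Enc O := fin_enc o0.
#[local] Instance enc_color : Enc (option (H + V)) := fin_enc None.

Lemma fp_covers E {EE : Enc E} (r c : E -> nat) (x : E -> (nat * nat) * O)
    (b : E -> (nat * nat) * option (H + V)) : FP r -> FP c -> FP x -> FP b ->
  FP (fun e => covers right left up down (r e) (c e) (x e) (b e)).
Proof.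
move=> Pr Pc Px Pb.
pose f o k e := covers right left up down (r e) (c e) ((x e).1, o) ((b e).1, k).
apply: (fp_ext (f := fun e => f (x e).2 (b e).2 e)).
  by move=> e; rewrite /f -!surjective_pairing.
have Px2 : FP (fun e => (x e).2) by fp.
have Pb2 : FP (fun e => (b e).2) by fp.
apply: (fp_fin (f := fun o e => f o (b e).2 e) Px2) => o.
apply: (fp_fin (f := fun k e => f o k e) Pb2) => k.
by rewrite /f /covers; case: k => [[h|v]|] /=; fp.
Qed.

Lemma fp_grid E {EE : Enc E} A {EA : Enc A} (r c : E -> nat) (s : seq A) :
  FP r -> FP c -> FP (fun e => grid (r e) (c e) s).
Proof. by move=> Pr Pc; rewrite /grid; fp. Qed.

Lemma fp_tiling_code E {EE : Enc E} (r c : E -> nat) (allowed : E -> nat -> nat -> pred O) :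
  FP r -> FP c -> (forall o, FP (fun x : E * (nat * nat) => allowed x.1 x.2.1 x.2.2 o)) ->
  FP (fun e => gadget_code (tiling_items right left up down (r e) (c e) (allowed e))
                           (tiling_target right left up down (r e) (c e) (allowed e))).
Proof.
move=> Pr Pc Pa.
have Pal : FP (fun x : E * ((nat * nat) * O) => allowed x.1 x.2.1.1 x.2.1.2 x.2.2).
  have Po : FP (fun x : E * ((nat * nat) * O) => x.2.2) by fp.
  apply: (fp_fin (f := fun o (x : E * ((nat * nat) * O)) => allowed x.1 x.2.1.1 x.2.1.2 o) Po) => o.
  have P := Pa o; by apply (@fp_compose _ _ _ _ _ _ (fun x : E * (nat * nat) => allowed x.1 x.2.1 x.2.2 o)
    (fun x : E * ((nat * nat) * O) => (x.1, x.2.1))) => //; fp.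
have Pb : FP (fun e => borders H V (r e) (c e)) by apply: fp_grid.
have Pp : FP (fun e => placements (r e) (c e) (allowed e)).
  by rewrite /placements; apply: fp_filter => //; apply: fp_grid.
rewrite /tiling_items /tiling_target; apply: fp_cover_code; first by fp.
rewrite /cover_rows; fp; first by apply: fp_covers; fp.
by apply: fp_grid; fp.
Qed.
End TilingFP.

(** * From Turing machines to tilings *)

Section Tapes.
Variable A : finType.

(* The symbol in cell i when the head is in cell h.                           *)
Definition tape_at (T : tape A) (h i : nat) : symbol A :=
  if i < h then nth None (lefts T) (h - i).-1 else nth None (head_symbol T :: rights T) (i - h).

Definition move_position (m : move) (h : nat) : nat :=
  match m with Left => h.-1 | Stay => h | Right => h.+1 end.

Lemma tape_at_head T h : tape_at T h h = head_symbol T.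
Proof. by rewrite /tape_at ltnn subnn. Qed.

(** Positions are natural numbers, so a move to the left is tracked only from a positive
    position. *)
Lemma tape_at_move (T : tape A) a m h i : (if m is Left then 0 < h else true) ->
  tape_at (write_move (a, m) T) (move_position m h) i = if i == h then a else tape_at T h i.
Proof.
case: T => l s r; rewrite /tape_at /write_move; case: m => /=.
- case: h => // h _; rewrite [h.+1.-1]/=; case: (ltngtP i h) => [lt|lt|->].
  + have -> : (i == h.+1) = false by lia.
    have -> : i < h.+1 by lia.
    by have -> : (h.+1 - i).-1 = (h - i).-1.+1 by [lia]; rewrite nth_behead.
  + have [->|ne] := eqVneq i h.+1; first by rewrite subSnn.
    have -> : (i < h.+1) = false by lia.
    by have -> : i - h = (i - h.+1).-1.+2 by [lia]; have -> : i - h.+1 = (i - h.+1).-1.+1 by lia.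
  have -> : (h == h.+1) = false by lia.
  by rewrite ltnSn subnn subSnn /=; case: (l).
- move=> _; case: (ltngtP i h) => // [lt|->]; last by rewrite subnn.
  by have -> : i - h = (i - h).-1.+1 by lia.
move=> _; case: (ltngtP i h) => [lt|lt|->].
- have -> : i < h.+1 by lia.
  by have -> : (h.+1 - i).-1 = (h - i).-1.+1 by lia.
- have -> : (i < h.+1) = false by lia.
  have -> : i - h = (i - h.+1).+1 by lia.
  by case: (i - h.+1) => [|k]; case: (r) => //= *; rewrite ?nth_nil.
by rewrite ltnSn subSnn.
Qed.

Lemma tape_at_init (w : word) h i :
  tape_at (tape_of A w) h i = if i < h then None else nth None [seq Some (inl b) | b <- w] (i - h).
Proof.
rewrite /tape_at /=; case: ifP => _; first by rewrite nth_nil.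
by case: w => [|b w] //=; case: (i - h) => [|k] /=; rewrite ?nth_nil.
Qed.
End Tapes.

Notation cell V := {ffun 'I_(extra_tapes V).+1 -> option (bool + aux V) * bool}%type.
Notation view V := (state V * {ffun 'I_(extra_tapes V).+1 -> option (bool + aux V)})%type.
Notation tile V := (view V * ((cell V * cell V) * cell V))%type.

(* A tableau row holds the product of all tapes at one time. A tile at time t *)
(* and position p records the state and the symbols read at time t (the       *)
(* "view", the same all along the row) and the contents of the cells p-1, p,  *)
(* p+1; the content of a cell is, for each tape, a symbol and whether the     *)
(* head is there.                                                             *)
Section Tableau.
Variable V : TM.
Local Notation K := (extra_tapes V).+1.
Implicit Types (o : tile V) (c : config V).

Definition own o : cell V := o.2.1.2.
Definition prev o : cell V := o.2.1.1.
Definition succ o : cell V := o.2.2.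

Definition acts (g : view V) : state V * {ffun 'I_K -> option (bool + aux V) * move} :=
  if halting g.1 then (g.1, [ffun j => (g.2 j, Stay)]) else delta g.1 g.2.

Definition next_cell (g : view V) (l m r : cell V) : cell V :=
  [ffun j => (if (m j).2 then ((acts g).2 j).1 else (m j).1,
              match ((acts g).2 j).2 with
              | Left => (r j).2 | Stay => (m j).2 | Right => (l j).2 end)].

(** Equal horizontal colours make adjacent tiles agree on the view and on the two cells they share.
    Equal vertical colours hand on the state and the updated cell; the symbols of the next view are
    fixed by the tiles under the heads. *)
Definition tile_right o : view V * cell V * cell V := (o.1, own o, succ o).
Definition tile_left o : view V * cell V * cell V := (o.1, prev o, own o).
Definition tile_down o : state V * cell V := (o.1.1, own o).
Definition tile_up o : state V * cell V := ((acts o.1).1, next_cell o.1 (prev o) (own o) (succ o)).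

Definition blank : cell V := [ffun=> (None, false)].

Definition has_symbol (a : option (bool + aux V)) (x : word) (origin p : nat) : bool :=
  match a with
  | None => (p < origin) || (size x <= p - origin)
  | Some (inl b) => [&& origin <= p, p - origin < size x & nth false x (p - origin) == b]
  | Some (inr _) => false
  end.

Definition is_letter (a : option (bool + aux V)) : bool :=
  if a is Some (inl _) then true else false.

(** Tape 0 carries the input and tape 1 a guessed certificate: letters from the origin on, within
    [P] cells, and blank ever after the first blank. All further tapes are blank. *)
Definition initial_symbol (x : word) (P origin p : nat) o (j : 'I_K) : bool :=
  if val j == 0 then has_symbol (own o j).1 x origin p
  else if val j == 1 then
    if (p < origin) || (origin + P <= p) then (own o j).1 == None
    else if (own o j).1 == None then (succ o j).1 == None else is_letter (own o j).1
  else (own o j).1 == None.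

(** The origin is [T], so that during [T] steps no head leaves the positions 0, ..., 2T. The view
    must show the symbol under each head, cells outside the grid are blank, and the last row must be
    accepting. *)
Definition tile_allowed (x : word) (P T t p : nat) o : bool :=
  [&& [forall j, (own o j).2 ==> ((own o j).1 == o.1.2 j)],
      (p == 0) ==> (prev o == blank), (p == T + T) ==> (succ o == blank),
      (t == 0) ==> (o.1.1 == start V) && [forall j, ((own o j).2 == (p == T)) && initial_symbol x P T p o j] &
      (t == T) ==> halting o.1.1 && accepting o.1.1].

Lemma has_symbolP a x origin p : has_symbol a x origin p =
  (a == if p < origin then None else nth None [seq Some (inl b) | b <- x] (p - origin)).
Proof.
rewrite /has_symbol; case: (ltnP p origin) => [lt|le] /=; first by case: a => [[b|c]|].
have [lt_p|le_p] := ltnP (p - origin) (size x).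
  by rewrite (nth_map false) //; case: a => [[b|c]|] //; rewrite eq_sym.
by rewrite [nth None _ _]nth_default ?size_map //; case: a => [[b|c]|].
Qed.

Definition view_of c : view V := (c.1, [ffun j => head_symbol (c.2 j)]).

Lemma stepE c : step c = ((acts (view_of c)).1, [ffun j => write_move ((acts (view_of c)).2 j) (c.2 j)]).
Proof.
rewrite /step /acts /=; case: ifP => _; last by case: delta.
case: c => q T /=; congr (_, _); apply/ffunP=> j; rewrite !ffunE /write_move /=.
by case: (T j).
Qed.

Section Run.
Variables (ws : seq word) (origin : nat).

Fixpoint position (t : nat) (j : 'I_K) : nat :=
  if t is t'.+1 then move_position ((acts (view_of (run V ws t'))).2 j).2 (position t' j)
  else origin.

Lemma position_bounds t j : origin <= position t j + t /\ position t j <= origin + t.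
Proof. by elim: t => [|t IH] /=; [lia | case: (_.2)=> /=; lia]. Qed.

Definition content (t i : nat) : cell V :=
  [ffun j => (tape_at ((run V ws t).2 j) (position t j) i, i == position t j)].

(** Before time [origin] the heads lie strictly inside the window, so the truncated predecessor is
    never taken at 0 and no head enters from outside. *)
Lemma content_step t i : t < origin -> i <= origin + origin ->
  content t.+1 i = next_cell (view_of (run V ws t))
    (if i == 0 then blank else content t i.-1) (content t i)
    (if i == origin + origin then blank else content t i.+1).
Proof.
move=> lt_t le_i; apply/ffunP=> j; have [le_h ge_h] := position_bounds t j.
rewrite [LHS]ffunE [RHS]ffunE -[run V ws t.+1]/(step (run V ws t)) stepE.
rewrite [X in X j]/= [X in tape_at X]ffunE.
rewrite -[position t.+1 j]/(move_position ((acts (view_of (run V ws t))).2 j).2 (position t j)).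
case: ((acts _).2 j) => a m; rewrite [content t i j]ffunE; congr (_, _).
  by rewrite tape_at_move //; case: (m) => //; lia.
case: m => /=.
- have [->|ne] := eqVneq i (origin + origin); rewrite /blank /content ffunE /=; first by apply/eqP; lia.
  by apply/eqP/eqP; lia.
- by [].
by case: i le_i => [|i] le_i /=; rewrite /blank /content ffunE.
Qed.
End Run.

Section Correct.
Variables (x : word) (P T : nat).
Let rows := T.+1.
Let cols := (T + T).+1.

Lemma content0 ws i j : content ws T 0 i j =
  (if i < T then None else nth None [seq Some (inl b) | b <- nth [::] ws j] (i - T), i == T).
Proof. by rewrite ffunE /= ffunE tape_at_init. Qed.

Lemma tableau_complete w : size w <= P -> accepts_within V [:: x; w] T ->
  exists g, tiling tile_right tile_left tile_up tile_down rows cols (tile_allowed x P T) g.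
Proof.
move=> le_w acc; pose ws := [:: x; w]; pose G := content ws T.
exists (fun t p => (view_of (run V ws t), ((if p == 0 then blank else G t p.-1, G t p),
                    if p == T + T then blank else G t p.+1))).
split=> t p lt_t lt_p; last 2 first.
- rewrite /tile_right /tile_left /own /prev /succ /=; congr (_, _); rewrite ltn_eqF //.
- rewrite /tile_up /tile_down /own /prev /succ /= -content_step //.
  by rewrite stepE.
rewrite /tile_allowed /own /prev /succ /=; apply/and5P; split.
- apply/forallP=> j; rewrite !ffunE; apply/implyP=> /= /eqP->.
  by rewrite tape_at_head.
- by apply/implyP=> ->.
- by apply/implyP=> ->.
- apply/implyP=> /eqP->; rewrite eqxx /=; apply/forallP=> j.
  rewrite /initial_symbol /own /succ /= /G content0 /= eqxx /=.
  case: eqP => [j0|j0]; first by rewrite has_symbolP j0.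
  case: eqP => [j1|j1] /=.
    have -> : nth [::] ws j = w by rewrite [nat_of_ord j]j1.
    have [lt|le] /= := ltnP p T; first by [].
    have [le_p|lt_p1] := leqP (T + P) p.
      by rewrite nth_default ?size_map //; lia.
    have [lt_w|le_w1] := ltnP (p - T) (size w); first by rewrite (nth_map false).
    rewrite nth_default ?size_map //=; have [_|_] := eqVneq p (T + T); first by rewrite ffunE.
    rewrite content0 [nat_of_ord j]j1 /=.
    by case: ifP => // _; rewrite nth_default // size_map; lia.
  have ws2 : size ws <= j by move: j0 j1; rewrite /=; case: (nat_of_ord j) => [|[]].
  by rewrite (nth_default [::] ws2) nth_nil if_same.
by apply/implyP=> /eqP->; apply: acc.
Qed.

Lemma bit_prefix_nth (s : seq (option (bool + aux V))) :
  (forall i, i < size s -> (nth None s i == None) || is_letter (nth None s i)) ->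
  (forall i, i.+1 < size s -> nth None s i = None -> nth None s i.+1 = None) ->
  forall i, nth None [seq Some (inl b) | b <- bit_prefix s] i = nth None s i.
Proof.
elim: s => [|[[b|c]|] s IH] letters contig i //.
- case: i => [|i] //=; apply: IH => [k lt_k|k lt_k]; first exact: (letters k.+1).
  exact: (contig k.+1).
- by have := letters 0 isT.
rewrite /= nth_nil; have none k : k <= size s -> nth None (None :: s) k = None.
  by elim: k => [|k IHk] // lt_k; apply: contig => //; apply: IHk; apply: ltnW.
have [le_i|lt_i] := leqP i (size s); first by rewrite none.
by rewrite nth_default.
Qed.

Lemma size_bit_prefix (s : seq (option (bool + aux V))) : size (bit_prefix s) <= size s.
Proof. by elim: s => [|[[b|c]|] s IH] //=. Qed.

(** The certificate is read off tape 1 in the first row; induction on the rows then shows that each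
    one is the configuration of the run at that time. *)
Lemma tableau_sound g :
  tiling tile_right tile_left tile_up tile_down rows cols (tile_allowed x P T) g ->
  exists2 w, size w <= P & accepts_within V [:: x; w] T.
Proof.
move=> [g_allowed g_right g_up].
have first_row p : p < cols -> (g 0 p).1.1 = start V /\
    forall j, (own (g 0 p) j).2 = (p == T) /\ initial_symbol x P T p (g 0 p) j.
  move=> lt_p; have /and5P[_ _ _ /= /andP[/eqP-> /forallP H] _] := g_allowed 0 p isT lt_p.
  by split=> // j; have /andP[/eqP-> ->] := H j.
have g_succ t p : t < rows -> p.+1 < cols -> succ (g t p) = own (g t p.+1).
  by move=> lt_t lt_p; have [_ _ ->] := g_right t p lt_t lt_p.
have g_prev t p : t < rows -> p.+1 < cols -> prev (g t p.+1) = own (g t p).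
  by move=> lt_t lt_p; have [_ -> _] := g_right t p lt_t lt_p.
have g_view t p : t < rows -> p < cols -> (g t p).1 = (g t 0).1.
  move=> lt_t; elim: p => // p IH lt_p; rewrite -(IH (ltnW lt_p)).
  by have [-> _ _] := g_right t p lt_t lt_p.
(* Only [T.+1] cells from the origin on belong to the grid, so the certificate is cut there. *)
pose s (j : 'I_K) := [seq (own (g 0 (T + i)) j).1 | i <- iota 0 (minn P T.+1)].
(* The machine may have a single tape; then no certificate is read and the empty word is taken. *)
pose w := if insub 1 is Some j then bit_prefix (s j) else [::].
have lt_iT i : i < minn P T.+1 -> T + i < cols by rewrite /cols; lia.
have sE (j : 'I_K) : val j = 1 -> forall i,
    nth None [seq Some (inl b) | b <- bit_prefix (s j)] i = nth None (s j) i.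
  move=> j1; have sz : size (s j) = minn P T.+1 by rewrite size_map size_iota.
  have nthE i : i < minn P T.+1 -> nth None (s j) i = (own (g 0 (T + i)) j).1.
    by move=> lt_i; rewrite (nth_map 0) ?size_iota // nth_iota.
  have init i : i < minn P T.+1 -> if nth None (s j) i == None then (succ (g 0 (T + i)) j).1 == None
      else is_letter (nth None (s j) i).
    move=> lt_i; have [_ H] := first_row _ (lt_iT i lt_i).
    have [_] := H j; rewrite /initial_symbol j1 /= ifF -?nthE //; lia.
  apply: bit_prefix_nth => i; rewrite sz => lt_i.
    by have := init i lt_i; case: eqP.
  move=> si; have := init i (ltnW lt_i); rewrite si eqxx g_succ //; last first.
    by rewrite -addnS; apply: lt_iT.
  by rewrite -addnS -nthE // => /eqP.
pose ws := [:: x; w].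
have le_w : size w <= P.
  rewrite /w; case: insub => // j; apply: leq_trans (size_bit_prefix _) _.
  by rewrite size_map size_iota geq_minl.
have row0 p : p < cols -> own (g 0 p) = content ws T 0 p.
  move=> lt_p; apply/ffunP=> j; have [_ /(_ j)[Df]] := first_row p lt_p.
  rewrite content0 [LHS]surjective_pairing Df /initial_symbol => Ds; congr (_, _); move: Ds.
  case: eqP => [j0|j0]; first by rewrite has_symbolP [nat_of_ord j]j0 => /eqP.
  case: eqP => [j1|j1]; last first.
    have ws2 : size ws <= j by move: j0 j1; rewrite /=; case: (nat_of_ord j) => [|[]].
    by move=> /eqP->; rewrite (nth_default [::] ws2) nth_nil if_same.
  have Dw : w = bit_prefix (s j).
    rewrite /w; case: insubP => [j' _ j'1|]; last by rewrite -j1 ltn_ord.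
    by have -> : j' = j by apply: val_inj; rewrite j'1 j1.
  rewrite j1 /= Dw sE //; have [lt /=|le /=] := ltnP p T; first by move/eqP.
  have [le_p /eqP->|lt_p1 _] := leqP (T + P) p.
    by rewrite nth_default // size_map size_iota; lia.
  have lt_i : p - T < minn P T.+1 by move: lt_p; rewrite /cols; lia.
  by rewrite (nth_map 0) ?size_iota // nth_iota // add0n subnKC.
have rowt t p : t < rows -> p < cols -> own (g t p) = content ws T t p /\ (g t p).1.1 = (run V ws t).1.
  elim: t p => [|t IH] p lt_t lt_p.
    by split; [apply: row0 | have [-> _] := first_row p lt_p].
  have lt_t' : t < rows by apply: ltnW.
  have ownE q : q < cols -> own (g t q) = content ws T t q by move=> /(IH q lt_t')[].
  (* All tiles of a row share one view, and the tile at the position of the head on tape [j] forces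
     the symbol it shows for [j]. *)
  have viewE : (g t p).1 = view_of (run V ws t).
    rewrite [LHS]surjective_pairing /view_of; have [_ ->] := IH p lt_t' lt_p; congr (_, _).
    apply/ffunP=> j; rewrite ffunE; have [le_h ge_h] := position_bounds ws T t j.
    have lt_h : position ws T t j < cols by rewrite /cols; rewrite /rows in lt_t; lia.
    have /and5P[/forallP/(_ j) + _ _ _ _] := g_allowed t _ lt_t' lt_h.
    rewrite ownE // ffunE /= eqxx tape_at_head /= => /eqP->.
    by rewrite g_view // -(g_view t _ lt_t' lt_h).
  have [Dq Dc] := g_up t p lt_t lt_p.
  split; last by rewrite -Dq viewE /run iterS -/(run V ws t) stepE.
  have /and5P[_ /implyP prev0 /implyP succT _ _] := g_allowed t p lt_t' lt_p.
  rewrite -Dc viewE content_step; [|by rewrite -ltnS|by rewrite -ltnS].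
  rewrite (ownE p) //; congr next_cell.
    case: eqP => [/eqP/prev0/eqP //|/eqP]; case: (p) lt_p => // q lt_q _.
    by rewrite g_prev // ownE // ltnW.
  case: eqP => [/eqP/succT/eqP //|ne].
  have lt_p1 : p.+1 < cols by rewrite /cols in lt_p *; lia.
  by rewrite g_succ // ownE.
exists w => //; rewrite /accepts_within /halts_within.
have /and5P[_ _ _ _] := g_allowed T 0 (ltnSn T) isT; rewrite eqxx /=.
by have [_ ->] := rowt T 0 (ltnSn T) isT.
Qed.
End Correct.
End Tableau.

(** * NP-hardness *)

Lemma fp_implb E {EE : Enc E} (b c : E -> bool) : FP b -> FP c -> FP (fun e => b e ==> c e).
Proof. by move=> Pb Pc; apply: (fp_if Pb); fp. Qed.

Lemma fp_forall E {EE : Enc E} (J : finType) (p : J -> E -> bool) :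
  (forall j, FP (p j)) -> FP (fun e => [forall j, p j e]).
Proof.
move=> Pp; apply: (fp_ext (f := fun e => all (fun j => p j e) (enum J))).
  by move=> e; apply/allP/forallP => [H j|H j _]; [apply: H; rewrite mem_enum | apply: H].
elim: (enum J) => [|j s IH] /=; first exact: fp_const.
exact: fp_and.
Qed.

Section Reduction.
Variables (V : TM) (c k d l : nat).

Let certificate_bound (x : word) := pbound c k (size x).
Let time_bound (x : word) := pbound d l (size x).

Let allowed (x : word) := @tile_allowed V x (certificate_bound x) (time_bound x).

Lemma fp_has_symbol E {EE : Enc E} (a : option (bool + aux V)) (x : E -> word) (o p : E -> nat) :
  FP x -> FP o -> FP p -> FP (fun e => has_symbol a (x e) (o e) (p e)).
Proof. by move=> Px Po Pp; rewrite /has_symbol; case: a => [[b|q]|]; fp. Qed.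

Lemma fp_tile_allowed (o : tile V) :
  FP (fun x : word * (nat * nat) => allowed x.1 x.2.1 x.2.2 o).
Proof.
have Px : FP (fun x : word * (nat * nat) => x.1) by fp.
have Pp : FP (fun x : word * (nat * nat) => x.2.2) by fp.
have PP : FP (fun x : word * (nat * nat) => certificate_bound x.1).
  by rewrite /certificate_bound /pbound; fp.
have PT : FP (fun x : word * (nat * nat) => time_bound x.1).
  by rewrite /time_bound /pbound; fp.
have Pi j : FP (fun x : word * (nat * nat) =>
    initial_symbol x.1 (certificate_bound x.1) (time_bound x.1) x.2.2 o j).
  by rewrite /initial_symbol; fp; apply: fp_has_symbol.
rewrite /allowed /tile_allowed; apply: fp_and; first by fp.
apply: fp_and; first by apply: fp_implb; fp.
apply: fp_and; first by apply: fp_implb; fp.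
apply: fp_and; last by apply: fp_implb; fp.
apply: fp_implb; first by fp.
apply: fp_and; first by fp.
by apply: fp_forall => j; fp.
Qed.

Let rows (x : word) := (time_bound x).+1.
Let cols (x : word) := (time_bound x + time_bound x).+1.

Definition reduction_items (x : word) :=
  tiling_items (@tile_right V) (@tile_left V) (@tile_up V) (@tile_down V) (rows x) (cols x) (allowed x).
Definition reduction_target (x : word) :=
  tiling_target (@tile_right V) (@tile_left V) (@tile_up V) (@tile_down V) (rows x) (cols x) (allowed x).

Definition reduction_graph (x : word) : constraint_graph :=
  gadget_graph [seq bval w | w <- reduction_items x] (bval (reduction_target x)).

Let tile0 : tile V := ((start V, [ffun=> None]), ((blank V, blank V), blank V)).

Lemma reduction_satisfiable x : satisfiable (reduction_graph x) <->
  exists w, size w <= certificate_bound x /\ accepts_within V [:: x; w] (time_bound x).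
Proof.
apply: iff_trans (tiling_satisfiable _ _ _ _ _ _ _ tile0) _.
split=> [[g /tableau_sound[w]]|[w [le_w acc]]]; first by exists w.
exact: tableau_complete acc.
Qed.

Lemma fp_reduction : FP (fun x => code_graph (reduction_graph x)).
Proof.
apply: (fp_ext (f := fun x => gadget_code (reduction_items x) (reduction_target x))).
  by move=> x; rewrite gadget_codeE.
apply: (fp_tiling_code _ _ _ _ tile0); last exact: fp_tile_allowed.
  by rewrite /rows /time_bound /pbound; fp.
by rewrite /cols /time_bound /pbound; fp.
Qed.
End Reduction.

Lemma cgs_NP_hard : NP_hard (@restrict constraint_graph_satisfiability
  (fun G : constraint_graph => has_treewidth (@edge G) 2)).
Proof.
move=> L [V [c [k [d [l HV]]]]].
pose R := @reduction_graph V c k d l.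
have Pf : FP (fun x : word * word => code_graph (R x.1)).
  by apply: (fp_compose (fp_reduction V c k d l)); fp.
have [M [j HM]] := output_machine (ptime_reindex (fun u : word => (u, [::])) Pf).
have [c' [k' Hp]] : exists c' k', forall n, n.+2 ^ j <= pbound c' k' n by apply: poly_pbound; polyt.
exists (fun x => exist _ (R x) (gadget_treewidth _ _)), M, c', k' => x.
split; first by apply: HM; apply: Hp.
by have [_ yesE] := HV x; apply: iff_trans yesE _; apply: iff_sym; apply: reduction_satisfiable.
Qed.

Theorem theorem7 :
  weakly_NP_complete
    (@restrict constraint_graph_satisfiability
       (fun G : constraint_graph => has_treewidth (@edge G) 2)).
Proof.
split; [exact: cgs_in_NP | exact: cgs_NP_hard | exact: cgs_pseudo_polynomial].
Qed.
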